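(* Let $A\in\{\mathbb{C},\mathbb{H},\mathbb{O}\}$, let $\widetilde\Omega\subseteq A$ be a circular open set, let $y\in\widetilde\Omega\setminus\mathbb{R}$ and set $\Omega:=\widetilde\Omega\setminus\mathbb{S}_y$. If $f\in\mathcal{SR}(\Omega)$, then one of the following assertions holds: 1. Every point of $\mathbb{S}_y$ is a removable singularity for $f$, i.e., $f$ extends to a slice regular function on $\widetilde\Omega$. It holds $\mathrm{ord}_f(\mathbb{S}_y)=0$ and $\mathrm{ord}_f(w)=0$ for all $w\in\mathbb{S}_y$. 2. Every point of $\mathbb{S}_y$ is a non removable pole for $f$. There exists $k\in\mathbb{N}\setminus\{0\}$ such that the function defined on $\Omega$ by the expression $x\mapsto\Delta_y^k(x)f(x)$ extends to a slice regular function $g\in\mathcal{SR}(\widetilde\Omega)$ that has at most one zero in $\mathbb{S}_y$. It holds $\mathrm{ord}_f(\mathbb{S}_y)=2k$. Moreover, $\mathrm{ord}_f(w)=k$ and $\lim_{\Omega\ni x\to w}|f(x)|=+\infty$ for all $w$ in $\mathbb{S}_y$ except the possible zero of $g$, which must have order less than $k$. 3. Every point $w\in\mathbb{S}_y$, except at most one, is an essential singularity, i.e., $\mathrm{ord}_f(w)=+\infty$. It holds $\mathrm{ord}_f(\mathbb{S}_y)=+\infty$. For all neighbourhoods $U$ of $\mathbb{S}_y$ in $\widetilde\Omega$ and for all $k\in\mathbb{N}$, $$\sup_{x\in U\setminus\mathbb{S}_y}|\Delta_y^k(x)f(x)|=+\infty.$$ In particular, to check which is the case it suffices to check whether $\mathrm{ord}_f(y),\mathrm{ord}_f(y^c)$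 are both $0$, both finite (but not both $0$) or not both finite; or, equivalently (if $J\in\mathbb{S}$ is such that $y\in\mathbb{C}_J\setminus\mathbb{R}$), whether the function defined on $\Omega_J:=\Omega\cap\mathbb{C}_J$ by the expression $z\mapsto(z-y)^k(z-y^c)^kf(z)$ is bounded near $y$ and $y^c$ for $k=0$, for some finite $k$, or for no $k\in\mathbb{N}$.
   Context: $A$ is one of the real $*$-algebras $\mathbb{C},\mathbb{H},\mathbb{O}$ (complex numbers, quaternions, octonions) with standard conjugation $x\mapsto x^c$, Euclidean norm $|\cdot|$ and topology; $t(x)=x+x^c$, $n(x)=xx^c=|x|^2$, $\operatorname{Re}(x)=t(x)/2$, $\operatorname{Im}(x)=x-\operatorname{Re}(x)$; $\mathbb{S}=\{w\in A: w^2=-1\}$, $\mathbb{C}_J=\mathbb{R}+\mathbb{R}J$ for $J\in\mathbb{S}$; for $x=\alpha+\beta J$, $\mathbb{S}_x=\{\alpha+\beta I: I\in\mathbb{S}\}$. For nonempty $D\subseteq\mathbb{C}$ invariant under complex conjugation, $\Omega_D=\{\alpha+\beta J:\alpha,\beta\in\mathbb{R},\,J\in\mathbb{S},\,\alpha+i\beta\in D\}$; sets of this form are called circular. For $D$ open and $\Omega=\Omega_D$, $\mathcal{SR}(\Omega)$ is the set of slice regular functions: functions $f:\Omega\to A$ for which there are $C^1$ functions $F_1,F_2:D\to A$ with $F_1(\bar z)=F_1(z)$, $F_2(\bar z)=-F_2(z)$, $f(\alpha+\beta J)=F_1(\alpha+i\beta)+JF_2(\alpha+i\beta)$ for all $\alpha+i\beta\in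 D$, $J\in\mathbb{S}$, and $\partial F_1/\partial\alpha=\partial F_2/\partial\beta$, $\partial F_1/\partial\beta=-\partial F_2/\partial\alpha$. The slice product $f\cdot g$ corresponds to $(F_1G_1-F_2G_2,\;F_1G_2+F_2G_1)$. Let $\Delta_y(x)=x^2-xt(y)+n(y)$ (zero set $\mathbb{S}_y$). For $n\in\mathbb{Z}$, $(x-y)^{\bullet n}$ denotes the $n$-th power of the function $x\mapsto x-y$ with respect to the slice product, where the inverse is $(x-y)^{-\bullet}=\Delta_y(x)^{-1}(x-y^c)$ on $A\setminus\mathbb{S}_y$; $(x-y)^{\bullet n}\cdot a$ is the slice product with the constant $a$. If $x,y$ lie in a common $\mathbb{C}_J$, set $\sigma(x,y)=\tau(x,y)=|x-y|$; otherwise set $\sigma(x,y)=\sqrt{(\operatorname{Re}x-\operatorname{Re}y)^2+(|\operatorname{Im}x|+|\operatorname{Im}y|)^2}$ and $\tau(x,y)=\sqrt{(\operatorname{Re}x-\operatorname{Re}y)^2+(|\operatorname{Im}x|-|\operatorname{Im}y|)^2}$. Let $\Sigma(y,R_1,R_2)=\{x\in A:\tau(x,y)>R_1,\ \sigma(x,y)<R_2\}$, $\mathrm{u}(x,y)=\sqrt{|\Delta_y(x)|}$, $\mathrm{U}(y,r)=\{x:\mathrm{u}(x,y)<r\}$, $\mathrm{U}(y,r_1,r_2)=\{x: r_1<\mathrm{u}(x,y)<r_2\}$, $\mathrm{U}_J(y,r)=\mathrm{U}(y,r)\cap\mathbb{C}_J$. A point $y$ is a singularity for $f\in\mathcal{SR}(\Omega)$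 if $\Sigma(y,0,R)\subseteq\Omega$ for some $R>0$. Then there is a unique sequence $\{a_n\}_{n\in\mathbb{Z}}$ in $A$ with $f(x)=\sum_{n\in\mathbb{Z}}(x-y)^{\bullet n}\cdot a_n$ in $\Sigma(y,0,R)$. The point $y$ is a pole for $f$ if there is $m\ge0$ with $a_n=0$ for all $n<-m$; the minimum such $m$ is the order $\mathrm{ord}_f(y)$. If $y$ is not a pole, it is an essential singularity and $\mathrm{ord}_f(y)=+\infty$. The point $y$ is a removable singularity if $f$ extends to a slice regular function on a circular open set containing $y$. If $\mathrm{U}(y,0,r_2)\subseteq\Omega$ with $r_2>0$ and $y\in\mathbb{C}_J$, then $f(x)=\sum_{k\in\mathbb{Z}}\Delta_y^k(x)(xu_k+v_k)$ on $\mathrm{U}(y,0,r_2)$, where, for $0<r<r_2$, $u_k=(2\pi J)^{-1}\int_{\partial\mathrm{U}_J(y,r)}d\zeta\,\Delta_y(\zeta)^{-k-1}f(\zeta)$ and $v_k=(2\pi J)^{-1}\int_{\partial\mathrm{U}_J(y,r)}d\zeta\,(\zeta-2\operatorname{Re}(y))\Delta_y(\zeta)^{-k-1}f(\zeta)$. The spherical order $\mathrm{ord}_f(\mathbb{S}_y)$ is the smallest even natural number $2k_0$ such that $u_k=0=v_k$ for all $k<-k_0$, and $+\infty$ if no such $k_0$ exists. *)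

(* Defs.v *)
From Stdlib Require Import Reals ZArith Lra ClassicalEpsilon.
From Coquelicot Require Import Coquelicot.

Set Implicit Arguments.
Unset Strict Implicit.
Unset Printing Implicit Defensive.

Open Scope R_scope.

(** * The real *-algebras C, H, O *)

(** Iterated Cayley-Dickson doubling of R: [CD 1], [CD 2], [CD 3] are the complex
    numbers, the quaternions and the octonions.  Coquelicot's product norm is
    sqrt (|a|^2 + |b|^2), so [norm] is the Euclidean norm. *)
Fixpoint CD (d : nat) : NormedModule R_AbsRing :=
  match d with
  | O => R_NormedModule
  | S d' => prod_NormedModule R_AbsRing (CD d') (CD d')
  end.

Fixpoint cd_one (d : nat) : CD d :=
  match d return CD d with
  | O => 1
  | S d' => (cd_one d', zero)
  end.

Arguments cd_one {d}.

Fixpoint cd_conj (d : nat) : CD d -> CD d :=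
  match d return CD d -> CD d with
  | O => fun x => x
  | S d' => fun x => (cd_conj (fst x), opp (snd x))
  end.

Fixpoint cd_mul (d : nat) : CD d -> CD d -> CD d :=
  match d return CD d -> CD d -> CD d with
  | O => fun x y => Rmult x y
  | S d' => fun x y =>
      (minus (cd_mul (fst x) (fst y)) (cd_mul (cd_conj (snd y)) (snd x)),
       plus (cd_mul (snd y) (fst x)) (cd_mul (snd x) (cd_conj (fst y))))
  end.

Declare Scope cd_scope.
Delimit Scope cd_scope with cd.
Notation "x + y" := (plus x y) : cd_scope.
Notation "x - y" := (minus x y) : cd_scope.
Notation "- x" := (opp x) : cd_scope.
Notation "x * y" := (cd_mul x y) : cd_scope.

Definition cd_real d (r : R) : CD d := scal r cd_one.
Arguments cd_real {d} r%_R_scope.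

(** [Re x] as an element of R; see [cd_t_re] below for [t x = 2 Re x]. *)
Fixpoint cd_re (d : nat) : CD d -> R :=
  match d return CD d -> R with
  | O => fun x => x
  | S d' => fun x => cd_re (fst x)
  end.

Definition cd_im d (x : CD d) : CD d := (x - cd_real (cd_re x))%cd.
Definition cd_t d (x : CD d) : CD d := (x + cd_conj x)%cd.
Definition cd_n d (x : CD d) : CD d := (x * cd_conj x)%cd.

Definition cd_inv d (x : CD d) : CD d := scal (/ (norm x) ^ 2) (cd_conj x).

Fixpoint cd_pow d (x : CD d) (n : nat) : CD d :=
  match n with
  | O => cd_one
  | S m => (x * cd_pow x m)%cd
  end.

Definition cd_zpow d (x : CD d) (k : Z) : CD d :=
  match k with
  | Z0 => cd_one
  | Zpos p => cd_pow x (Pos.to_nat p)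
  | Zneg p => cd_pow (cd_inv x) (Pos.to_nat p)
  end.
Arguments cd_zpow {d} x k%_Z_scope.

(** * Slices, spheres, circular sets *)

Definition imag_unit d (J : CD d) : Prop := (J * J)%cd = opp cd_one.

Definition slice_pt d (a b : R) (J : CD d) : CD d := (cd_real a + scal b J)%cd.
Arguments slice_pt {d} (a b)%_R_scope J.

Definition slice d (J : CD d) (x : CD d) : Prop := exists a b, x = slice_pt a b J.

Definition sphere d (x : CD d) (w : CD d) : Prop :=
  exists a b J I, imag_unit J /\ imag_unit I /\ x = slice_pt a b J /\ w = slice_pt a b I.

Definition conj_invariant (D : C -> Prop) : Prop := forall z, D z -> D (Cconj z).

Definition Omega_of d (D : C -> Prop) (x : CD d) : Prop :=
  exists a b J, imag_unit J /\ D (a, b) /\ x = slice_pt a b J.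

Definition circular d (Om : CD d -> Prop) : Prop :=
  exists D : C -> Prop,
    (exists z, D z) /\ conj_invariant D /\ (forall x, Om x <-> Omega_of D x).

(** * Slice regular functions

    A function on a subset is a total function of which only the values on that
    subset are used. *)

(** [Fa], [Fb] are the partial derivatives of [F] on the open set [D], and are
    continuous there. *)
Definition C1_on d (D : C -> Prop) (F Fa Fb : C -> CD d) : Prop :=
  forall z, D z ->
    is_derive (fun t : R => F (t, snd z)) (fst z) (Fa z) /\
    is_derive (fun t : R => F (fst z, t)) (snd z) (Fb z) /\
    continuous Fa z /\ continuous Fb z.

(** [(F1, F2)] is even-odd with respect to complex conjugation, and induces [f]. *)
Definition slice_stem d (D : C -> Prop) (F1 F2 : C -> CD d) (f : CD d -> CD d) : Prop :=
  (forall z, D z -> F1 (Cconj z) = F1 z /\ F2 (Cconj z) = opp (F2 z)) /\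
  (forall a b J, D (a, b) -> imag_unit J ->
     f (slice_pt a b J) = (F1 (a, b) + J * F2 (a, b))%cd).

Definition slice_regular d (Om : CD d -> Prop) (f : CD d -> CD d) : Prop :=
  exists D : C -> Prop,
    (exists z, D z) /\ open D /\ conj_invariant D /\ (forall x, Om x <-> Omega_of D x) /\
    exists F1 F2 F1a F1b F2a F2b : C -> CD d,
      slice_stem D F1 F2 f /\ C1_on D F1 F1a F1b /\ C1_on D F2 F2a F2b /\
      (forall z, D z -> F1a z = F2b z /\ F1b z = opp (F2a z)).

Definition extends d (Om : CD d -> Prop) (f : CD d -> CD d)
    (Om' : CD d -> Prop) (g : CD d -> CD d) : Prop :=
  (forall x, Om x -> Om' x) /\ (forall x, Om x -> g x = f x).

(** * Slice product *)

(** A fixed imaginary unit (for [d >= 1]), used only to recover the stem function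
    of a slice function from its values; the result does not depend on this
    choice, see [stem_of_slice]. *)
Definition J0 d : CD d :=
  match d return CD d with
  | O => zero
  | S d' => (zero, cd_one)
  end.
Arguments J0 {d}.

Definition stem1 d (f : CD d -> CD d) (z : C) : CD d :=
  scal (/ 2) (f (slice_pt (fst z) (snd z) J0) + f (slice_pt (fst z) (- snd z) J0))%cd.

Definition stem2 d (f : CD d -> CD d) (z : C) : CD d :=
  opp (J0 * scal (/ 2) (f (slice_pt (fst z) (snd z) J0) - f (slice_pt (fst z) (- snd z) J0)))%cd.

(** The slice function with stem [(F1, F2)], written at
    [x = Re x + |Im x| (Im x / |Im x|)]; for real [x] the second summand is zero,
    as it has to be because [F2] vanishes on R. *)
Definition induced d (F1 F2 : C -> CD d) (x : CD d) : CD d :=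
  (F1 (cd_re x, norm (cd_im x)) +
   scal (/ norm (cd_im x)) (cd_im x) * F2 (cd_re x, norm (cd_im x)))%cd.

Definition slice_mul d (f g : CD d -> CD d) : CD d -> CD d :=
  induced (fun z => stem1 f z * stem1 g z - stem2 f z * stem2 g z)%cd
          (fun z => stem1 f z * stem2 g z + stem2 f z * stem1 g z)%cd.

Fixpoint slice_pow d (f : CD d -> CD d) (n : nat) : CD d -> CD d :=
  match n with
  | O => fun _ => cd_one
  | S m => slice_mul f (slice_pow f m)
  end.

Definition Delta d (y x : CD d) : CD d := (x * x - x * cd_t y + cd_n y)%cd.

(** (x - y)^{bullet n}, with (x - y)^{-bullet} = Delta_y(x)^{-1} (x - y^c). *)
Definition bullet d (y : CD d) (n : Z) : CD d -> CD d :=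
  match n with
  | Z0 => fun _ => cd_one
  | Zpos p => slice_pow (fun x => x - y)%cd (Pos.to_nat p)
  | Zneg p => slice_pow (fun x => cd_inv (Delta y x) * (x - cd_conj y))%cd (Pos.to_nat p)
  end.

(** * Shells *)

Definition same_slice d (x y : CD d) : Prop :=
  exists J, imag_unit J /\ slice J x /\ slice J y.

Definition sigma d (x y : CD d) : R :=
  if excluded_middle_informative (same_slice x y) then norm (x - y)%cd
  else sqrt ((cd_re x - cd_re y) ^ 2 + (norm (cd_im x) + norm (cd_im y)) ^ 2).

Definition tau d (x y : CD d) : R :=
  if excluded_middle_informative (same_slice x y) then norm (x - y)%cd
  else sqrt ((cd_re x - cd_re y) ^ 2 + (norm (cd_im x) - norm (cd_im y)) ^ 2).

Definition Shell d (y : CD d) (R1 R2 : R) (x : CD d) : Prop :=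
  tau x y > R1 /\ sigma x y < R2.

Definition cassini_u d (x y : CD d) : R := sqrt (norm (Delta y x)).

(** U(y, r1, r2) *)
Definition cassini_shell d (y : CD d) (r1 r2 : R) (x : CD d) : Prop :=
  r1 < cassini_u x y < r2.

(** * Laurent expansions and orders *)

(** A series indexed by Z converges when its parts over [n >= 0] and [n < 0] do. *)
Definition is_zseries d (b : Z -> CD d) (l : CD d) : Prop :=
  exists l1 l2 : CD d,
    is_series (fun n : nat => b (Z.of_nat n)) l1 /\
    is_series (fun n : nat => b (- Z.of_nat (S n))%Z) l2 /\
    l = (l1 + l2)%cd.

Definition singularity d (Om : CD d -> Prop) (y : CD d) : Prop :=
  exists r, 0 < r /\ forall x, Shell y 0 r x -> Om x.

Definition laurent d (Om : CD d -> Prop) (f : CD d -> CD d) (y : CD d) (a : Z -> CD d) : Prop :=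
  exists r, 0 < r /\ (forall x, Shell y 0 r x -> Om x) /\
    forall x, Shell y 0 r x ->
      is_zseries (fun n => slice_mul (bullet y n) (fun _ => a n) x) (f x).

Definition pole_bound d (Om : CD d -> Prop) (f : CD d -> CD d) (y : CD d) (m : nat) : Prop :=
  exists a, laurent Om f y a /\ forall n : Z, (n < - Z.of_nat m)%Z -> a n = zero.

Definition pole d (Om : CD d -> Prop) (f : CD d -> CD d) (y : CD d) : Prop :=
  exists m, pole_bound Om f y m.

Definition essential d (Om : CD d -> Prop) (f : CD d -> CD d) (y : CD d) : Prop :=
  singularity Om y /\ ~ pole Om f y.

Definition removable d (Om : CD d -> Prop) (f : CD d -> CD d) (y : CD d) : Prop :=
  singularity Om y /\
  exists (Om' : CD d -> Prop) (g : CD d -> CD d),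
    circular Om' /\ open Om' /\ Om' y /\ slice_regular Om' g /\ extends Om f Om' g.

(** The greatest lower bound of a set of natural numbers in the extended reals is its
    minimum, and [p_infty] when the set is empty. *)
Definition ord d (Om : CD d -> Prop) (f : CD d -> CD d) (y : CD d) : Rbar :=
  Glb_Rbar (fun r => exists m : nat, r = INR m /\ pole_bound Om f y m).

(** The integral of [dzeta h(zeta)] over the positively oriented boundary of
    U_J(y, r), for [0 < r] and [r <> |Im y|].  That boundary is the set of the
    [zeta] in C_J with [Delta_y(zeta) = r^2 exp(J theta)] for some [theta] in
    [0, 2 PI]; each [theta] gives exactly two such points, whence two differentiable
    branches which together run once through the boundary (two loops if
    [r < |Im y|], two halves of one loop if [r > |Im y|]).  For [r = |Im y| > 0]
    the boundary has a crossing point and there are no differentiable branches. *)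
Definition is_cassini_int d (J y : CD d) (r : R) (h : CD d -> CD d) (l : CD d) : Prop :=
  exists (g1 g2 dg1 dg2 : R -> CD d) (l1 l2 : CD d),
    (forall th, slice J (g1 th) /\ slice J (g2 th) /\ g1 th <> g2 th /\
       Delta y (g1 th) = slice_pt (r ^ 2 * cos th) (r ^ 2 * sin th) J /\
       Delta y (g2 th) = slice_pt (r ^ 2 * cos th) (r ^ 2 * sin th) J /\
       is_derive g1 th (dg1 th) /\ is_derive g2 th (dg2 th)) /\
    is_RInt (fun th => dg1 th * h (g1 th))%cd 0 (2 * PI) l1 /\
    is_RInt (fun th => dg2 th * h (g2 th))%cd 0 (2 * PI) l2 /\
    l = (l1 + l2)%cd.

Definition is_cassini_coef d (J y : CD d) (r : R) (h : CD d -> CD d) (c : CD d) : Prop :=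
  exists l, is_cassini_int J y r h l /\ c = (cd_inv (scal (2 * PI)%R J) * l)%cd.

Definition spherical_laurent d (Om : CD d -> Prop) (f : CD d -> CD d) (y : CD d)
    (u v : Z -> CD d) : Prop :=
  exists r2, 0 < r2 /\ (forall x, cassini_shell y 0 r2 x -> Om x) /\
    (forall x, cassini_shell y 0 r2 x ->
       is_zseries (fun k => cd_zpow (Delta y x) k * (x * u k + v k))%cd (f x)) /\
    (forall (J : CD d) r k, imag_unit J -> slice J y ->
       0 < r < r2 -> r <> norm (cd_im y) ->
       is_cassini_coef J y r
         (fun ze => cd_zpow (Delta y ze) (- k - 1) * f ze)%cd (u k) /\
       is_cassini_coef J y r
         (fun ze => (ze - cd_real (2 * cd_re y)) *
                    (cd_zpow (Delta y ze) (- k - 1) * f ze))%cd (v k)).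

Definition sph_ord d (Om : CD d -> Prop) (f : CD d -> CD d) (y : CD d) : Rbar :=
  Glb_Rbar (fun r => exists k0 : nat, r = INR (2 * k0) /\
    exists u v, spherical_laurent Om f y u v /\
      forall k : Z, (k < - Z.of_nat k0)%Z -> u k = zero /\ v k = zero).

(** * The three cases, for [f] slice regular on [Omt] minus the sphere of [y] *)

Definition off_sphere d (Omt : CD d -> Prop) (y x : CD d) : Prop := Omt x /\ ~ sphere y x.

Definition removable_case d (Omt : CD d -> Prop) (y : CD d) (f : CD d -> CD d) : Prop :=
  let Om := off_sphere Omt y in
  (forall w, sphere y w -> removable Om f w) /\
  (exists g, slice_regular Omt g /\ extends Om f Omt g) /\
  sph_ord Om f y = Finite 0 /\
  (forall w, sphere y w -> ord Om f w = Finite 0).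

Definition polar_case d (Omt : CD d -> Prop) (y : CD d) (f : CD d -> CD d) : Prop :=
  let Om := off_sphere Omt y in
  (forall w, sphere y w -> pole Om f w /\ ~ removable Om f w) /\
  exists k : nat, k <> O /\
    exists g,
      slice_regular Omt g /\
      extends Om (fun x => cd_pow (Delta y x) k * f x)%cd Omt g /\
      (forall w1 w2, sphere y w1 -> sphere y w2 -> g w1 = zero -> g w2 = zero -> w1 = w2) /\
      sph_ord Om f y = Finite (INR (2 * k)) /\
      (forall w, sphere y w -> g w <> zero ->
         ord Om f w = Finite (INR k) /\
         filterlim (fun x => norm (f x)) (within Om (locally w)) (Rbar_locally p_infty)) /\
      (forall w, sphere y w -> g w = zero -> Rbar_lt (ord Om f w) (Finite (INR k))).

Definition essential_case d (Omt : CD d -> Prop) (y : CD d) (f : CD d -> CD d) : Prop :=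
  let Om := off_sphere Omt y in
  (exists w0, sphere y w0 /\
     forall w, sphere y w -> w <> w0 -> essential Om f w /\ ord Om f w = p_infty) /\
  sph_ord Om f y = p_infty /\
  (forall (U : CD d -> Prop) (k : nat),
     (forall x, U x -> Omt x) -> (forall w, sphere y w -> locally w U) ->
     Lub_Rbar (fun s => exists x, U x /\ ~ sphere y x /\
                 s = norm (cd_pow (Delta y x) k * f x)%cd) = p_infty).

(** z |-> (z - y)^k (z - y^c)^k f(z) is bounded on [Om] intersected with C_J, near [w]. *)
Definition bounded_near d (Om : CD d -> Prop) (J y : CD d) (f : CD d -> CD d)
    (k : nat) (w : CD d) : Prop :=
  exists M : R,
    within (fun z => Om z /\ slice J z) (locally w)
      (fun z => norm ((cd_pow (z - y) k * cd_pow (z - cd_conj y) k) * f z)%cd <= M).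

(** * Basic facts *)

(* Restated because the generic lemmas do not rewrite at the abstract type [CD d]. *)
Lemma cd_oppr0 d : opp (zero : CD d) = zero.
Proof. exact (opp_zero (G := CD d)). Qed.

Lemma cd_subr0 d (x : CD d) : (x - zero)%cd = x.
Proof. exact (minus_zero_r (G := CD d) x). Qed.

Lemma cd_sub0r d (x : CD d) : (zero - x)%cd = opp x.
Proof. exact (plus_zero_l (opp x : CD d)). Qed.

Lemma cd_conj_conj d (x : CD d) : cd_conj (cd_conj x) = x.
Proof.
induction d as [|d IH]; [reflexivity|].
destruct x as [a b]; apply (f_equal2 pair); [exact (IH a)|exact (opp_opp (b : CD d))].
Qed.

Lemma cd_conj_opp d (x : CD d) : cd_conj (opp x) = opp (cd_conj x).
Proof.
induction d as [|d IH]; [reflexivity|].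
destruct x as [a b]; apply (f_equal2 pair); [exact (IH a)|reflexivity].
Qed.

Lemma cd_conj_0 d : cd_conj (zero : CD d) = zero.
Proof.
induction d as [|d IH]; [reflexivity|].
apply (f_equal2 pair); [exact IH|exact (cd_oppr0 d)].
Qed.

Lemma cd_conj_1 d : cd_conj (cd_one : CD d) = cd_one.
Proof.
induction d as [|d IH]; [reflexivity|].
apply (f_equal2 pair); [exact IH|exact (cd_oppr0 d)].
Qed.

Lemma cd_mul_pair d (a b a' b' : CD d) :
  @cd_mul (S d) (a, b) (a', b') =
  ((a * a' - cd_conj b' * b)%cd, (b' * a + b * cd_conj a')%cd).
Proof. reflexivity. Qed.

Lemma cd_mul_0 d (x : CD d) : (zero * x)%cd = zero /\ (x * zero)%cd = zero.
Proof.
induction d as [|d IH].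
- split; [exact (Rmult_0_l x)|exact (Rmult_0_r x)].
- destruct x as [a b]; change (@zero (CD (S d))) with (@zero (CD d), @zero (CD d)).
  rewrite !cd_mul_pair, !cd_conj_0, !(proj1 (IH _)), !(proj2 (IH _)), cd_subr0.
  now rewrite plus_zero_l.
Qed.

Lemma cd_mul_1 d (x : CD d) : (cd_one * x)%cd = x /\ (x * cd_one)%cd = x.
Proof.
induction d as [|d IH].
- split; [exact (Rmult_1_l x)|exact (Rmult_1_r x)].
- destruct x as [a b]; change (@cd_one (S d)) with (@cd_one d, @zero (CD d)).
  rewrite !cd_mul_pair, !cd_conj_0, !cd_conj_1, !(proj1 (cd_mul_0 _)),
    !(proj2 (cd_mul_0 _)), !(proj1 (IH _)), !(proj2 (IH _)).
  now rewrite !cd_subr0, plus_zero_l, plus_zero_r.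
Qed.

Lemma cd_t_re d (x : CD d) : cd_t x = cd_real (2 * cd_re x).
Proof.
unfold cd_t, cd_real; induction d as [|d IH].
- change (x + x = 2 * x * 1); ring.
- destruct x as [a b]; apply (f_equal2 pair); [exact (IH a)|].
  change (plus b (opp b) = scal (2 * cd_re a) (zero : CD d)).
  transitivity (zero : CD d);
    [exact (plus_opp_r (b : CD d))|symmetry; exact (scal_zero_r (V := CD d) _)].
Qed.

Lemma J0_mul_pair d (a b : CD d) :
  @cd_mul (S d) J0 (a, b) = (opp (cd_conj b), cd_conj a).
Proof.
simpl J0; rewrite cd_mul_pair, (proj1 (cd_mul_0 _)), (proj2 (cd_mul_0 _)),
  (proj1 (cd_mul_1 _)), (proj2 (cd_mul_1 _)), cd_sub0r.
apply (f_equal2 pair); [reflexivity|exact (plus_zero_l (cd_conj a : CD d))].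
Qed.

Lemma J0_mulK d (x : CD (S d)) : (J0 * (J0 * x))%cd = opp x.
Proof.
destruct x as [a b]; rewrite !J0_mul_pair, cd_conj_opp, !cd_conj_conj.
reflexivity.
Qed.

Lemma J0_unit d : imag_unit (J0 : CD (S d)).
Proof.
unfold imag_unit; rewrite <- (proj2 (cd_mul_1 J0)) at 2; exact (J0_mulK cd_one).
Qed.

Lemma J0_mul_opp d (x : CD (S d)) : (J0 * - x)%cd = (- (J0 * x))%cd.
Proof.
destruct x as [a b]; change (opp (a, b)) with (opp a, opp b).
rewrite !J0_mul_pair, !cd_conj_opp; reflexivity.
Qed.

Lemma plus_minus_sum (G : AbelianGroup) (x y : G) :
  plus (plus x y) (plus x (opp y)) = plus x x /\
  minus (plus x y) (plus x (opp y)) = plus y y.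
Proof.
split.
- now rewrite (plus_comm x (opp y)), plus_assoc, <- (plus_assoc x y (opp y)), plus_opp_r,
    plus_zero_r.
- unfold minus; rewrite opp_plus, opp_opp, (plus_comm x y), <- plus_assoc; f_equal.
  transitivity (plus (plus x (opp x)) y); [apply plus_assoc|].
  now rewrite plus_opp_r, plus_zero_l.
Qed.

Lemma scal_half (V : ModuleSpace R_Ring) (x : V) : scal (/ 2) (plus x x) = x.
Proof.
transitivity (scal (plus (/ 2) (/ 2)) x);
  [rewrite (scal_distr_l (V := V)); symmetry; apply (scal_distr_r (V := V))|].
replace (plus (/ 2) (/ 2)) with (one : R_Ring) by (cbv; field); apply scal_one.
Qed.

Lemma half_sum d (x y : CD d) :
  scal (/ 2) (x + y + (x + - y))%cd = x /\ scal (/ 2) (x + y - (x + - y))%cd = y.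
Proof.
destruct (plus_minus_sum (x : CD d) (y : CD d)) as [h1 h2].
split; [transitivity (scal (/ 2) (x + x)%cd)|transitivity (scal (/ 2) (y + y)%cd)].
- exact (f_equal (scal (/ 2)) h1).
- exact (scal_half (x : CD d)).
- exact (f_equal (scal (/ 2)) h2).
- exact (scal_half (y : CD d)).
Qed.

Lemma stem_of_slice d (D : C -> Prop) (F1 F2 : C -> CD (S d)) (f : CD (S d) -> CD (S d)) z :
  conj_invariant D -> slice_stem D F1 F2 f -> D z -> stem1 f z = F1 z /\ stem2 f z = F2 z.
Proof.
intros hD [hF hf] hz; destruct z as [a b].
pose proof (hD _ hz) as hz'; unfold Cconj in hz'; simpl in hz'.
destruct (hF _ hz) as [h1 h2]; unfold Cconj in h1, h2; simpl in h1, h2.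
unfold stem1, stem2; simpl fst; simpl snd.
rewrite (hf _ _ _ hz (J0_unit d)), (hf _ _ _ hz' (J0_unit d)), h1, h2, J0_mul_opp.
destruct (half_sum (F1 (a, b)) (J0 * F2 (a, b))%cd) as [e1 e2].
split; [exact e1|].
transitivity (opp (J0 * (J0 * F2 (a, b))))%cd; [exact (f_equal (fun t => opp (cd_mul J0 t)) e2)|].
rewrite J0_mulK; exact (opp_opp (F2 (a, b) : CD (S d))).
Qed.

(* Main.v *)
Require Import Defs.
From Stdlib Require Import Reals ZArith Lra Lia Classical ClassicalEpsilon.
From Coquelicot Require Import Coquelicot.
Open Scope R_scope.

(** In real coordinates the stem function of [f] is a finite family of holomorphic
    functions [h] near the point [c = a0 + i b0] representing the sphere of [y], and on
    each slice [f] is the image [ev J h] of [h] under a complex linear map.  Bounds on two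
    different slices bound [h], up to a constant factor.  Hence everything is governed by
    the least [k], if any, for which [(z - c)^k h] is bounded near [c]: a finite order at two
    points of the sphere, a finite spherical order and boundedness of [Delta^k f] are each
    equivalent to the existence of such a [k].  If there is one, [dlt c z ^ k * h] extends
    holomorphically by Riemann's theorem; its Taylor series at [c], respectively its expansion
    in powers of [w = dlt c z] along the two branches [a0 + i (b0^2 - w)^(1/2)] and
    [a0 - i (b0^2 - w)^(1/2)] of the inverse, gives the Laurent, respectively the spherical,
    expansion of [f].  The value of the extension at [c] is not zero when [k > 0] is minimal,
    and so its image under [ev J] vanishes for at most one [J]. *)

(** * Continuity and complex derivatives *)

(** Two obstacles shape the setup. The octonions are not associative, but J(Jx) = -x for a unit [J],
    so left multiplication by the elements [sl J z] of one slice is an action of the complex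
    numbers; products are arranged as such actions on a coefficient standing at the right, and
    [ev J] is complex linear for them. Secondly, [Shell y 0 r] with r at most |Im y| is only a
    punctured disc in the slice through y. The order at one point of the sphere therefore sees one
    slice, and the stem function is controlled only after a second point is used; this is the origin
    of the possible exceptional point. Orders are defined through the existence of expansions, so
    each direction has its own argument: an expansion bounded below yields growth bounds by
    geometric majorants, and a growth bound yields an expansion by Taylor's theorem. The stem
    function commutes with conjugation, so it is studied at [c] alone. *)

Definition Ccont (f : C -> C) (c : C) : Prop :=
  forall eps, 0 < eps -> exists del, 0 < del /\
    forall z, Cmod (z - c) < del -> Cmod (f z - f c) < eps.

(* Caratheodory's form of the derivative: it makes the algebraic rules purely algebraic. *)
Definition cder (f : C -> C) (c l : C) : Prop :=
  exists q, q c = l /\ Ccont q c /\ forall z, f z = (f c + (z - c) * q z)%C.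

(** Continuity of the derivative is built in, since differentiation under the integral sign in
    [cauchy_formula] asks for it, and stem functions have it because they are C^1. The price is that
    Riemann's theorem has to establish it at the filled point. *)
Definition hol (U : C -> Prop) (f : C -> C) : Prop :=
  exists f' : C -> C, forall z, U z -> cder f z (f' z) /\ Ccont f' z.

Definition disc (c : C) (r : R) (z : C) : Prop := Cmod (z - c) < r.

Lemma Cmod_sub_sym (a b : C) : Cmod (a - b) = Cmod (b - a).
Proof. rewrite <- Cmod_opp; f_equal; ring. Qed.

Lemma Cmod_sub_trans (a b c : C) : Cmod (a - c) <= Cmod (a - b) + Cmod (b - c).
Proof. replace (a - c)%C with ((a - b) + (b - c))%C by ring; apply Cmod_triangle. Qed.

Lemma Cmod_minus_ge (a b : C) : Cmod a - Cmod b <= Cmod (a - b).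
Proof.
generalize (Cmod_triangle (a - b) b); replace (a - b + b)%C with a by ring; lra.
Qed.

Lemma Cmod_le_sum (z : C) : Cmod z <= Rabs (fst z) + Rabs (snd z).
Proof.
apply Rsqr_incr_0_var; [|generalize (Rabs_pos (fst z)) (Rabs_pos (snd z)); lra].
unfold Cmod; rewrite Rsqr_sqrt by nra.
unfold Rsqr; rewrite <- (pow2_abs (fst z)), <- (pow2_abs (snd z)).
generalize (Rabs_pos (fst z)) (Rabs_pos (snd z)); nra.
Qed.

Lemma abs_fst_le_Cmod (z : C) : Rabs (fst z) <= Cmod z.
Proof. eapply Rle_trans; [apply Rmax_l|apply Rmax_Cmod]. Qed.

Lemma abs_snd_le_Cmod (z : C) : Rabs (snd z) <= Cmod z.
Proof. eapply Rle_trans; [apply Rmax_r|apply Rmax_Cmod]. Qed.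

Lemma Cmod_ineq0 (z : C) : z <> 0%C -> 0 < Cmod z.
Proof. apply Cmod_gt_0. Qed.

Lemma Csub_neq0 (a b : C) : a <> b -> (a - b)%C <> 0%C.
Proof. intros h e; apply h; replace a with (a - b + b)%C by ring; rewrite e; ring. Qed.

Lemma Cmod_zero_sub (a : C) : Cmod (a - a) = 0.
Proof. replace (a - a)%C with (RtoC 0) by ring; apply Cmod_0. Qed.

Lemma Ccont_ext (f g : C -> C) c :
  (exists r, 0 < r /\ forall z, disc c r z -> f z = g z) -> Ccont f c -> Ccont g c.
Proof.
intros [r [hr e]] h eps he; destruct (h eps he) as [d [hd H]].
exists (Rmin d r); split; [now apply Rmin_pos|]; intros z hz.
rewrite <- !e; [apply H|unfold disc; rewrite Cmod_zero_sub; lra|];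
  (eapply Rlt_le_trans; [exact hz|]); [apply Rmin_l|apply Rmin_r].
Qed.

Lemma Ccont_const (k c : C) : Ccont (fun _ => k) c.
Proof. intros eps he; exists 1; split; [lra|]; intros; now rewrite Cmod_zero_sub. Qed.

Lemma Ccont_id (c : C) : Ccont (fun z => z) c.
Proof. intros eps he; exists eps; auto. Qed.

Lemma Ccont_plus (f g : C -> C) c : Ccont f c -> Ccont g c -> Ccont (fun z => f z + g z)%C c.
Proof.
intros hf hg eps he.
destruct (hf (eps / 2)) as [d1 [h1 H1]]; [lra|]; destruct (hg (eps / 2)) as [d2 [h2 H2]]; [lra|].
exists (Rmin d1 d2); split; [now apply Rmin_pos|]; intros z hz.
pose proof (H1 z (Rlt_le_trans _ _ _ hz (Rmin_l _ _))).
pose proof (H2 z (Rlt_le_trans _ _ _ hz (Rmin_r _ _))).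
replace (f z + g z - (f c + g c))%C with ((f z - f c) + (g z - g c))%C by ring.
eapply Rle_lt_trans; [apply Cmod_triangle|]; lra.
Qed.

Lemma Ccont_bound (f : C -> C) c : Ccont f c ->
  exists d, 0 < d /\ forall z, disc c d z -> Cmod (f z) <= Cmod (f c) + 1.
Proof.
intros h; destruct (h 1 Rlt_0_1) as [d [hd H]]; exists d; split; [easy|]; intros z hz.
generalize (H z hz) (Cmod_minus_ge (f z) (f c)); lra.
Qed.

Lemma Ccont_mult (f g : C -> C) c : Ccont f c -> Ccont g c -> Ccont (fun z => f z * g z)%C c.
Proof.
intros hf hg eps he.
destruct (Ccont_bound g c hg) as [d0 [h0 H0]].
assert (ha := Cmod_ge_0 (f c)); assert (hb := Cmod_ge_0 (g c)).
destruct (hf (eps / 2 / (Cmod (g c) + 1))) as [d1 [h1 H1]];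
  [repeat apply Rdiv_lt_0_compat; lra|].
destruct (hg (eps / 2 / (Cmod (f c) + 1))) as [d2 [h2 H2]];
  [repeat apply Rdiv_lt_0_compat; lra|].
exists (Rmin d0 (Rmin d1 d2)); split; [repeat apply Rmin_pos; easy|]; intros z hz.
pose proof (Rmin_l d0 (Rmin d1 d2)); pose proof (Rmin_r d0 (Rmin d1 d2)).
pose proof (Rmin_l d1 d2); pose proof (Rmin_r d1 d2).
pose proof (H0 z ltac:(unfold disc; lra)) as k0.
pose proof (H1 z ltac:(lra)) as k1; pose proof (H2 z ltac:(lra)) as k2.
replace (f z * g z - f c * g c)%C with ((f z - f c) * g z + f c * (g z - g c))%C by ring.
eapply Rle_lt_trans; [apply Cmod_triangle|]; rewrite !Cmod_mult.
assert (e1 : Cmod (f z - f c) * Cmod (g z) <= eps / 2 / (Cmod (g c) + 1) * (Cmod (g c) + 1)).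
{ apply Rmult_le_compat; try apply Cmod_ge_0; lra. }
assert (e2 : Cmod (f c) * Cmod (g z - g c) < (Cmod (f c) + 1) * (eps / 2 / (Cmod (f c) + 1))).
{ apply Rle_lt_trans with (Cmod (f c) * (eps / 2 / (Cmod (f c) + 1))).
  - apply Rmult_le_compat_l; lra.
  - apply Rmult_lt_compat_r; [repeat apply Rdiv_lt_0_compat|]; lra. }
replace (eps / 2 / (Cmod (g c) + 1) * (Cmod (g c) + 1)) with (eps / 2) in e1 by (field; lra).
replace ((Cmod (f c) + 1) * (eps / 2 / (Cmod (f c) + 1))) with (eps / 2) in e2 by (field; lra).
lra.
Qed.

Lemma Ccont_comp (f g : C -> C) c : Ccont g c -> Ccont f (g c) -> Ccont (fun z => f (g z)) c.
Proof.
intros hg hf eps he; destruct (hf eps he) as [d [hd H]]; destruct (hg d hd) as [d' [hd' H']].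
exists d'; auto.
Qed.

Lemma Ccont_inv (c : C) : c <> 0%C -> Ccont Cinv c.
Proof.
intros hc eps he; assert (k := Cmod_ineq0 c hc).
exists (Rmin (Cmod c / 2) (eps * Cmod c ^ 2 / 2)); split.
{ apply Rmin_pos; [lra|]; apply Rdiv_lt_0_compat; [|lra]; apply Rmult_lt_0_compat; [lra|nra]. }
intros z hz.
pose proof (Rmin_l (Cmod c / 2) (eps * Cmod c ^ 2 / 2)).
pose proof (Rmin_r (Cmod c / 2) (eps * Cmod c ^ 2 / 2)).
assert (k1 : Cmod c / 2 < Cmod z).
{ generalize (Cmod_minus_ge c z); rewrite Cmod_sub_sym; lra. }
assert (hz0 : z <> 0%C) by (intros e; subst z; rewrite Cmod_0 in k1; lra).
replace (/ z - / c)%C with ((c - z) * (/ z * / c))%C by (field; auto).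
rewrite !Cmod_mult, !Cmod_inv, Cmod_sub_sym by auto.
apply Rmult_lt_reg_r with (Cmod z * Cmod c); [nra|].
replace (Cmod (z - c) * (/ Cmod z * / Cmod c) * (Cmod z * Cmod c)) with (Cmod (z - c))
  by (field; lra).
apply Rlt_le_trans with (eps * Cmod c ^ 2 / 2); [lra|].
replace (eps * (Cmod z * Cmod c)) with (eps * Cmod c * Cmod z) by ring.
replace (eps * Cmod c ^ 2 / 2) with (eps * Cmod c * (Cmod c / 2)) by field.
apply Rmult_le_compat_l; nra.
Qed.

Lemma cder_cont f c l : cder f c l -> Ccont f c.
Proof.
intros [q [_ [hq e]]].
apply Ccont_ext with (fun z => f c + (z - c) * q z)%C.
- exists 1; split; [lra|]; intros; now rewrite <- e.
- apply Ccont_plus; [apply Ccont_const|]; apply Ccont_mult; [|exact hq].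
  apply Ccont_plus; [apply Ccont_id|apply Ccont_const].
Qed.

(** Caratheodory's identity is required at every [z], not only near [c]. The quotient for [g] is
    therefore the plain difference quotient, which coincides near [c] with the one of [f]. *)
Lemma cder_ext_loc f g c l :
  (exists r, 0 < r /\ forall z, disc c r z -> f z = g z) -> cder f c l -> cder g c l.
Proof.
intros [r [hr e]] [q [h1 [h2 h3]]].
assert (ec : f c = g c) by (apply e; unfold disc; rewrite Cmod_zero_sub; lra).
exists (fun z => if Ceq_dec z c then l else ((g z - g c) / (z - c))%C); split; [|split].
- destruct (Ceq_dec c c); congruence.
- apply Ccont_ext with q; [|exact h2].
  exists r; split; [easy|]; intros z hz; destruct (Ceq_dec z c) as [->|n]; [easy|].
  rewrite <- (e z hz), <- ec, h3; field; now apply Csub_neq0.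
- intros z; destruct (Ceq_dec z c) as [->|n]; [ring|]; field; now apply Csub_neq0.
Qed.

Lemma cder_eq f c l l' : cder f c l -> l = l' -> cder f c l'.
Proof. now intros h <-. Qed.

Lemma cder_const k c : cder (fun _ => k) c 0.
Proof. exists (fun _ => RtoC 0); split; [easy|]; split; [apply Ccont_const|]; intros; ring. Qed.

Lemma cder_id c : cder (fun z => z) c 1.
Proof. exists (fun _ => RtoC 1); split; [easy|]; split; [apply Ccont_const|]; intros; ring. Qed.

Lemma cder_plus f g c l m : cder f c l -> cder g c m -> cder (fun z => f z + g z)%C c (l + m).
Proof.
intros [p [h1 [h2 h3]]] [q [k1 [k2 k3]]]; exists (fun z => p z + q z)%C; split; [|split].
- congruence.
- now apply Ccont_plus.
- intros; rewrite h3, k3; ring.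
Qed.

Lemma cder_mult f g c l m :
  cder f c l -> cder g c m -> cder (fun z => f z * g z)%C c (l * g c + f c * m).
Proof.
intros hf hg; pose proof (cder_cont _ _ _ hg) as cg; revert hf hg.
intros [p [h1 [h2 h3]]] [q [k1 [k2 k3]]]; exists (fun z => p z * g z + f c * q z)%C; split; [|split].
- congruence.
- repeat (apply Ccont_plus || apply Ccont_mult || apply Ccont_const || assumption).
- intros z; rewrite (h3 z); replace (g z) with (g c + (z - c) * q z)%C at 1 by now rewrite <- k3.
  rewrite (k3 z); ring.
Qed.

Lemma cder_comp f g c l m : cder g c m -> cder f (g c) l -> cder (fun z => f (g z)) c (m * l).
Proof.
intros hg; pose proof (cder_cont _ _ _ hg) as cg; revert hg.
intros [p [h1 [h2 h3]]] [q [k1 [k2 k3]]]; exists (fun z => p z * q (g z))%C; split; [|split].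
- congruence.
- apply Ccont_mult; [easy|]; now apply (Ccont_comp q g).
- intros z; rewrite (k3 (g z)).
  replace (g z - g c)%C with ((z - c) * p z)%C by (rewrite (h3 z); ring); ring.
Qed.

Lemma cder_inv (c : C) : c <> 0%C -> cder Cinv c (- (/ c * / c)).
Proof.
(* With the quotient [- (/ z * / c)] the identity fails at [0], so the function is first altered
   there; the disc of radius |c| around [c] avoids that point. *)
intros hc; apply cder_ext_loc with
  (fun z => if Ceq_dec z 0 then (/ c + (z - c) * - (/ z * / c))%C else (/ z)%C).
{ exists (Cmod c); split; [exact (Cmod_ineq0 c hc)|]; intros z hz.
  destruct (Ceq_dec z 0) as [->|]; [|easy].
  exfalso; unfold disc in hz; replace (0 - c)%C with (- c)%C in hz by ring.
  rewrite Cmod_opp in hz; lra. }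
exists (fun z => - (/ z * / c))%C; split; [easy|]; split.
- apply Ccont_ext with (fun z => (- / c) * / z)%C; [exists 1; split; [lra|]; intros; ring|].
  apply Ccont_mult; [apply Ccont_const|now apply Ccont_inv].
- intros z; destruct (Ceq_dec c 0); [easy|]; destruct (Ceq_dec z 0); [easy|]; field; auto.
Qed.

Lemma hol_cont U f c : hol U f -> U c -> Ccont f c.
Proof. intros [f' h] hc; exact (cder_cont _ _ _ (proj1 (h c hc))). Qed.

Lemma hol_sub (U V : C -> Prop) f : (forall z, V z -> U z) -> hol U f -> hol V f.
Proof. intros h [f' H]; exists f'; auto. Qed.

Lemma hol_ext (U : C -> Prop) f g :
  (forall z, U z -> exists r, 0 < r /\ forall w, disc z r w -> U w) ->
  (forall z, U z -> f z = g z) -> hol U f -> hol U g.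
Proof.
intros ho e [f' H]; exists f'; intros z hz; split; [|now apply H].
apply cder_ext_loc with f; [|now apply H].
destruct (ho z hz) as [r [hr h]]; exists r; split; [easy|]; intros; apply e; auto.
Qed.

Lemma hol_const U k : hol U (fun _ => k).
Proof. exists (fun _ => RtoC 0); intros; split; [apply cder_const|apply Ccont_const]. Qed.

Lemma hol_id U : hol U (fun z => z).
Proof. exists (fun _ => RtoC 1); intros; split; [apply cder_id|apply Ccont_const]. Qed.

Lemma hol_plus U f g : hol U f -> hol U g -> hol U (fun z => f z + g z)%C.
Proof.
intros [f' hf] [g' hg]; exists (fun z => f' z + g' z)%C; intros z hz; split.
- apply cder_plus; [now apply hf|now apply hg].
- apply Ccont_plus; [now apply hf|now apply hg].
Qed.

Lemma hol_mult U f g : hol U f -> hol U g -> hol U (fun z => f z * g z)%C.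
Proof.
intros hf hg; assert (cf := fun c => hol_cont U f c hf); assert (cg := fun c => hol_cont U g c hg).
destruct hf as [f' hf], hg as [g' hg]; exists (fun z => f' z * g z + f z * g' z)%C.
intros z hz; split.
- apply cder_mult; [now apply hf|now apply hg].
- apply Ccont_plus; apply Ccont_mult; auto; [now apply hf|now apply hg].
Qed.

Lemma hol_comp (U V : C -> Prop) f g : (forall z, U z -> V (g z)) ->
  hol V f -> hol U g -> hol U (fun z => f (g z)).
Proof.
intros h hf hg; assert (cg := fun c => hol_cont U g c hg).
destruct hf as [f' hf], hg as [g' hg]; exists (fun z => g' z * f' (g z))%C.
intros z hz; split.
- apply cder_comp; [now apply hg|now apply hf, h].
- apply Ccont_mult; [now apply hg|]; apply (Ccont_comp f' g); auto; now apply hf, h.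
Qed.

Lemma hol_inv U (f : C -> C) : (forall z, U z -> f z <> 0%C) -> hol U f -> hol U (fun z => / f z)%C.
Proof.
intros h; apply hol_comp with (V := fun z : C => z <> 0%C); [exact h|].
exists (fun c => - (/ c * / c))%C; intros c hc; split; [now apply cder_inv|].
apply Ccont_ext with (fun z => (RtoC (-1)) * (/ z * / z))%C.
- exists 1; split; [lra|]; intros; ring.
- repeat (apply Ccont_mult || apply Ccont_const || now apply Ccont_inv).
Qed.

Lemma hol_pow U (f : C -> C) n : hol U f -> hol U (fun z => f z ^ n)%C.
Proof.
intros h; induction n as [|n IH]; [exact (hol_const U (RtoC 1))|].
simpl; now apply hol_mult.
Qed.

Lemma hol_sub_const U (k : C) : hol U (fun z => z - k)%C.
Proof. apply hol_plus; [apply hol_id|apply hol_const]. Qed.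

Lemma hol_opp U (f : C -> C) : hol U f -> hol U (fun z => - f z)%C.
Proof.
intros h; destruct (hol_mult U _ _ (hol_const U (RtoC (-1))) h) as [f' H].
exists f'; intros z hz; split; [|now apply H].
apply cder_ext_loc with (fun z => RtoC (-1) * f z)%C; [|now apply H].
exists 1; split; [lra|]; intros; ring.
Qed.

Lemma hol_minus U f g : hol U f -> hol U g -> hol U (fun z => f z - g z)%C.
Proof. intros hf hg; apply hol_plus; [easy|now apply hol_opp]. Qed.

Lemma disc_open c r z : disc c r z -> exists r', 0 < r' /\ forall w, disc z r' w -> disc c r w.
Proof.
intros h; exists (r - Cmod (z - c)); split; [unfold disc in h; lra|]; intros w hw.
unfold disc in *; generalize (Cmod_sub_trans w z c); lra.
Qed.

(** * Paths and integrals of complex functions *)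

Ltac eqR := match goal with |- @eq _ ?a ?b => change (@eq R a b) end.

(** Paths are treated by components, so that the real theorems on integrals and derivatives apply;
    [rder_caratheodory] gives back a form in which the product and chain rules are algebra. *)
Definition rcont (g : R -> C) (t : R) : Prop :=
  continuous (fun s => fst (g s)) t /\ continuous (fun s => snd (g s)) t.

Definition rder (g : R -> C) (t : R) (l : C) : Prop :=
  is_derive (fun s => fst (g s)) t (fst l) /\ is_derive (fun s => snd (g s)) t (snd l).

Definition csc (k : R) (z : C) : C := (RtoC k * z)%C.

Lemma continuous_R_eps (f : R -> R) t : continuous f t <->
  forall eps, 0 < eps -> exists d, 0 < d /\ forall s, Rabs (s - t) < d -> Rabs (f s - f t) < eps.
Proof.
split.
- intros h eps he.
  destruct (proj1 (filterlim_locally f (f t)) h (mkposreal eps he)) as [d Hd].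
  exists d; split; [apply cond_pos|]; intros s hs; exact (Hd s hs).
- intros H; apply filterlim_locally; intros eps.
  destruct (H eps (cond_pos eps)) as [d [hd Hd]].
  exists (mkposreal d hd); intros s hs; exact (Hd s hs).
Qed.

Lemma rcont_eps (g : R -> C) t : rcont g t <->
  forall eps, 0 < eps -> exists d, 0 < d /\ forall s, Rabs (s - t) < d -> Cmod (g s - g t) < eps.
Proof.
unfold rcont; rewrite !continuous_R_eps; split.
- intros [h1 h2] eps he.
  destruct (h1 (eps / 2)) as [d1 [k1 H1]]; [lra|]; destruct (h2 (eps / 2)) as [d2 [k2 H2]]; [lra|].
  exists (Rmin d1 d2); split; [now apply Rmin_pos|]; intros s hs.
  eapply Rle_lt_trans; [apply Cmod_le_sum|].
  pose proof (H1 s (Rlt_le_trans _ _ _ hs (Rmin_l _ _))).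
  pose proof (H2 s (Rlt_le_trans _ _ _ hs (Rmin_r _ _))).
  simpl; unfold Rminus in *; lra.
- intros H; split; intros eps he; destruct (H eps he) as [d [hd Hd]]; exists d; split; auto;
    intros s hs; eapply Rle_lt_trans; [|exact (Hd s hs)| |exact (Hd s hs)].
  + apply (abs_fst_le_Cmod (g s - g t)).
  + apply (abs_snd_le_Cmod (g s - g t)).
Qed.

Lemma rcont_comp (f : C -> C) (g : R -> C) t :
  rcont g t -> Ccont f (g t) -> rcont (fun s => f (g s)) t.
Proof.
rewrite !rcont_eps; intros hg hf eps he.
destruct (hf eps he) as [d [hd H]]; destruct (hg d hd) as [d' [hd' H']]; exists d'; auto.
Qed.

Lemma rcont_plus f g t : rcont f t -> rcont g t -> rcont (fun s => f s + g s)%C t.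
Proof.
intros [h1 h2] [k1 k2]; split.
- exact (continuous_plus (fun s => fst (f s)) (fun s => fst (g s)) t h1 k1).
- exact (continuous_plus (fun s => snd (f s)) (fun s => snd (g s)) t h2 k2).
Qed.

Lemma rcont_mult f g t : rcont f t -> rcont g t -> rcont (fun s => f s * g s)%C t.
Proof.
intros [h1 h2] [k1 k2]; split.
- apply (continuous_minus (fun s => fst (f s) * fst (g s)) (fun s => snd (f s) * snd (g s)));
    [exact (continuous_mult (fun s => fst (f s)) (fun s => fst (g s)) t h1 k1)
    |exact (continuous_mult (fun s => snd (f s)) (fun s => snd (g s)) t h2 k2)].
- apply (continuous_plus (fun s => fst (f s) * snd (g s)) (fun s => snd (f s) * fst (g s)));
    [exact (continuous_mult (fun s => fst (f s)) (fun s => snd (g s)) t h1 k2)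
    |exact (continuous_mult (fun s => snd (f s)) (fun s => fst (g s)) t h2 k1)].
Qed.

Lemma rcont_const k t : rcont (fun _ => k) t.
Proof. split; apply continuous_const. Qed.

Lemma rcont_ext f g t : (forall s, f s = g s) -> rcont f t -> rcont g t.
Proof.
intros e [h1 h2]; split; [apply continuous_ext with (2 := h1)|apply continuous_ext with (2 := h2)];
  intros; now rewrite e.
Qed.

Lemma rder_caratheodory g t l : rder g t l <->
  exists p, p t = l /\ rcont p t /\ forall s, g s = (g t + csc (s - t) (p s))%C.
Proof.
split.
- intros [h1 h2].
  exists (fun s => if Req_EM_T s t then l else csc (/ (s - t)) (g s - g t)); split; [|split].
  + destruct (Req_EM_T t t); congruence.
  + assert (key : forall (u : R -> R) m, is_derive u t m ->
      continuous (fun s => if Req_EM_T s t then m else / (s - t) * (u s - u t)) t).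
    { intros u m hu; apply is_derive_Reals in hu; apply continuous_R_eps; intros eps he.
      destruct (hu eps he) as [d Hd]; exists d; split; [apply cond_pos|]; intros s hs.
      destruct (Req_EM_T t t); [|easy]; destruct (Req_EM_T s t).
      - now rewrite Rminus_diag, Rabs_R0.
      - specialize (Hd (s - t)); replace (t + (s - t)) with s in Hd by ring.
        unfold Rdiv in Hd; rewrite Rmult_comm in Hd; apply Hd; [lra|easy]. }
    split; [apply continuous_ext with (2 := key _ _ h1)|apply continuous_ext with (2 := key _ _ h2)];
      intros s; destruct (Req_EM_T s t); try easy; unfold csc; simpl; eqR; ring.
  + intros s; destruct (Req_EM_T s t) as [->|n]; unfold csc.
    * rewrite Rminus_diag; ring.
    * assert (hn : s - t <> 0) by lra; rewrite RtoC_inv by easy; field; intros k; apply hn; now apply RtoC_inj in k.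
- intros [p [e [[h1 h2] H]]].
  assert (key : forall (u q : R -> R), continuous q t -> (forall s, u s = u t + (s - t) * q s) ->
    is_derive u t (q t)).
  { intros u q hq E; apply is_derive_Reals; intros eps he.
    destruct (proj1 (continuous_R_eps _ _) hq eps he) as [d [hd Hd]].
    exists (mkposreal d hd); intros x hx hxd; rewrite (E (t + x)).
    replace ((u t + (t + x - t) * q (t + x) - u t) / x) with (q (t + x)) by (field; easy).
    apply Hd; now replace (t + x - t) with x by ring. }
  subst l; split.
  + apply (key (fun s => fst (g s)) (fun s => fst (p s)) h1); intros s; rewrite (H s) at 1.
    unfold csc; simpl; ring.
  + apply (key (fun s => snd (g s)) (fun s => snd (p s)) h2); intros s; rewrite (H s) at 1.
    unfold csc; simpl; ring.
Qed.

Lemma rder_cont g t l : rder g t l -> rcont g t.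
Proof.
intros [h1 h2]; split; apply (ex_derive_continuous (V := R_NormedModule)); eexists; eassumption.
Qed.

Lemma rder_comp (f : C -> C) (g : R -> C) t l m :
  rder g t m -> cder f (g t) l -> rder (fun s => f (g s)) t (m * l)%C.
Proof.
intros hg; pose proof (rder_cont _ _ _ hg) as cg; revert hg; rewrite !rder_caratheodory.
intros [p [h1 [h2 h3]]] [q [k1 [k2 k3]]]; exists (fun s => p s * q (g s))%C; split; [|split].
- congruence.
- apply rcont_mult; [easy|]; now apply rcont_comp.
- intros s; rewrite (k3 (g s)).
  replace (g s - g t)%C with (csc (s - t) (p s)) by (rewrite (h3 s); ring); unfold csc; ring.
Qed.

Lemma rder_mult f g t l m :
  rder f t l -> rder g t m -> rder (fun s => f s * g s)%C t (l * g t + f t * m)%C.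
Proof.
intros hf hg; pose proof (rder_cont _ _ _ hg) as cg; revert hf hg; rewrite !rder_caratheodory.
intros [p [h1 [h2 h3]]] [q [k1 [k2 k3]]]; exists (fun s => p s * g s + f t * q s)%C; split; [|split].
- congruence.
- apply rcont_plus; [now apply rcont_mult|apply rcont_mult; [apply rcont_const|assumption]].
- intros s; rewrite (h3 s).
  transitivity (f t * (g t + csc (s - t) (q s)) + csc (s - t) (p s) * g s)%C;
    [rewrite <- k3; unfold csc; ring|unfold csc; ring].
Qed.

Lemma rder_const k t : rder (fun _ => k) t 0%C.
Proof. split; apply (is_derive_const (V := R_NormedModule)). Qed.

Lemma rder_eq g t l l' : rder g t l -> l = l' -> rder g t l'.
Proof. now intros h <-. Qed.

Lemma rder_ext f g t l : (forall s, f s = g s) -> rder f t l -> rder g t l.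
Proof.
intros e [h1 h2]; split; [apply is_derive_ext with (2 := h1)|apply is_derive_ext with (2 := h2)];
  intros; now rewrite e.
Qed.

Definition cI (f : R -> C) (a b : R) : C :=
  (RInt (fun t => fst (f t)) a b, RInt (fun t => snd (f t)) a b).

Lemma rcont_ex_RInt f a b : (forall t, rcont f t) ->
  ex_RInt (fun t => fst (f t)) a b /\ ex_RInt (fun t => snd (f t)) a b.
Proof.
intros h; split; apply (ex_RInt_continuous (V := R_CompleteNormedModule)); intros; apply h.
Qed.

Lemma cI_ext f g a b : (forall t, f t = g t) -> cI f a b = cI g a b.
Proof. intros e; unfold cI; f_equal; apply RInt_ext; intros; now rewrite e. Qed.

Lemma cI_plus f g a b : (forall t, rcont f t) -> (forall t, rcont g t) ->
  cI (fun t => f t + g t)%C a b = (cI f a b + cI g a b)%C.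
Proof.
intros hf hg; destruct (rcont_ex_RInt f a b hf), (rcont_ex_RInt g a b hg).
unfold cI, Cplus; simpl; f_equal.
- now apply (RInt_plus (V := R_CompleteNormedModule) (fun t => fst (f t)) (fun t => fst (g t))).
- now apply (RInt_plus (V := R_CompleteNormedModule) (fun t => snd (f t)) (fun t => snd (g t))).
Qed.

Lemma cI_scal k f a b : (forall t, rcont f t) -> cI (fun t => k * f t)%C a b = (k * cI f a b)%C.
Proof.
intros hf; destruct (rcont_ex_RInt f a b hf) as [h1 h2].
pose proof (fun l => ex_RInt_scal (V := R_NormedModule) _ a b l h1) as s1.
pose proof (fun l => ex_RInt_scal (V := R_NormedModule) _ a b l h2) as s2.
unfold cI, Cmult; simpl; f_equal.
- rewrite (RInt_minus (V := R_CompleteNormedModule) (fun t => scal (fst k) (fst (f t)))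
    (fun t => scal (snd k) (snd (f t)))) by auto.
  now rewrite !(RInt_scal (V := R_CompleteNormedModule)) by auto.
- rewrite (RInt_plus (V := R_CompleteNormedModule) (fun t => scal (fst k) (snd (f t)))
    (fun t => scal (snd k) (fst (f t)))) by auto.
  now rewrite !(RInt_scal (V := R_CompleteNormedModule)) by auto.
Qed.

(** The factor 2 is the cost of estimating the two components separately; it reappears in later
    constants. *)
Lemma cI_bound f a b M : a <= b -> (forall t, rcont f t) -> (forall t, a <= t <= b -> Cmod (f t) <= M) ->
  Cmod (cI f a b) <= 2 * ((b - a) * M).
Proof.
intros hab hf hM; destruct (rcont_ex_RInt f a b hf) as [h1 h2].
eapply Rle_trans; [apply Cmod_le_sum|]; simpl.
pose proof (abs_RInt_le_const _ a b M hab h1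
  (fun t ht => Rle_trans _ _ _ (abs_fst_le_Cmod (f t)) (hM t ht))).
pose proof (abs_RInt_le_const _ a b M hab h2
  (fun t ht => Rle_trans _ _ _ (abs_snd_le_Cmod (f t)) (hM t ht))).
lra.
Qed.

Lemma cI_derive F f a b : (forall t, rder F t (f t)) -> (forall t, rcont f t) ->
  cI f a b = (F b - F a)%C.
Proof.
intros hF hf; unfold cI, Cminus, Cplus, Copp; simpl; f_equal; apply is_RInt_unique.
- exact (is_RInt_derive (V := R_CompleteNormedModule) (fun t => fst (F t)) (fun t => fst (f t))
    a b (fun t _ => proj1 (hF t)) (fun t _ => proj1 (hf t))).
- exact (is_RInt_derive (V := R_CompleteNormedModule) (fun t => snd (F t)) (fun t => snd (f t))
    a b (fun t _ => proj2 (hF t)) (fun t _ => proj2 (hf t))).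
Qed.

Lemma cI_const k a b : cI (fun _ => k) a b = csc (b - a) k.
Proof.
unfold cI; rewrite !RInt_const; unfold csc, scal; simpl; unfold mult; simpl.
apply injective_projections; simpl; ring.
Qed.

(** * The unit circle and its powers *)

Definition cis (t : R) : C := (cos t, sin t).

Lemma Cmod_cis t : Cmod (cis t) = 1.
Proof.
unfold Cmod, cis; simpl.
replace (cos t * (cos t * 1) + sin t * (sin t * 1)) with 1; [apply sqrt_1|].
generalize (sin2_cos2 t); unfold Rsqr; lra.
Qed.

Lemma cis_neq0 t : cis t <> 0%C.
Proof. intros e; generalize (Cmod_cis t); rewrite e, Cmod_0; lra. Qed.

Lemma cis_opp t : cis (- t) = (/ cis t)%C.
Proof.
assert (e : (cis (- t) * cis t = 1)%C).
{ unfold cis, Cmult, RtoC; rewrite cos_neg, sin_neg; simpl.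
  generalize (sin2_cos2 t); unfold Rsqr; intros; f_equal; lra. }
transitivity (cis (- t) * cis t * / cis t)%C; [|rewrite e]; field; apply cis_neq0.
Qed.

Lemma cis_2PI : cis (2 * PI) = cis 0.
Proof. unfold cis; now rewrite cos_2PI, sin_2PI, cos_0, sin_0. Qed.

Lemma cis_0 : cis 0 = 1%C.
Proof. unfold cis; now rewrite cos_0, sin_0. Qed.

Lemma rder_cis t : rder cis t (Ci * cis t)%C.
Proof. split; simpl; auto_derive; try easy; ring. Qed.

Lemma rder_cis_opp t : rder (fun s => cis (- s)) t (- Ci * cis (- t))%C.
Proof. split; simpl; auto_derive; try easy; ring. Qed.

Lemma rcont_cis t : rcont cis t.
Proof. exact (rder_cont _ _ _ (rder_cis t)). Qed.

Lemma rcont_cis_opp t : rcont (fun s => cis (- s)) t.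
Proof. exact (rder_cont _ _ _ (rder_cis_opp t)). Qed.

Lemma rcont_pow f n t : rcont f t -> rcont (fun s => f s ^ n)%C t.
Proof.
intros h; induction n as [|n IH]; [apply rcont_const|]; simpl; now apply rcont_mult.
Qed.

Lemma cder_pow n c : cder (fun z => z ^ S n)%C c (RtoC (INR (S n)) * c ^ n)%C.
Proof.
induction n as [|n IH].
- apply cder_ext_loc with (fun z => z); [exists 1; split; [lra|]; intros; simpl; ring|].
  apply cder_eq with (1 := cder_id c); simpl; ring.
- apply cder_ext_loc with (fun z => z * z ^ S n)%C; [exists 1; split; [lra|]; easy|].
  apply cder_eq with (1 := cder_mult _ _ _ _ _ (cder_id c) IH).
  rewrite (S_INR (S n)), RtoC_plus; simpl; ring.
Qed.

Lemma cI_cis_pow n : cI (fun t => cis (- t) ^ S n)%C 0 (2 * PI) = 0%C.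
Proof.
(* Differentiation multiplies [cis (- t) ^ S n] by [k], so dividing by [k] gives a primitive, which
   takes equal values at 0 and 2 PI. *)
set (k := (- Ci * RtoC (INR (S n)))%C).
assert (hk : k <> 0%C).
{ apply Cmult_neq_0; [intros e; apply (f_equal snd) in e; simpl in e; lra|].
  intros e; apply RtoC_inj in e; revert e; apply not_0_INR; lia. }
rewrite (cI_derive (fun t => / k * cis (- t) ^ S n)%C).
- rewrite Ropp_0, cis_opp, cis_2PI, cis_0.
  replace (/ 1)%C with (RtoC 1) by (field; intros e; apply RtoC_inj in e; lra).
  ring.
- intros t.
  eapply rder_eq; [apply rder_mult; [apply rder_const|]; apply (rder_comp (fun z => z ^ S n)%C);
    [apply rder_cis_opp|apply cder_pow]|].
  unfold k; simpl Cpow; field; split; intros e; apply hk; unfold k; rewrite e; ring.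
- intros t; apply rcont_pow, rcont_cis_opp.
Qed.

(** * Complex series *)

Definition csum (a : nat -> C) (l : C) : Prop :=
  is_series (fun n => fst (a n)) (fst l) /\ is_series (fun n => snd (a n)) (snd l).

(** The sum stops before index [N], unlike [sum_n], so that the empty sum exists and the remainder
    after [csumn a N] carries the factor x^N. *)
Fixpoint csumn (a : nat -> C) (N : nat) : C :=
  match N with O => RtoC 0 | S n => (csumn a n + a n)%C end.

Lemma csumn_comp a N : csumn a (S N) = (sum_n (fun n => fst (a n)) N, sum_n (fun n => snd (a n)) N).
Proof.
induction N as [|N IH].
- simpl; rewrite !sum_O; apply injective_projections; simpl; ring.
- change (csumn a (S (S N))) with (csumn a (S N) + a (S N))%C; rewrite IH, !sum_Sn.
  apply injective_projections; reflexivity.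
Qed.

Lemma csum_ext a b l : (forall n, a n = b n) -> csum a l -> csum b l.
Proof.
intros e [h1 h2]; split; [apply is_series_ext with (2 := h1)|apply is_series_ext with (2 := h2)];
  intros; now rewrite e.
Qed.

Lemma csum_unique a l l' : csum a l -> csum a l' -> l = l'.
Proof.
intros [h1 h2] [k1 k2]; apply injective_projections.
- now rewrite <- (is_series_unique _ _ h1), (is_series_unique _ _ k1).
- now rewrite <- (is_series_unique _ _ h2), (is_series_unique _ _ k2).
Qed.

Lemma csum_plus a b l m : csum a l -> csum b m -> csum (fun n => a n + b n)%C (l + m)%C.
Proof.
intros [h1 h2] [k1 k2]; split.
- exact (is_series_plus (V := R_NormedModule) _ _ _ _ h1 k1).
- exact (is_series_plus (V := R_NormedModule) _ _ _ _ h2 k2).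
Qed.

Lemma csum_scal k a l : csum a l -> csum (fun n => k * a n)%C (k * l)%C.
Proof.
intros [h1 h2]; split.
- exact (is_series_minus (V := R_NormedModule) _ _ _ _
    (is_series_scal (V := R_NormedModule) (fst k) _ _ h1)
    (is_series_scal (V := R_NormedModule) (snd k) _ _ h2)).
- exact (is_series_plus (V := R_NormedModule) _ _ _ _
    (is_series_scal (V := R_NormedModule) (fst k) _ _ h2)
    (is_series_scal (V := R_NormedModule) (snd k) _ _ h1)).
Qed.

Lemma csum_conj a l : csum a l -> csum (fun n => Cconj (a n)) (Cconj l).
Proof.
intros [h1 h2]; split; [exact h1|].
exact (is_series_opp (V := R_NormedModule) _ _ h2).
Qed.

Lemma csum_decr a l : csum (fun n => a (S n)) l -> csum a (l + a O)%C.
Proof.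
intros [h1 h2]; split.
- apply (is_series_decr_1 (V := R_NormedModule) (fun n => fst (a n))).
  replace (plus _ _) with (fst l); [exact h1|]; unfold plus, opp; simpl; ring.
- apply (is_series_decr_1 (V := R_NormedModule) (fun n => snd (a n))).
  replace (plus _ _) with (snd l); [exact h2|]; unfold plus, opp; simpl; ring.
Qed.

Lemma csum_incr a l : csum a l -> csum (fun n => a (S n)) (l - a O)%C.
Proof.
intros [h1 h2]; split.
- apply (is_series_incr_1 (V := R_NormedModule) (fun n => fst (a n))).
  replace (plus _ _) with (fst l); [exact h1|]; unfold plus; simpl; ring.
- apply (is_series_incr_1 (V := R_NormedModule) (fun n => snd (a n))).
  replace (plus _ _) with (snd l); [exact h2|]; unfold plus; simpl; ring.
Qed.

Lemma is_series_of_geom_rem (a : nat -> R) l M q : 0 <= q < 1 ->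
  (forall N, Rabs (l - sum_n a N) <= M * q ^ S N) -> is_series a l.
Proof.
intros hq h; change (is_lim_seq (sum_n a) l).
apply is_lim_seq_le_le with (u := fun N => l - M * q ^ S N) (w := fun N => l + M * q ^ S N).
- intros N; generalize (h N); unfold Rabs; destruct Rcase_abs; lra.
- replace (Finite l) with (Rbar_minus l (Rbar_mult M 0)) by (simpl; f_equal; ring).
  apply is_lim_seq_minus'; [apply is_lim_seq_const|].
  apply (is_lim_seq_scal_l _ M 0), (is_lim_seq_incr_1 (fun n => q ^ n)), is_lim_seq_geom.
  rewrite Rabs_pos_eq; lra.
- replace (Finite l) with (Rbar_plus l (Rbar_mult M 0)) by (simpl; f_equal; ring).
  apply is_lim_seq_plus'; [apply is_lim_seq_const|].
  apply (is_lim_seq_scal_l _ M 0), (is_lim_seq_incr_1 (fun n => q ^ n)), is_lim_seq_geom.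
  rewrite Rabs_pos_eq; lra.
Qed.

Lemma csum_of_geom_rem a l M q : 0 <= q < 1 ->
  (forall N, Cmod (l - csumn a N) <= M * q ^ N) -> csum a l.
Proof.
intros hq h; split; apply is_series_of_geom_rem with M q; auto; intros N;
  (eapply Rle_trans; [|exact (h (S N))]); rewrite csumn_comp.
- exact (abs_fst_le_Cmod (l - (_, _))).
- exact (abs_snd_le_Cmod (l - (_, _))).
Qed.

Lemma is_series_geom_le (a : nat -> R) l M : is_series a l ->
  (forall n, Rabs (a n) <= M * (/ 2) ^ n) -> Rabs l <= 2 * M.
Proof.
intros h hb.
assert (g : is_series (fun n => M * (/ 2) ^ n) (M * 2)).
{ apply (is_series_scal (V := R_NormedModule) M).
  replace 2 with (/ (1 - / 2)) at 2 by field; apply is_series_geom; rewrite Rabs_pos_eq; lra. }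
assert (hM : forall n, M * (/ 2) ^ n - a n >= 0 /\ M * (/ 2) ^ n + a n >= 0).
{ intros n; generalize (hb n); unfold Rabs; destruct Rcase_abs; lra. }
pose proof (is_series_minus (V := R_NormedModule) _ _ _ _ g h) as k1.
pose proof (is_series_plus (V := R_NormedModule) _ _ _ _ g h) as k2.
assert (pos : forall b s, is_series b s -> (forall n, b n >= 0) -> 0 <= s).
{ intros b s hs hp; change (Rbar_le 0 s); apply is_lim_seq_le with (fun _ => 0) (sum_n b); [|apply is_lim_seq_const|exact hs].
  intros n; induction n as [|n IH]; [rewrite sum_O; apply Rge_le, hp|].
  rewrite sum_Sn; unfold plus; simpl; generalize (hp (S n)); lra. }
apply Rabs_le; split.
- generalize (pos _ _ k2 (fun n => proj2 (hM n))); unfold plus; simpl; lra.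
- generalize (pos _ _ k1 (fun n => proj1 (hM n))); unfold plus, opp; simpl; lra.
Qed.

Lemma csum_geom_le a l M : csum a l -> (forall n, Cmod (a n) <= M * (/ 2) ^ n) -> Cmod l <= 4 * M.
Proof.
intros [h1 h2] hb; eapply Rle_trans; [apply Cmod_le_sum|].
pose proof (is_series_geom_le _ _ M h1 (fun n => Rle_trans _ _ _ (abs_fst_le_Cmod (a n)) (hb n))).
pose proof (is_series_geom_le _ _ M h2 (fun n => Rle_trans _ _ _ (abs_snd_le_Cmod (a n)) (hb n))).
lra.
Qed.

Lemma series_terms_bounded (a : nat -> R) l : is_series a l -> exists M, forall n, Rabs (a n) <= M.
Proof.
intros h; assert (h0 := ex_series_lim_0 a (ex_intro _ l h)); apply is_lim_seq_spec in h0.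
destruct (h0 (mkposreal 1 Rlt_0_1)) as [N HN]; simpl in HN.
assert (fin : forall N, exists M, forall n, (n < N)%nat -> Rabs (a n) <= M).
{ clear; induction N as [|N [M IH]]; [exists 0; intros; lia|].
  exists (Rmax M (Rabs (a N))); intros n hn; destruct (Nat.eq_dec n N) as [->|]; [apply Rmax_r|].
  eapply Rle_trans; [apply IH; lia|apply Rmax_l]. }
destruct (fin N) as [M HM]; exists (Rmax M 1); intros n.
destruct (Nat.lt_ge_cases n N) as [k|k]; [eapply Rle_trans; [now apply HM|apply Rmax_l]|].
specialize (HN n k); rewrite Rminus_0_r in HN; eapply Rle_trans; [apply Rlt_le, HN|apply Rmax_r].
Qed.

Lemma csum_terms_bounded a l : csum a l -> exists M, 0 <= M /\ forall n, Cmod (a n) <= M.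
Proof.
intros [h1 h2]; destruct (series_terms_bounded _ _ h1) as [M1 H1].
destruct (series_terms_bounded _ _ h2) as [M2 H2]; exists (M1 + M2); split.
- generalize (H1 O) (H2 O) (Rabs_pos (fst (a O))) (Rabs_pos (snd (a O))); lra.
- intros n; eapply Rle_trans; [apply Cmod_le_sum|]; generalize (H1 n) (H2 n); lra.
Qed.

(** * Cauchy's integral formula and Taylor series *)

(** With x = (w - c) / rho and zeta = c + rho cis t, the function 1 / (1 - x cis(-t)) equals (zeta -
    c) / (zeta - w): it is Cauchy's kernel after the substitution d zeta = i (zeta - c) dt. *)
Lemma kernel_neq0 (x : C) t : Cmod x < 1 -> (1 - x * cis (- t))%C <> 0%C.
Proof.
intros h e; assert (k : (x * cis (- t) = 1)%C).
{ transitivity (1 - (1 - x * cis (- t)))%C; [ring|]; rewrite e; ring. }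
apply (f_equal Cmod) in k; rewrite Cmod_mult, Cmod_cis, Cmod_1 in k; lra.
Qed.

Lemma rcont_kernel (x : C) t : Cmod x < 1 -> rcont (fun t => / (1 - x * cis (- t)))%C t.
Proof.
intros h; apply (rcont_comp Cinv); [|now apply Ccont_inv, kernel_neq0].
apply rcont_plus; [apply rcont_const|].
apply rcont_ext with (fun t => (- x) * cis (- t))%C; [intros; ring|].
apply rcont_mult; [apply rcont_const|apply rcont_cis_opp].
Qed.

(** The finite geometric series is integrated together with its remainder, which avoids exchanging
    an infinite sum with the integral. *)
Lemma cI_kernel_expand (phi : R -> C) (x : C) N :
  (forall t, rcont phi t) -> Cmod x < 1 ->
  cI (fun t => phi t * / (1 - x * cis (- t)))%C 0 (2 * PI) =
   (csumn (fun n => x ^ n * cI (fun t => phi t * cis (- t) ^ n)%C 0 (2 * PI)) N +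
   x ^ N * cI (fun t => phi t * cis (- t) ^ N * / (1 - x * cis (- t)))%C 0 (2 * PI))%C.
Proof.
intros hp hx; induction N as [|N IH].
- simpl; ring_simplify; apply cI_ext; intros t; ring.
- rewrite IH; simpl csumn; rewrite <- Cplus_assoc; f_equal; simpl Cpow.
  assert (c1 : forall n t, rcont (fun t => phi t * cis (- t) ^ n)%C t)
    by (intros; apply rcont_mult; [easy|apply rcont_pow, rcont_cis_opp]).
  assert (c2 : forall t, rcont (fun t => phi t * (cis (- t) * cis (- t) ^ N) * / (1 - x * cis (- t)))%C t)
    by (intros; apply rcont_mult; [exact (c1 (S N) _)|now apply rcont_kernel]).
  replace (x * x ^ N)%C with (x ^ N * x)%C by ring; rewrite <- Cmult_assoc, <- (cI_scal x) by easy.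
  rewrite <- Cmult_plus_distr_l; f_equal; rewrite <- cI_plus; [|easy|].
  + apply cI_ext; intros t; field; now apply kernel_neq0.
  + intros t; apply rcont_mult; [apply rcont_const|easy].
Qed.

Lemma cI_kernel_rem (phi : R -> C) (x : C) N M :
  (forall t, rcont phi t) -> Cmod x < 1 -> (forall t, 0 <= t <= 2 * PI -> Cmod (phi t) <= M) ->
  Cmod (x ^ N * cI (fun t => phi t * cis (- t) ^ N * / (1 - x * cis (- t)))%C 0 (2 * PI)) <=
  2 * ((2 * PI - 0) * (M * / (1 - Cmod x))) * Cmod x ^ N.
Proof.
intros hp hx hM; rewrite Cmod_mult, Cmod_pow, Rmult_comm; apply Rmult_le_compat_r.
{ apply pow_le, Cmod_ge_0. }
generalize PI_RGT_0; intros hpi; apply cI_bound; [lra| |].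
- intros t; apply rcont_mult; [|now apply rcont_kernel].
  apply rcont_mult; [easy|apply rcont_pow, rcont_cis_opp].
- intros t ht; rewrite !Cmod_mult, Cmod_pow, Cmod_cis, pow1, Rmult_1_r.
  rewrite Cmod_inv by now apply kernel_neq0.
  apply Rmult_le_compat; [apply Cmod_ge_0| |now apply hM|].
  + left; apply Rinv_0_lt_compat, Cmod_ineq0; now apply kernel_neq0.
  + apply Rinv_le_contravar; [lra|].
    generalize (Cmod_minus_ge 1 (x * cis (- t))); rewrite Cmod_mult, Cmod_cis, Cmod_1; lra.
Qed.

Lemma csum_kernel (phi : R -> C) (x : C) M :
  (forall t, rcont phi t) -> Cmod x < 1 -> (forall t, 0 <= t <= 2 * PI -> Cmod (phi t) <= M) ->
  csum (fun n => x ^ n * cI (fun t => phi t * cis (- t) ^ n)%C 0 (2 * PI))%C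
    (cI (fun t => phi t * / (1 - x * cis (- t)))%C 0 (2 * PI)).
Proof.
intros hp hx hM.
apply csum_of_geom_rem with (2 * ((2 * PI - 0) * (M * / (1 - Cmod x)))) (Cmod x).
{ split; [apply Cmod_ge_0|easy]. }
intros N; rewrite (cI_kernel_expand phi x N hp hx).
eapply Rle_trans; [|apply (cI_kernel_rem phi x N M hp hx hM)].
right; f_equal; ring.
Qed.

Lemma csum_single (a : nat -> C) : (forall n, a (S n) = 0%C) -> csum a (a O).
Proof.
intros h; replace (a O) with (0 + a O)%C by ring; apply csum_decr.
apply csum_of_geom_rem with 0 0; [lra|]; intros N; replace (csumn _ N) with (RtoC 0).
- rewrite Cmod_zero_sub; lra.
- induction N as [|N IH]; [easy|]; simpl; rewrite <- IH, h; ring.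
Qed.

(** In the expansion for the constant function 1 all terms except the one of index 0 integrate to
    zero. *)
Lemma cI_kernel (x : C) : Cmod x < 1 ->
  cI (fun t => / (1 - x * cis (- t)))%C 0 (2 * PI) = RtoC (2 * PI).
Proof.
intros hx.
assert (h := csum_kernel (fun _ => RtoC 1) x 1 (fun t => rcont_const _ t) hx).
rewrite (cI_ext _ (fun t => 1 * / (1 - x * cis (- t)))%C) by (intros; ring).
apply csum_unique with (1 := h ltac:(intros; cbv beta; rewrite Cmod_1; lra)).
match goal with |- csum ?a _ => assert (e : a O = RtoC (2 * PI)) end.
{ rewrite (cI_ext _ (fun _ => RtoC 1)) by (intros; simpl; ring); rewrite cI_const.
  unfold csc; simpl; rewrite Rminus_0_r; ring. }
rewrite <- e; apply csum_single; intros n.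
rewrite (cI_ext _ (fun t => cis (- t) ^ S n)%C) by (intros; simpl; ring).
rewrite cI_cis_pow; ring.
Qed.

(** * Differentiation under the integral sign and Cauchy's formula *)

Definition cont2 (g : R -> R -> C) (x t : R) : Prop :=
  continuity_2d_pt (fun u v => fst (g u v)) x t /\ continuity_2d_pt (fun u v => snd (g u v)) x t.

Lemma cont2_eps g x t : cont2 g x t <-> forall eps, 0 < eps -> exists d, 0 < d /\
  forall u v, Rabs (u - x) < d -> Rabs (v - t) < d -> Cmod (g u v - g x t) < eps.
Proof.
split.
- intros [h1 h2] eps he; assert (he2 : 0 < eps / 2) by lra.
  destruct (h1 (mkposreal _ he2)) as [d1 H1]; destruct (h2 (mkposreal _ he2)) as [d2 H2].
  exists (Rmin d1 d2); split; [apply Rmin_pos; apply cond_pos|]; intros u v hu hv.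
  eapply Rle_lt_trans; [apply Cmod_le_sum|].
  pose proof (H1 u v (Rlt_le_trans _ _ _ hu (Rmin_l _ _)) (Rlt_le_trans _ _ _ hv (Rmin_l _ _))).
  pose proof (H2 u v (Rlt_le_trans _ _ _ hu (Rmin_r _ _)) (Rlt_le_trans _ _ _ hv (Rmin_r _ _))).
  simpl in *; unfold Rminus in *; lra.
- intros H; split; intros eps; destruct (H eps (cond_pos eps)) as [d [hd Hd]];
    exists (mkposreal d hd); intros u v hu hv; eapply Rle_lt_trans; [|exact (Hd u v hu hv)| |exact (Hd u v hu hv)].
  + apply (abs_fst_le_Cmod (g u v - g x t)).
  + apply (abs_snd_le_Cmod (g u v - g x t)).
Qed.

Lemma cont2_comp (f : C -> C) g x t : cont2 g x t -> Ccont f (g x t) -> cont2 (fun u v => f (g u v)) x t.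
Proof.
rewrite !cont2_eps; intros hg hf eps he.
destruct (hf eps he) as [d [hd H]]; destruct (hg d hd) as [d' [hd' H']]; exists d'; auto.
Qed.

Lemma cont2_fst g x t : rcont g x -> cont2 (fun u _ => g u) x t.
Proof.
rewrite rcont_eps, cont2_eps; intros h eps he; destruct (h eps he) as [d [hd H]]; exists d; auto.
Qed.

Lemma cont2_snd g x t : rcont g t -> cont2 (fun _ v => g v) x t.
Proof.
rewrite rcont_eps, cont2_eps; intros h eps he; destruct (h eps he) as [d [hd H]]; exists d; auto.
Qed.

Lemma cont2_plus f g x t : cont2 f x t -> cont2 g x t -> cont2 (fun u v => f u v + g u v)%C x t.
Proof.
intros [h1 h2] [k1 k2]; split.
- exact (continuity_2d_pt_plus _ _ x t h1 k1).
- exact (continuity_2d_pt_plus _ _ x t h2 k2).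
Qed.

Lemma cont2_mult f g x t : cont2 f x t -> cont2 g x t -> cont2 (fun u v => f u v * g u v)%C x t.
Proof.
intros [h1 h2] [k1 k2]; split.
- exact (continuity_2d_pt_minus _ _ x t (continuity_2d_pt_mult _ _ x t h1 k1)
    (continuity_2d_pt_mult _ _ x t h2 k2)).
- exact (continuity_2d_pt_plus _ _ x t (continuity_2d_pt_mult _ _ x t h1 k2)
    (continuity_2d_pt_mult _ _ x t h2 k1)).
Qed.

Lemma is_derive_RInt_param_eq (f df : R -> R -> R) (a b x r : R) : 0 < r ->
  (forall u t, Rabs (u - x) < r -> is_derive (fun v => f v t) u (df u t)) ->
  (forall t, continuity_2d_pt df x t) ->
  (forall u, Rabs (u - x) < r -> ex_RInt (f u) a b) ->
  is_derive (fun u => RInt (f u) a b) x (RInt (df x) a b).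
Proof.
intros hr h1 h2 h3.
rewrite (RInt_ext (df x) (fun t => Derive (fun u => f u t) x)).
2:{ intros t _; symmetry; apply is_derive_unique, h1; rewrite Rminus_diag, Rabs_R0; lra. }
apply is_derive_RInt_param.
- exists (mkposreal r hr); intros u hu t _; exists (df u t); now apply h1.
- intros t _; apply continuity_2d_pt_ext_loc with (2 := h2 t).
  exists (mkposreal r hr); intros u v hu _; symmetry; now apply is_derive_unique, h1.
- exists (mkposreal r hr); intros u hu; now apply h3.
Qed.

Lemma rder_cI_param (f df : R -> R -> C) (a b x r : R) : 0 < r ->
  (forall u t, Rabs (u - x) < r -> rder (fun v => f v t) u (df u t)) ->
  (forall t, cont2 df x t) ->
  (forall u t, Rabs (u - x) < r -> rcont (f u) t) ->
  rder (fun u => cI (f u) a b) x (cI (df x) a b).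
Proof.
intros hr h1 h2 h3; split.
- apply (is_derive_RInt_param_eq (fun u t => fst (f u t)) (fun u t => fst (df u t)) a b x r hr).
  + intros; now apply h1.
  + intros; apply h2.
  + intros u hu; exact (proj1 (rcont_ex_RInt (f u) a b (fun t => h3 u t hu))).
- apply (is_derive_RInt_param_eq (fun u t => snd (f u t)) (fun u t => snd (df u t)) a b x r hr).
  + intros; now apply h1.
  + intros; apply h2.
  + intros u hu; exact (proj2 (rcont_ex_RInt (f u) a b (fun t => h3 u t hu))).
Qed.

Lemma rder_zero_const (g : R -> C) a b : a < b ->
  (forall t, a <= t <= b -> rder g t 0%C) -> g a = g b.
Proof.
intros hab h; apply injective_projections.
- apply (eq_is_derive (V := R_NormedModule) (fun t => fst (g t))); [intros; now apply h|easy].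
- apply (eq_is_derive (V := R_NormedModule) (fun t => snd (g t))); [intros; now apply h|easy].
Qed.

(** The circle is contracted to the point [w]. The derivative in [l] of the integral [G l] along w +
    l (zeta(t) - w) is the integral of a function of [t] with a periodic primitive, so [G] is
    constant. At l = 1 it is the Cauchy integral, at l = 0 it is [f w] times the integral of the
    kernel. *)
Lemma cauchy_formula (f : C -> C) (c w : C) (r rho : R) :
  hol (disc c r) f -> 0 < rho < r -> disc c rho w ->
  cI (fun t => f (c + csc rho (cis t)) * / (1 - csc (/ rho) (w - c) * cis (- t)))%C 0 (2 * PI) =
  (RtoC (2 * PI) * f w)%C.
Proof.
intros hf [hrho hr] hw; assert (cf := fun z => hol_cont _ _ z hf); destruct hf as [f' hf].
set (x := csc (/ rho) (w - c)).
assert (hx : Cmod x < 1).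
{ unfold x, csc; rewrite Cmod_mult, Cmod_R, Rabs_pos_eq by (left; now apply Rinv_0_lt_compat).
  apply Rmult_lt_reg_l with rho; [easy|]; rewrite <- Rmult_assoc, Rinv_r by lra.
  unfold disc in hw; lra. }
assert (hxr : csc rho x = (w - c)%C).
{ unfold x, csc; rewrite RtoC_inv by lra; field; intros e; apply RtoC_inj in e; lra. }
set (P := fun (l t : R) => (w + csc l (c + csc rho (cis t) - w))%C).
assert (cE : forall t, rcont (fun t => c + csc rho (cis t) - w)%C t).
{ intros t; apply rcont_plus; [|apply rcont_const]; apply rcont_plus; [apply rcont_const|].
  apply rcont_mult; [apply rcont_const|apply rcont_cis]. }
(* Differentiation at l = 0 and l = 1 involves parameters slightly outside [0, 1]. Moving by (r -
   rho) / (4 rho) raises the bound rho for the distance to [c] by (r - rho) / 2, so [P] stays in the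
   disc. *)
assert (hin : forall l u t, 0 <= l <= 1 -> Rabs (u - l) < (r - rho) / (4 * rho) -> disc c r (P u t)).
{ intros l u t hl hu; unfold disc, P.
  replace (w + csc u (c + csc rho (cis t) - w) - c)%C
    with (csc (1 - u) (w - c) + csc (u * rho) (cis t))%C
    by (unfold csc; rewrite RtoC_minus, RtoC_mult; ring).
  eapply Rle_lt_trans; [apply Cmod_triangle|]; unfold csc; rewrite !Cmod_mult, !Cmod_R, Cmod_cis, Rmult_1_r.
  unfold disc in hw; rewrite Rabs_mult, (Rabs_pos_eq rho) by lra.
  assert (h1 : Rabs (1 - u) <= 1 - l + (r - rho) / (4 * rho)).
  { replace (1 - u) with ((1 - l) - (u - l)) by ring; eapply Rle_trans; [apply Rabs_triang|].
    rewrite Rabs_Ropp, (Rabs_pos_eq (1 - l)); lra. }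
  assert (h2 : Rabs u <= l + (r - rho) / (4 * rho)).
  { replace u with (l + (u - l)) at 1 by ring; eapply Rle_trans; [apply Rabs_triang|].
    rewrite (Rabs_pos_eq l); lra. }
  apply Rle_lt_trans with ((1 - l + (r - rho) / (4 * rho)) * rho + (l + (r - rho) / (4 * rho)) * rho).
  - apply Rplus_le_compat; [|apply Rmult_le_compat_r; lra].
    apply Rmult_le_compat; try lra; [apply Rabs_pos|apply Cmod_ge_0].
  - replace ((1 - l + (r - rho) / (4 * rho)) * rho + (l + (r - rho) / (4 * rho)) * rho)
      with (rho + (r - rho) / 2) by (field; lra); lra. }
assert (hr0 : 0 < (r - rho) / (4 * rho)) by (apply Rdiv_lt_0_compat; lra).
assert (hin0 : forall l t, 0 <= l <= 1 -> disc c r (P l t)).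
{ intros l t hl; apply (hin l l t hl); rewrite Rminus_diag, Rabs_R0; easy. }
set (K := fun t => (/ (1 - x * cis (- t)))%C).
(* The denominator of the kernel cancels the factor zeta - w that comes from differentiating [P] in
   [l], which leaves an integrand without a pole. *)
assert (hK : forall t, ((c + csc rho (cis t) - w) * K t = csc rho (cis t))%C).
{ intros t; unfold K; replace (c + csc rho (cis t) - w)%C with (csc rho (cis t) - csc rho x)%C
    by (rewrite hxr; ring).
  generalize (kernel_neq0 x t hx); rewrite cis_opp; intros hk; unfold csc; field; split;
    [apply cis_neq0|].
  intros e; apply hk; transitivity ((cis t - x) * / cis t)%C; [field; apply cis_neq0|rewrite e; ring]. }
set (G := fun l => cI (fun t => f (P l t) * K t)%C 0 (2 * PI)).
assert (rP : forall u t, rder (fun v => P v t) u (c + csc rho (cis t) - w)%C).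
{ intros u t; unfold P; split; simpl; auto_derive; try easy; ring. }
assert (cP : forall u t, rcont (P u) t).
{ intros u t; unfold P; apply rcont_plus; [apply rcont_const|].
  apply rcont_mult; [apply rcont_const|apply cE]. }
assert (cK : forall t, rcont K t) by (intros; now apply rcont_kernel).
assert (cI0 : forall l, 0 <= l <= 1 -> forall t, rcont (fun t => f' (P l t) * csc rho (cis t))%C t).
{ intros l hl t; apply rcont_mult; [|apply rcont_mult; [apply rcont_const|apply rcont_cis]].
  apply rcont_comp; [apply cP|now apply hf, hin0]. }
assert (dG : forall l, 0 <= l <= 1 ->
  rder G l (cI (fun t => f' (P l t) * csc rho (cis t))%C 0 (2 * PI))).
{ intros l hl.
  apply (rder_cI_param (fun l t => f (P l t) * K t)%C
    (fun l t => f' (P l t) * csc rho (cis t))%C 0 (2 * PI) l ((r - rho) / (4 * rho)) hr0).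
  - intros u t hu; eapply rder_eq.
    + apply rder_mult; [|apply rder_const]; apply (rder_comp f); [apply rP|].
      apply hf; exact (hin l u t hl hu).
    + transitivity (f' (P u t) * ((c + csc rho (cis t) - w) * K t))%C; [ring|now rewrite hK].
  - intros t; apply cont2_mult; [|apply cont2_snd, rcont_mult; [apply rcont_const|apply rcont_cis]].
    apply cont2_comp; [|now apply hf, hin0].
    apply cont2_plus; [apply cont2_fst, rcont_const|]; apply cont2_mult; [|now apply cont2_snd].
    apply cont2_fst; split; [apply continuous_id|apply continuous_const].
  - intros u t hu; apply rcont_mult; [|easy]; apply rcont_comp; [apply cP|].
    apply cf; exact (hin l u t hl hu). }
assert (hCi : Ci <> 0%C) by (intros e; apply (f_equal snd) in e; simpl in e; lra).
(* The primitive in [t] is f(P l t) / (l i). It makes no sense for l = 0, where the integrand is the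
   constant [f' w] times rho cis t and is integrated directly. *)
assert (z : forall l, 0 <= l <= 1 -> cI (fun t => f' (P l t) * csc rho (cis t))%C 0 (2 * PI) = 0%C).
{ intros l hl; destruct (Req_dec l 0) as [->|hl0].
  - rewrite (cI_derive (fun t => f' w * csc rho (cis t) * / Ci)%C).
    + rewrite cis_2PI; ring.
    + intros t; replace (P 0 t) with w by (unfold P, csc; ring).
      assert (h : rder (fun t => (f' w * RtoC rho * / Ci) * cis t)%C t
        (0 * cis t + (f' w * RtoC rho * / Ci) * (Ci * cis t))%C)
        by (apply rder_mult; [apply rder_const|apply rder_cis]).
      apply rder_ext with (2 := rder_eq _ _ _ (f' w * csc rho (cis t))%C h ltac:(unfold csc; field; easy)).
      intros; unfold csc; ring.
    + now apply cI0.
  - assert (hl1 : RtoC l <> 0%C) by (intros e; now apply RtoC_inj in e).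
    rewrite (cI_derive (fun t => f (P l t) * / (RtoC l * Ci))%C).
    + unfold P; rewrite cis_2PI; ring.
    + intros t; eapply rder_eq.
      * apply rder_mult; [|apply rder_const]; apply (rder_comp f) with (m := csc (l * rho) (Ci * cis t)).
        -- unfold P; split; simpl; auto_derive; try easy; ring.
        -- now apply hf, hin0.
      * unfold csc; rewrite RtoC_mult; field; easy.
    + now apply cI0. }
assert (e01 : G 0 = G 1).
{ apply rder_zero_const; [lra|]; intros t ht; rewrite <- (z t ht); now apply dG. }
transitivity (G 1).
{ unfold G; apply cI_ext; intros t; unfold K; f_equal; f_equal; unfold P, csc; ring. }
rewrite <- e01; unfold G.
rewrite (cI_ext _ (fun t => f w * K t)%C)
  by (intros t; f_equal; f_equal; unfold P, csc; ring).
rewrite cI_scal by easy; unfold K; rewrite cI_kernel by easy; ring.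
Qed.

(** Up to the factor 2 PI rho^n this is the n-th Taylor coefficient at [c]. *)
Definition circ_coef (f : C -> C) (c : C) (rho : R) (n : nat) : C :=
  cI (fun t => f (c + csc rho (cis t)) * cis (- t) ^ n)%C 0 (2 * PI).

Lemma rcont_circle f c rho r t : (forall z, disc c r z -> Ccont f z) -> 0 < rho < r ->
  rcont (fun t => f (c + csc rho (cis t)))%C t.
Proof.
intros hf hr; apply rcont_comp; [|apply hf].
- apply rcont_plus; [apply rcont_const|apply rcont_mult; [apply rcont_const|apply rcont_cis]].
- unfold disc, csc; replace (c + RtoC rho * cis t - c)%C with (RtoC rho * cis t)%C by ring.
  rewrite Cmod_mult, Cmod_cis, Cmod_R, Rabs_pos_eq; lra.
Qed.

Lemma rcont_bounded (f : R -> C) a b : (forall t, rcont f t) ->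
  exists M, 0 <= M /\ forall t, a <= t <= b -> Cmod (f t) <= M.
Proof.
intros hf.
destruct (bounded_continuity (V := R_NormedModule) (fun t => fst (f t)) a b) as [M1 H1];
  [intros; apply hf|].
destruct (bounded_continuity (V := R_NormedModule) (fun t => snd (f t)) a b) as [M2 H2];
  [intros; apply hf|].
exists (Rabs M1 + Rabs M2); split; [generalize (Rabs_pos M1) (Rabs_pos M2); lra|].
intros t ht; eapply Rle_trans; [apply Cmod_le_sum|].
pose proof (H1 t ht) as k1; pose proof (H2 t ht) as k2; unfold norm in k1, k2; simpl in k1, k2.
unfold abs in k1, k2; simpl in k1, k2.
generalize (Rle_abs M1) (Rle_abs M2); lra.
Qed.

Lemma taylor_circle f c r rho w : hol (disc c r) f -> 0 < rho < r -> disc c rho w ->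
  csum (fun n => csc (/ (2 * PI) * / rho ^ n) (circ_coef f c rho n) * (w - c) ^ n)%C (f w).
Proof.
intros hf hr hw; generalize PI_RGT_0; intros hpi.
set (phi := fun t => f (c + csc rho (cis t))%C).
assert (cphi : forall t, rcont phi t)
  by (intros; apply (rcont_circle f c rho r); [intros; now apply (hol_cont _ _ _ hf)|easy]).
destruct (rcont_bounded phi 0 (2 * PI) cphi) as [M [hM0 hM]].
assert (hx : Cmod (csc (/ rho) (w - c)) < 1).
{ unfold csc; rewrite Cmod_mult, Cmod_R, Rabs_pos_eq by (left; now apply Rinv_0_lt_compat).
  apply Rmult_lt_reg_l with rho; [easy|]; rewrite <- Rmult_assoc, Rinv_r by lra.
  unfold disc in hw; lra. }
pose proof (csum_kernel phi _ M cphi hx hM) as h.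
unfold phi in h; rewrite (cauchy_formula f c w r rho hf hr hw) in h.
apply (csum_scal (RtoC (/ (2 * PI)))) in h.
rewrite Cmult_assoc, <- RtoC_mult, Rinv_l, Cmult_1_l in h by lra.
apply csum_ext with (2 := h); intros n; unfold circ_coef, csc.
rewrite !RtoC_mult, Cpow_mult_l, <- RtoC_pow, pow_inv; ring.
Qed.

(** * Estimates and uniqueness for power series, Taylor's theorem *)

Lemma small_zero (a : C) M r : 0 < r ->
  (forall z : C, z <> 0%C -> Cmod z < r -> Cmod a <= M * Cmod z) -> a = 0%C.
Proof.
intros hr h; apply Cmod_eq_0, Rle_antisym; [|apply Cmod_ge_0].
apply Rnot_lt_le; intros hp.
set (t := Rmin (r / 2) (Cmod a / (2 * (Rabs M + 1)))).
assert (hM := Rabs_pos M).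
assert (ht : 0 < t) by (apply Rmin_pos; [lra|apply Rdiv_lt_0_compat; lra]).
assert (k : Cmod a <= M * t).
{ assert (e : Cmod (RtoC t) = t) by (rewrite Cmod_R, Rabs_pos_eq; lra).
  rewrite <- e at 1; apply h; [intros k; apply RtoC_inj in k; lra|rewrite e].
  generalize (Rmin_l (r / 2) (Cmod a / (2 * (Rabs M + 1)))); fold t; lra. }
assert (k2 : t * (2 * (Rabs M + 1)) <= Cmod a).
{ replace (Cmod a) with (Cmod a / (2 * (Rabs M + 1)) * (2 * (Rabs M + 1))) by (field; lra).
  apply Rmult_le_compat_r; [lra|apply Rmin_r]. }
generalize (Rle_abs M); nra.
Qed.

(** Convergence at [z0] bounds the terms there; at half that modulus they are dominated by a
    geometric series of ratio 1/2, uniformly in [z]. *)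
Lemma psum_bound (a : nat -> C) (z0 l0 : C) : z0 <> 0%C -> csum (fun n => a n * z0 ^ n)%C l0 ->
  exists M, 0 <= M /\ forall z l, Cmod z <= Cmod z0 / 2 -> csum (fun n => a n * z ^ n)%C l -> Cmod l <= M.
Proof.
intros hz0 h; destruct (csum_terms_bounded _ _ h) as [M [hM H]]; exists (4 * M); split; [lra|].
intros z l hz hl; apply csum_geom_le with (1 := hl); intros n.
rewrite Cmod_mult, Cmod_pow.
apply Rle_trans with (Cmod (a n * z0 ^ n) * (/ 2) ^ n).
- rewrite Cmod_mult, Cmod_pow, Rmult_assoc; apply Rmult_le_compat_l; [apply Cmod_ge_0|].
  rewrite <- Rpow_mult_distr; apply pow_incr; split; [apply Cmod_ge_0|lra].
- apply Rmult_le_compat_r; [apply pow_le; lra|apply H].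
Qed.

Lemma psum_shift (a : nat -> C) (z l : C) : z <> 0%C -> csum (fun n => a n * z ^ n)%C l ->
  csum (fun n => a (S n) * z ^ n)%C (/ z * (l - a O))%C.
Proof.
intros hz h; apply csum_incr in h; apply (csum_scal (/ z)%C) in h; simpl in h.
rewrite Cmult_1_r in h; apply csum_ext with (2 := h); intros; field; easy.
Qed.

Lemma psum_lip (a : nat -> C) (z0 l0 : C) : z0 <> 0%C -> csum (fun n => a n * z0 ^ n)%C l0 ->
  exists M, 0 <= M /\ forall z l, Cmod z <= Cmod z0 / 2 -> csum (fun n => a n * z ^ n)%C l ->
    Cmod (l - a O) <= M * Cmod z.
Proof.
intros hz0 h; destruct (psum_bound _ _ _ hz0 (psum_shift _ _ _ hz0 h)) as [M [hM H]].
exists M; split; [easy|]; intros z l hz hl; destruct (Ceq_dec z 0) as [->|n].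
- apply csum_incr in hl; replace (l - a O)%C with (RtoC 0).
  + rewrite Cmod_0; lra.
  + simpl in hl; rewrite Cmult_1_r in hl; apply csum_unique with (2 := hl).
    apply csum_ext with (fun n => RtoC 0); [intros; ring|].
    now apply (csum_single (fun _ => RtoC 0)).
- pose proof (H z _ hz (psum_shift _ _ _ n hl)) as k.
  replace (l - a O)%C with (/ z * (l - a O) * z)%C by (field; easy).
  rewrite Cmod_mult; apply Rmult_le_compat_r; [apply Cmod_ge_0|easy].
Qed.

(** The constant coefficient differs from a sum at [z] by O(|z|), hence is zero; dividing the series
    by [z] brings the next coefficient to the front. *)
Lemma psum_zero (a : nat -> C) r : 0 < r ->
  (forall z : C, z <> 0%C -> Cmod z < r -> csum (fun n => a n * z ^ n)%C 0%C) -> forall n, a n = 0%C.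
Proof.
intros hr h n.
assert (a0 : forall a : nat -> C, (forall z : C, z <> 0%C -> Cmod z < r -> csum (fun n => a n * z ^ n)%C 0%C) ->
  a O = 0%C).
{ clear a h; intros a h; set (z0 := RtoC (r / 2)).
  assert (hz0 : z0 <> 0%C) by (intros e; apply RtoC_inj in e; lra).
  assert (m0 : Cmod z0 = r / 2) by (unfold z0; rewrite Cmod_R, Rabs_pos_eq; lra).
  destruct (psum_lip a z0 _ hz0 (h z0 hz0 ltac:(lra))) as [M [hM H]].
  apply small_zero with M (r / 4); [lra|]; intros z hz1 hz2.
  rewrite <- Cmod_opp; replace (- a O)%C with (0 - a O)%C by ring.
  apply H; [lra|apply h; [easy|lra]]. }
revert a h; induction n as [|n IH]; intros a h; [now apply a0|].
apply (IH (fun n => a (S n))); intros z hz1 hz2.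
replace (RtoC 0) with (/ z * (0 - a O))%C by (rewrite a0 by easy; field; easy).
now apply psum_shift, h.
Qed.

Lemma psum_unique (a b : nat -> C) r g : 0 < r ->
  (forall z : C, z <> 0%C -> Cmod z < r -> csum (fun n => a n * z ^ n)%C (g z)) ->
  (forall z : C, z <> 0%C -> Cmod z < r -> csum (fun n => b n * z ^ n)%C (g z)) ->
  forall n, a n = b n.
Proof.
intros hr ha hb n.
assert (e : (a n - b n)%C = 0%C).
{ apply (psum_zero (fun n => a n - b n)%C r hr); intros z h1 h2.
  replace (RtoC 0) with (g z + (-1) * g z)%C by ring.
  apply csum_ext with (fun n => a n * z ^ n + (-1) * (b n * z ^ n))%C; [intros; ring|].
  apply csum_plus; [|apply csum_scal]; auto. }
replace (a n) with (a n - b n + b n)%C by ring; rewrite e; ring.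
Qed.

(** The second conclusion, valid for every radius, lets the contour integrals that define the
    spherical coefficients be read off from the series. *)
Theorem taylor f c r : 0 < r -> hol (disc c r) f -> exists a : nat -> C,
  (forall z, disc c r z -> csum (fun n => a n * (z - c) ^ n)%C (f z)) /\
  (forall rho n, 0 < rho < r -> circ_coef f c rho n = (RtoC (2 * PI) * RtoC rho ^ n * a n)%C).
Proof.
intros hr hf; generalize PI_RGT_0; intros hpi.
set (A := fun rho n => csc (/ (2 * PI) * / rho ^ n) (circ_coef f c rho n)).
assert (hA : forall rho z, 0 < rho < r -> disc c rho z -> csum (fun n => A rho n * (z - c) ^ n)%C (f z))
  by (intros; now apply (taylor_circle f c r)).
(* Coefficients computed on different circles agree by uniqueness on the smaller disc; this yields
   one series for the whole disc. *)
assert (hAr : forall rho n, 0 < rho < r -> A rho n = A (r / 2) n).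
{ intros rho n h; apply (psum_unique (A rho) (A (r / 2)) (Rmin rho (r / 2)) (fun z => f (z + c)%C)).
  - apply Rmin_pos; lra.
  - intros z _ hz; pose proof (hA rho (z + c)%C h) as k.
    replace (z + c - c)%C with z in k by ring; apply k.
    unfold disc; replace (z + c - c)%C with z by ring.
    eapply Rlt_le_trans; [exact hz|apply Rmin_l].
  - intros z _ hz; pose proof (hA (r / 2) (z + c)%C ltac:(lra)) as k.
    replace (z + c - c)%C with z in k by ring; apply k.
    unfold disc; replace (z + c - c)%C with z by ring.
    eapply Rlt_le_trans; [exact hz|apply Rmin_r]. }
exists (A (r / 2)); split.
- intros z hz; unfold disc in hz; assert (h0 := Cmod_ge_0 (z - c)).
  set (rho := (Cmod (z - c) + r) / 2); assert (hrho : 0 < rho < r) by (unfold rho; lra).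
  apply csum_ext with (fun n => A rho n * (z - c) ^ n)%C.
  + intros n; now rewrite hAr.
  + apply hA; [easy|unfold disc, rho; lra].
- intros rho n h; rewrite <- (hAr rho n h); unfold A, csc.
  rewrite (RtoC_mult (/ (2 * PI))), (RtoC_inv (2 * PI)), (RtoC_inv (rho ^ n)), RtoC_pow
    by (try apply pow_nonzero; lra).
  field; split; [rewrite <- RtoC_pow|]; intros e; apply RtoC_inj in e; [|lra].
  revert e; apply pow_nonzero; lra.
Qed.

Lemma taylor_coef0 (a : nat -> C) c l : csum (fun n => a n * (c - c) ^ n)%C l -> l = a O.
Proof.
intros h; apply csum_unique with (1 := h).
apply csum_ext with (fun n => match n with O => a O | S _ => RtoC 0 end).
- intros [|n]; simpl; ring.
- now apply (csum_single (fun n => match n with O => a O | S _ => RtoC 0 end)).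
Qed.

(** Up to a power of rho the integral is the coefficient of index 0 of f(z) (z - c)^(m + 1), a
    function that vanishes at [c]. *)
Lemma circ_coef_neg f c r rho m : hol (disc c r) f -> 0 < rho < r ->
  cI (fun t => f (c + csc rho (cis t)) * cis t ^ S m)%C 0 (2 * PI) = 0%C.
Proof.
intros hf hr.
destruct (taylor (fun z => f z * (z - c) ^ S m)%C c r) as [a [h1 h2]]; [lra| |].
{ apply hol_mult; [easy|]; apply hol_pow, hol_sub_const. }
assert (a0 : a O = 0%C).
{ rewrite <- (taylor_coef0 a c _ (h1 c ltac:(unfold disc; rewrite Cmod_zero_sub; lra))); simpl; ring. }
pose proof (h2 rho O hr) as e; rewrite a0 in e; unfold circ_coef in e.
assert (hrho : RtoC rho <> 0%C) by (intros k; apply RtoC_inj in k; lra).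
assert (k : cI (fun t => RtoC rho ^ S m * (f (c + csc rho (cis t)) * cis t ^ S m))%C 0 (2 * PI) = 0%C).
{ transitivity (RtoC (2 * PI) * RtoC rho ^ 0 * 0)%C; [rewrite <- e; apply cI_ext|ring].
  intros t; replace (c + csc rho (cis t) - c)%C with (csc rho (cis t)) by ring.
  unfold csc; rewrite Cpow_mult_l; change (cis (- t) ^ 0)%C with (RtoC 1); ring. }
rewrite cI_scal in k.
- assert (hp := Cpow_nz _ (S m) hrho).
  apply (f_equal (Cmult (/ (RtoC rho ^ S m)))) in k.
  rewrite Cmult_assoc, Cinv_l, Cmult_1_l in k by easy; rewrite k; ring.
- intros t; apply rcont_mult; [|apply rcont_pow, rcont_cis].
  apply (rcont_circle f c rho r); [intros; now apply (hol_cont _ _ _ hf)|easy].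
Qed.

Lemma Ccont_lip (g : C -> C) c M d : 0 < d -> 0 <= M ->
  (forall z, disc c d z -> Cmod (g z - g c) <= M * Cmod (z - c)) -> Ccont g c.
Proof.
intros hd hM h eps he; exists (Rmin d (eps / (M + 1))); split.
- apply Rmin_pos; [easy|apply Rdiv_lt_0_compat; lra].
- intros z hz; assert (k1 := Rlt_le_trans _ _ _ hz (Rmin_l _ _)).
  assert (k2 := Rlt_le_trans _ _ _ hz (Rmin_r _ _)).
  eapply Rle_lt_trans; [now apply h|].
  apply Rle_lt_trans with ((M + 1) * Cmod (z - c)); [generalize (Cmod_ge_0 (z - c)); nra|].
  apply Rlt_le_trans with ((M + 1) * (eps / (M + 1))); [apply Rmult_lt_compat_l; lra|].
  right; field; lra.
Qed.

Lemma taylor_lip (a : nat -> C) f c r : 0 < r ->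
  (forall z, z <> c -> disc c r z -> csum (fun n => a n * (z - c) ^ n)%C (f z)) ->
  exists M d, 0 <= M /\ 0 < d <= r /\
    forall z, z <> c -> disc c d z -> Cmod (f z - a O) <= M * Cmod (z - c).
Proof.
intros hr h; set (z0 := RtoC (r / 2)).
assert (hz0 : z0 <> 0%C) by (intros e; apply RtoC_inj in e; lra).
assert (m0 : Cmod z0 = r / 2) by (unfold z0; rewrite Cmod_R, Rabs_pos_eq; lra).
assert (ez : (z0 + c - c)%C = z0) by ring.
assert (hz1 : (z0 + c)%C <> c) by (intros e; apply hz0; rewrite <- ez, e; ring).
pose proof (h (z0 + c)%C hz1) as hs; unfold disc in hs; rewrite ez in hs.
destruct (psum_lip a z0 _ hz0 (hs ltac:(lra))) as [M [hM H]].
exists M, (r / 4); split; [easy|]; split; [lra|]; intros z hz hd; unfold disc in *.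
apply H; [lra|apply h; [easy|lra]].
Qed.

(** Off [c] Caratheodory's quotient [q] is the sum of the shifted series, which tends to its
    constant coefficient; continuity of [q] at [c] identifies [l] with it. *)
Lemma taylor_coef1 (a : nat -> C) f c l r : 0 < r -> cder f c l ->
  (forall z, disc c r z -> csum (fun n => a n * (z - c) ^ n)%C (f z)) -> l = a 1%nat.
Proof.
intros hr [q [hq [cq eq]]] h.
assert (a0 : f c = a O) by
  exact (taylor_coef0 a c _ (h c ltac:(unfold disc; rewrite Cmod_zero_sub; lra))).
assert (hs : forall z, z <> c -> disc c r z -> csum (fun n => a (S n) * (z - c) ^ n)%C (q z)).
{ intros z hz hd; replace (q z) with (/ (z - c) * (f z - a O))%C.
  - now apply psum_shift, h; [apply Csub_neq0|].
  - rewrite eq, a0; field; now apply Csub_neq0. }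
destruct (taylor_lip (fun n => a (S n)) q c r hr hs) as [M [d [hM [hd H]]]].
apply NNPP; intros hn; assert (hp := Cmod_ineq0 _ (Csub_neq0 _ _ hn)).
destruct (cq (Cmod (l - a 1%nat) / 2) ltac:(lra)) as [d2 [hd2 H2]].
(* At distance [t] from [c] the value of [q] is within half of |l - a 1| of [l] and within a quarter
   of it of [a 1], which is contradictory. *)
set (t := Rmin (Rmin d d2) (Cmod (l - a 1%nat) / (2 * (M + 1))) / 2).
assert (ht : 0 < t).
{ unfold t; apply Rdiv_lt_0_compat; [|lra]; repeat apply Rmin_pos; try lra.
  apply Rdiv_lt_0_compat; lra. }
pose proof (Rmin_l (Rmin d d2) (Cmod (l - a 1%nat) / (2 * (M + 1)))) as m1.
pose proof (Rmin_r (Rmin d d2) (Cmod (l - a 1%nat) / (2 * (M + 1)))) as m2.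
pose proof (Rmin_l d d2) as m3; pose proof (Rmin_r d d2) as m4.
assert (ez : (c + RtoC t - c)%C = RtoC t) by ring.
assert (mz : Cmod (c + RtoC t - c) = t) by (rewrite ez, Cmod_R, Rabs_pos_eq; lra).
assert (nz : (c + RtoC t)%C <> c).
{ intros e; rewrite e, Cmod_zero_sub in mz; lra. }
assert (k1 := H (c + RtoC t)%C nz ltac:(unfold disc; rewrite mz; unfold t in *; lra)).
assert (k2 := H2 (c + RtoC t)%C ltac:(rewrite mz; unfold t in *; lra)).
rewrite mz in k1; rewrite hq in k2.
assert (k3 : M * t <= Cmod (l - a 1%nat) / 4).
{ apply Rle_trans with ((M + 1) * t); [nra|].
  apply Rle_trans with ((M + 1) * (Cmod (l - a 1%nat) / (2 * (M + 1)) / 2)).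
  - apply Rmult_le_compat_l; [lra|]; unfold t; lra.
  - right; field; lra. }
pose proof (Cmod_sub_trans l (q (c + RtoC t)%C) (a 1%nat)) as k4.
rewrite (Cmod_sub_sym l (q (c + RtoC t)%C)) in k4; cbv beta in k1; lra.
Qed.

(** The estimate is made on the circle of radius r / 2, inside the open disc, and loses another
    factor 2 in [cI_bound]; hence 4 M / r. *)
Lemma cauchy_estimate f f' c r M : 0 < r -> (forall z, disc c r z -> cder f z (f' z) /\ Ccont f' z) ->
  (forall z, disc c r z -> Cmod (f z) <= M) -> Cmod (f' c) <= 4 * M / r.
Proof.
intros hr hf hM; generalize PI_RGT_0; intros hpi.
assert (hc : disc c r c) by (unfold disc; rewrite Cmod_zero_sub; lra).
assert (hol_f : hol (disc c r) f) by (now exists f').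
destruct (taylor f c r hr hol_f) as [a [h1 h2]].
rewrite (taylor_coef1 a f c _ r hr (proj1 (hf c hc)) h1).
specialize (h2 (r / 2) 1%nat ltac:(lra)); apply (f_equal Cmod) in h2.
rewrite !Cmod_mult, Cmod_pow, !Cmod_R, !Rabs_pos_eq in h2 by lra.
assert (k : Cmod (circ_coef f c (r / 2) 1) <= 2 * ((2 * PI - 0) * M)).
{ apply cI_bound; [lra| |].
  - intros t; apply rcont_mult; [|apply rcont_pow, rcont_cis_opp].
    apply (rcont_circle f c (r / 2) r); [intros; now apply (hol_cont _ _ _ hol_f)|lra].
  - intros t _; rewrite Cmod_mult, Cmod_pow, Cmod_cis, pow1, Rmult_1_r; apply hM.
    unfold disc, csc; replace (c + RtoC (r / 2) * cis t - c)%C with (RtoC (r / 2) * cis t)%C by ring.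
    rewrite Cmod_mult, Cmod_cis, Cmod_R, Rabs_pos_eq; lra. }
rewrite h2 in k; apply Rmult_le_reg_l with (2 * PI * (r / 2) ^ 1); [simpl; nra|].
replace (2 * PI * (r / 2) ^ 1 * (4 * M / r)) with (2 * ((2 * PI - 0) * M)) by (field; lra).
exact k.
Qed.

(** * Punctured discs and Riemann's theorem on removable singularities *)

Definition pdisc (c : C) (r : R) (z : C) : Prop := z <> c /\ disc c r z.

Lemma disc_center c r : 0 < r -> disc c r c.
Proof. intros; unfold disc; rewrite Cmod_zero_sub; lra. Qed.

Lemma disc_mono c r s z : r <= s -> disc c r z -> disc c s z.
Proof. unfold disc; lra. Qed.

Lemma pdisc_disc c r z w : pdisc c r z -> disc z (Cmod (z - c)) w -> w <> c /\ Cmod (w - c) < 2 * Cmod (z - c).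
Proof.
unfold pdisc, disc; intros [hz1 hz2] hw; split.
- intros ->; rewrite Cmod_sub_sym in hw; lra.
- generalize (Cmod_sub_trans w z c); lra.
Qed.

Definition fill (f : C -> C) (c v : C) (z : C) : C := if Ceq_dec z c then v else f z.

Lemma fill_at f c v : fill f c v c = v.
Proof. unfold fill; now destruct (Ceq_dec c c). Qed.

Lemma fill_off f c v z : z <> c -> fill f c v z = f z.
Proof. unfold fill; now destruct (Ceq_dec z c). Qed.

Lemma fill_off_loc f c v z : z <> c -> exists r, 0 < r /\ forall w, disc z r w -> f w = fill f c v w.
Proof.
intros hz; exists (Cmod (z - c)); split; [now apply Cmod_ineq0, Csub_neq0|].
intros w hw; rewrite fill_off; [easy|].
intros ->; unfold disc in hw; rewrite Cmod_sub_sym in hw; lra.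
Qed.

(* [(z - c)^2 f z] is C^1 at [c] by the Cauchy estimate on the disc of radius [|z - c|]
   around [z]; its Taylor series starts in degree 2 and can be divided by [(z - c)^2]. *)
Lemma removable_taylor f c r M : 0 < r -> hol (pdisc c r) f ->
  (forall z, pdisc c r z -> Cmod (f z) <= M) ->
  exists a : nat -> C, forall z, pdisc c (r / 2) z -> csum (fun n => a n * (z - c) ^ n)%C (f z).
Proof.
intros hr [f' hf] hM.
assert (hM0 : 0 <= M).
{ eapply Rle_trans; [apply Cmod_ge_0|apply (hM (c + RtoC (r / 2))%C)].
  assert (e : (c + RtoC (r / 2) - c)%C = RtoC (r / 2)) by ring; split.
  - intros k; rewrite k in e; assert (e2 : (c - c)%C = 0%C) by ring; rewrite e2 in e.
    apply RtoC_inj in e; lra.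
  - unfold disc; rewrite e, Cmod_R, Rabs_pos_eq; lra. }
(* For [z] in the disc of half the radius, the disc of radius |z - c| around [z] still lies in the
   punctured disc where [f] is bounded. *)
assert (hf' : forall z, pdisc c (r / 2) z -> Cmod (f' z) <= 4 * M / Cmod (z - c)).
{ intros z hz; apply (cauchy_estimate f f'); [apply Cmod_ineq0, Csub_neq0, hz| |]; intros w hw;
    destruct (pdisc_disc _ _ _ _ hz hw) as [k1 k2]; destruct hz as [hz1 hz2]; unfold disc in hz2;
    [apply hf|apply hM]; split; auto; unfold disc; lra. }
assert (hq : Ccont (fun z => (z - c) * f z)%C c).
{ apply Ccont_lip with M (r / 2); [lra|easy|]; intros z h.
  replace ((z - c) * f z - (c - c) * f c)%C with ((z - c) * f z)%C by ring.
  rewrite Cmod_mult, Rmult_comm; destruct (Ceq_dec z c) as [->|hn].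
  + rewrite Cmod_zero_sub; lra.
  + apply Rmult_le_compat_r; [apply Cmod_ge_0|apply hM]; split; [easy|].
    apply disc_mono with (2 := h); lra. }
set (K := fun z => ((z - c) * (z - c) * f z)%C).
set (K' := fun z => (2 * (z - c) * f z + (z - c) * (z - c) * f' z)%C).
assert (hK : hol (disc c (r / 2)) K).
{ exists K'; intros z hz; destruct (Ceq_dec z c) as [->|hn]; [split|].
  - exists (fun z => (z - c) * f z)%C; split; [unfold K'; ring|].
    split; [exact hq|intros; unfold K; ring].
  - apply Ccont_lip with (6 * M) (r / 2); [lra|lra|]; intros z h.
    replace (K' z - K' c)%C with (K' z)%C by (unfold K'; ring).
    destruct (Ceq_dec z c) as [->|hn].
    + unfold K'; replace (2 * (c - c) * f c + (c - c) * (c - c) * f' c)%C with (RtoC 0) by ring.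
      rewrite Cmod_0, Cmod_zero_sub; lra.
    + assert (hp := Cmod_ineq0 _ (Csub_neq0 _ _ hn)).
      assert (b1 := hM z (conj hn (disc_mono c (r / 2) r z ltac:(lra) h))).
      assert (b2 := hf' z (conj hn h)).
      unfold K'; eapply Rle_trans; [apply Cmod_triangle|]; rewrite !Cmod_mult, Cmod_R.
      replace (Rabs 2) with 2 by (rewrite Rabs_pos_eq; lra).
      assert (b3 : Cmod (z - c) * Cmod (z - c) * Cmod (f' z) <= 4 * M * Cmod (z - c)).
      { apply Rle_trans with (Cmod (z - c) * Cmod (z - c) * (4 * M / Cmod (z - c))).
        - apply Rmult_le_compat_l; [nra|easy].
        - right; field; lra. }
      nra.
  - assert (hz' : pdisc c r z) by (split; [easy|apply disc_mono with (2 := hz); lra]).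
    split.
    + assert (h1 : cder (fun z => (z - c) * (z - c))%C z (1 * (z - c) + (z - c) * 1)).
      { apply (cder_mult (fun z => z - c)%C (fun z => z - c)%C);
          apply (cder_eq _ _ (1 + 0)); try ring; apply (cder_plus (fun z => z) (fun _ => - c)%C);
          (apply cder_id || apply cder_const). }
      apply cder_eq with (1 := cder_mult _ _ _ _ _ h1 (proj1 (hf z hz'))); unfold K'; ring.
    + assert (l1 : Ccont (fun z => z - c)%C z)
        by (apply Ccont_plus; [apply Ccont_id|apply Ccont_const]).
      assert (cfz := cder_cont _ _ _ (proj1 (hf z hz'))).
      apply Ccont_plus; apply Ccont_mult; try (apply Ccont_mult); auto; [apply Ccont_const|].
      now apply hf. }
destruct (taylor K c (r / 2) ltac:(lra) hK) as [b [h1 _]].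
assert (Kc : K c = 0%C) by (unfold K; ring).
assert (b0 : b O = 0%C).
{ rewrite <- Kc; symmetry; exact (taylor_coef0 b c _ (h1 c (disc_center c (r / 2) ltac:(lra)))). }
assert (b1 : b 1%nat = 0%C).
{ symmetry; apply (taylor_coef1 b K c 0%C (r / 2)); [lra| |easy].
  exists (fun z => (z - c) * f z)%C; split; [ring|]; split; [exact hq|intros; unfold K; ring]. }
exists (fun n => b (S (S n))); intros z [hz1 hz2]; assert (hn := Csub_neq0 _ _ hz1).
replace (f z) with (/ (z - c) * (/ (z - c) * (K z - b O) - b 1%nat))%C
  by (rewrite b0, b1; unfold K; field; easy).
apply (psum_shift (fun n => b (S n))); [easy|]; now apply psum_shift, h1.
Qed.

(** The series found off [c] provides the value [a O] and the derivative [a 1] at [c]. What remains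
    is continuity of the derivative there, obtained from the Cauchy estimate for [f] minus its
    affine part. *)
Theorem riemann f c r M : 0 < r -> hol (pdisc c r) f ->
  (forall z, pdisc c r z -> Cmod (f z) <= M) -> exists v, hol (disc c r) (fill f c v).
Proof.
intros hr hf hM; destruct (removable_taylor f c r M hr hf hM) as [a ha]; destruct hf as [f' hf].
assert (hs : forall z, z <> c -> disc c (r / 2) z ->
  csum (fun n => a (S n) * (z - c) ^ n)%C (/ (z - c) * (f z - a O))%C).
{ intros z h1 h2; now apply psum_shift, ha; [apply Csub_neq0|]. }
destruct (taylor_lip (fun n => a (S n)) _ c (r / 2) ltac:(lra) hs) as [L [d [hL [hd H]]]].
cbv beta in H.
exists (a O), (fill f' c (a 1%nat)); intros z hz; destruct (Ceq_dec z c) as [->|hn]; [split|split].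
- exists (fill (fun z => / (z - c) * (f z - a O))%C c (a 1%nat)); split; [|split].
  + now rewrite !fill_at.
  + apply Ccont_lip with L d; [easy|easy|]; intros z h; rewrite fill_at.
    destruct (Ceq_dec z c) as [->|hn]; [rewrite fill_at, !Cmod_zero_sub; lra|].
    rewrite fill_off by easy; now apply H.
  + intros z; rewrite fill_at; destruct (Ceq_dec z c) as [->|hn]; [rewrite fill_at; ring|].
    rewrite !fill_off by easy; field; now apply Csub_neq0.
- apply Ccont_lip with (16 * L) (d / 2); [lra|lra|]; intros z h; rewrite fill_at.
  destruct (Ceq_dec z c) as [->|hn]; [rewrite fill_at, !Cmod_zero_sub; lra|].
  rewrite fill_off by easy; assert (hp := Cmod_ineq0 _ (Csub_neq0 _ _ hn)); unfold disc in h.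
  (* On the disc of radius |z - c| around [z] the remainder f(w) - a0 - a1 (w - c) is at most L (2
     |z - c|)^2, and the Cauchy estimate turns this into 16 L |z - c|. *)
  replace (16 * L * Cmod (z - c))
    with (4 * (4 * L * (Cmod (z - c) * Cmod (z - c))) / Cmod (z - c)) by (field; lra).
  apply (cauchy_estimate (fun w => f w + (- a O + - a 1%nat * (w - c)))%C
    (fun w => f' w - a 1%nat)%C); [easy| |]; intros w hw;
    destruct (pdisc_disc c (r / 2) z w ltac:(split; [easy|unfold disc; lra]) hw) as [k1 k2].
  + assert (hw' : pdisc c r w) by (split; [easy|unfold disc; lra]); split.
    * apply cder_plus; [now apply hf|].
      apply (cder_eq _ _ (0 + (0 * (w - c) + - a 1%nat * (1 + 0)))); [|ring].
      apply (cder_plus (fun _ => - a O)%C (fun w => - a 1%nat * (w - c))%C); [apply cder_const|].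
      apply (cder_mult (fun _ => - a 1%nat)%C (fun w => w - c)%C); [apply cder_const|].
      apply (cder_plus (fun z => z) (fun _ => - c)%C); [apply cder_id|apply cder_const].
    * apply Ccont_plus; [now apply hf|apply Ccont_const].
  + pose proof (H w k1 ltac:(unfold disc; lra)) as hw2; assert (hn2 := Csub_neq0 _ _ k1).
    replace (f w + (- a O + - a 1%nat * (w - c)))%C
      with ((/ (w - c) * (f w - a O) - a 1%nat) * (w - c))%C by (field; easy).
    rewrite Cmod_mult; assert (p1 := Cmod_ge_0 (w - c)).
    apply Rle_trans with (L * Cmod (w - c) * Cmod (w - c)); [now apply Rmult_le_compat_r|].
    apply Rle_trans with (L * (2 * Cmod (z - c) * (2 * Cmod (z - c)))); [|right; ring].
    rewrite Rmult_assoc; apply Rmult_le_compat_l; [easy|apply Rmult_le_compat; lra].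
- rewrite fill_off by easy; apply cder_ext_loc with f; [now apply fill_off_loc|].
  now apply hf.
- apply Ccont_ext with f'; [now apply fill_off_loc|now apply hf].
Qed.

(** * Uniqueness of derivatives, gluing and reflection *)

Lemma cder_unique f c l l' : cder f c l -> cder f c l' -> l = l'.
Proof.
intros [p [<- [hp ep]]] [q [<- [hq eq]]]; apply NNPP; intros hn.
assert (hpos := Cmod_ineq0 _ (Csub_neq0 _ _ hn)); set (e := Cmod (p c - q c) / 2).
destruct (hp e ltac:(unfold e; lra)) as [d1 [h1 H1]]; destruct (hq e ltac:(unfold e; lra)) as [d2 [h2 H2]].
set (t := Rmin d1 d2 / 2).
assert (ht : 0 < t) by (unfold t; generalize (Rmin_pos _ _ h1 h2); lra).
pose proof (Rmin_l d1 d2); pose proof (Rmin_r d1 d2).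
assert (ez : (c + RtoC t - c)%C = RtoC t) by ring.
assert (mz : Cmod (c + RtoC t - c) = t) by (rewrite ez, Cmod_R, Rabs_pos_eq; lra).
specialize (H1 (c + RtoC t)%C ltac:(rewrite mz; unfold t; lra)).
specialize (H2 (c + RtoC t)%C ltac:(rewrite mz; unfold t; lra)).
assert (k : p (c + RtoC t)%C = q (c + RtoC t)%C).
{ pose proof (ep (c + RtoC t)%C) as e1; rewrite (eq (c + RtoC t)%C), ez in e1.
  assert (tn : RtoC t <> 0%C) by (intros k; apply RtoC_inj in k; lra).
  transitivity (/ RtoC t * (f c + RtoC t * p (c + RtoC t) - f c))%C; [field; easy|].
  rewrite <- e1; field; easy. }
rewrite k in H1; pose proof (Cmod_sub_trans (p c) (q (c + RtoC t)%C) (q c)) as k2.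
rewrite (Cmod_sub_sym (p c) (q (c + RtoC t)%C)) in k2; unfold e in *; lra.
Qed.

(** At each point some derivative is chosen; by uniqueness the choice agrees with the derivative
    given on each disc, from which it inherits continuity. *)
Lemma hol_local (U : C -> Prop) f :
  (forall z, U z -> exists r, 0 < r /\ hol (disc z r) f) -> hol U f.
Proof.
intros h; exists (fun z => epsilon (inhabits (RtoC 0)) (fun l => cder f z l)); intros z hz.
destruct (h z hz) as [r [hr [f' H]]].
assert (e : forall w, disc z r w -> f' w = epsilon (inhabits (RtoC 0)) (fun l => cder f w l)).
{ intros w hw; apply (cder_unique f w); [now apply H|].
  apply epsilon_spec; exists (f' w); now apply H. }
assert (hzz := disc_center z r hr); split.
- rewrite <- e by easy; now apply H.
- apply Ccont_ext with f'; [exists r; auto|now apply H].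
Qed.

Lemma disc_conj c r z : disc (Cconj c) r z <-> disc c r (Cconj z).
Proof.
unfold disc; replace (z - Cconj c)%C with (Cconj (Cconj z - c)); [now rewrite Cmod_conj|].
apply injective_projections; simpl; ring.
Qed.

Lemma Ccont_reflect f c : Ccont f c -> Ccont (fun z => Cconj (f (Cconj z))) (Cconj c).
Proof.
intros h eps he; destruct (h eps he) as [d [hd H]]; exists d; split; [easy|]; intros z hz.
rewrite Cconj_conj; replace (Cconj (f (Cconj z)) - Cconj (f c))%C with (Cconj (f (Cconj z) - f c))
  by (apply injective_projections; simpl; ring).
rewrite Cmod_conj; apply H; now apply disc_conj.
Qed.

(** Schwarz reflection: it carries the local extension at [c] over to [Cconj c]. *)
Lemma hol_reflect f c r : hol (disc c r) f -> hol (disc (Cconj c) r) (fun z => Cconj (f (Cconj z))).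
Proof.
intros [f' H]; exists (fun z => Cconj (f' (Cconj z))); intros z hz; apply disc_conj in hz.
destruct (H _ hz) as [[q [h1 [h2 h3]]] h4].
rewrite <- (Cconj_conj z); split; [|now apply Ccont_reflect].
exists (fun z => Cconj (q (Cconj z))); split; [now rewrite !Cconj_conj, h1|split].
- now apply Ccont_reflect.
- intros w; rewrite !Cconj_conj, (h3 (Cconj w)); apply injective_projections; simpl; ring.
Qed.

(** * [C^1] pairs satisfying the Cauchy-Riemann equations *)

Lemma locally_C_disc (z : C) (P : C -> Prop) :
  locally z P <-> exists r, 0 < r /\ forall w, disc z r w -> P w.
Proof.
split.
- intros [e He]; exists e; split; [apply cond_pos|]; intros w hw; apply He.
  split; (eapply Rle_lt_trans; [|exact hw]).
  + apply (abs_fst_le_Cmod (w - z)).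
  + apply (abs_snd_le_Cmod (w - z)).
- intros [r [hr H]]; exists (mkposreal (r / 2) ltac:(lra)); intros w [h1 h2]; apply H.
  eapply Rle_lt_trans; [apply Cmod_le_sum|].
  unfold ball in h1, h2; simpl in h1, h2; unfold AbsRing_ball, abs, minus, plus, opp in h1, h2.
  simpl in h1, h2; simpl; lra.
Qed.

Lemma continuous_C_eps (u : C -> R) (z : C) : continuous u z <->
  forall eps, 0 < eps -> exists d, 0 < d /\ forall w, disc z d w -> Rabs (u w - u z) < eps.
Proof.
split.
- intros h eps he.
  apply locally_C_disc; exact (proj1 (filterlim_locally u (u z)) h (mkposreal eps he)).
- intros H; apply filterlim_locally; intros eps; apply locally_C_disc.
  exact (H eps (cond_pos eps)).
Qed.

Lemma Ccont_components (p q : C -> R) z : Ccont (fun w => (p w, q w)) z <-> continuous p z /\ continuous q z.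
Proof.
rewrite !continuous_C_eps; split.
- intros h; split; intros eps he; destruct (h eps he) as [d [hd H]]; exists d; split; auto; intros w hw;
    eapply Rle_lt_trans; [|exact (H w hw)| |exact (H w hw)].
  + apply (abs_fst_le_Cmod ((p w, q w) - (p z, q z))).
  + apply (abs_snd_le_Cmod ((p w, q w) - (p z, q z))).
- intros [h1 h2] eps he.
  destruct (h1 (eps / 2) ltac:(lra)) as [d1 [k1 H1]]; destruct (h2 (eps / 2) ltac:(lra)) as [d2 [k2 H2]].
  exists (Rmin d1 d2); split; [now apply Rmin_pos|]; intros w hw.
  eapply Rle_lt_trans; [apply Cmod_le_sum|].
  pose proof (H1 w (Rlt_le_trans _ _ _ hw (Rmin_l _ _))).
  pose proof (H2 w (Rlt_le_trans _ _ _ hw (Rmin_r _ _))).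
  simpl; unfold Rminus in *; lra.
Qed.

Lemma cder_of_little_o f z l :
  (forall eps, 0 < eps -> exists d, 0 < d /\ forall w, disc z d w ->
    Cmod (f w - f z - l * (w - z)) <= eps * Cmod (w - z)) -> cder f z l.
Proof.
intros h; exists (fill (fun w => / (w - z) * (f w - f z))%C z l); split; [apply fill_at|]; split.
- intros eps he; destruct (h (eps / 2) ltac:(lra)) as [d [hd H]]; exists d; split; [easy|].
  intros w hw; rewrite fill_at; destruct (Ceq_dec w z) as [->|n]; [rewrite fill_at, Cmod_zero_sub; lra|].
  rewrite fill_off by easy; assert (hn := Csub_neq0 _ _ n); assert (hp := Cmod_ineq0 _ hn).
  apply Rmult_lt_reg_r with (Cmod (w - z)); [easy|]; rewrite <- Cmod_mult.
  replace ((/ (w - z) * (f w - f z) - l) * (w - z))%C with (f w - f z - l * (w - z))%C by (field; easy).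
  eapply Rle_lt_trans; [now apply H|]; nra.
- intros w; destruct (Ceq_dec w z) as [->|n]; [ring|].
  rewrite fill_off by easy; field; now apply Csub_neq0.
Qed.

(** One partial derivative that exists nearby and is continuous at the point, together with the
    other one at the point, gives differentiability; this is [is_derive_filterdiff]. *)
Lemma partials_little_o (D : C -> Prop) (p pa pb : C -> R) z : open D -> D z ->
  (forall w, D w -> is_derive (fun t => p (t, snd w)) (fst w) (pa w)) ->
  is_derive (fun t => p (fst z, t)) (snd z) (pb z) -> continuous pa z ->
  forall eps, 0 < eps -> exists d, 0 < d /\ forall w, disc z d w ->
    Rabs (p w - p z - (pa z * (fst w - fst z) + pb z * (snd w - snd z))) <= eps * Cmod (w - z).
Proof.
intros hD hz h1 h2 h3 eps he.
pose proof (is_derive_filterdiff (fun u v => p (u, v)) (fst z) (snd z) (fun u v => pa (u, v)) (pb z)) as h.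
destruct z as [a b]; simpl in *.
assert (hh : filterdiff (fun u : R * R => p (fst u, snd u)) (locally (a, b))
    (fun u : R * R => plus (scal (fst u) (pa (a, b))) (scal (snd u) (pb (a, b))))).
{ apply h; [|exact h2|].
  - assert (l := hD _ hz); apply filter_imp with (2 := l); intros [u v] hw; exact (h1 _ hw).
  - apply continuous_ext with (2 := h3); now intros []. }
apply (filterdiff_differentiable_pt_lim (fun u v => p (u, v)) a b (pa (a, b)) (pb (a, b))) in hh.
destruct (hh (mkposreal eps he)) as [d Hd]; exists d; split; [apply cond_pos|]; intros [u v] hw.
specialize (Hd u v).
assert (a1 := abs_fst_le_Cmod ((u, v) - (a, b))); assert (a2 := abs_snd_le_Cmod ((u, v) - (a, b))).
simpl in a1, a2, Hd; unfold disc in hw.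
eapply Rle_trans; [apply Hd; unfold Rminus; lra|].
apply Rmult_le_compat_l; [lra|]; apply Rmax_lub; unfold Rminus; lra.
Qed.

Lemma hol_of_CR (D : C -> Prop) (p q pa pb qa qb : C -> R) : open D ->
  (forall z, D z -> is_derive (fun t => p (t, snd z)) (fst z) (pa z) /\
    is_derive (fun t => p (fst z, t)) (snd z) (pb z) /\ continuous pa z) ->
  (forall z, D z -> is_derive (fun t => q (t, snd z)) (fst z) (qa z) /\
    is_derive (fun t => q (fst z, t)) (snd z) (qb z) /\ continuous qa z) ->
  (forall z, D z -> pa z = qb z /\ pb z = - qa z) ->
  hol D (fun z => (p z, q z)).
Proof.
intros hD hp hq hCR; exists (fun z => (pa z, qa z)); intros z hz; split.
2:{ apply Ccont_components; split; [now apply hp|now apply hq]. }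
apply cder_of_little_o; intros eps he.
destruct (hp z hz) as [p1 [p2 p3]], (hq z hz) as [q1 [q2 q3]], (hCR z hz) as [c1 c2].
destruct (partials_little_o D p pa pb z hD hz (fun w hw => proj1 (hp w hw)) p2 p3 (eps / 2) ltac:(lra))
  as [d1 [k1 H1]].
destruct (partials_little_o D q qa qb z hD hz (fun w hw => proj1 (hq w hw)) q2 q3 (eps / 2) ltac:(lra))
  as [d2 [k2 H2]].
exists (Rmin d1 d2); split; [now apply Rmin_pos|]; intros w hw.
eapply Rle_trans; [apply Cmod_le_sum|].
pose proof (H1 w (Rlt_le_trans _ _ _ hw (Rmin_l _ _))) as m1.
pose proof (H2 w (Rlt_le_trans _ _ _ hw (Rmin_r _ _))) as m2.
rewrite c2 in m1; rewrite <- c1 in m2.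
replace (eps * Cmod (w - z)) with (eps / 2 * Cmod (w - z) + eps / 2 * Cmod (w - z)) by field.
apply Rplus_le_compat.
- eapply Rle_trans; [|exact m1]; right; f_equal; simpl; ring.
- eapply Rle_trans; [|exact m2]; right; f_equal; simpl; ring.
Qed.

Lemma cder_partials f z l : cder f z l ->
  rder (fun t => f (t, snd z)) (fst z) l /\ rder (fun t => f (fst z, t)) (snd z) (Ci * l)%C.
Proof.
intros h; split.
- apply rder_eq with (1 * l)%C; [|ring]; apply (rder_comp f); [|now destruct z].
  split; simpl; [apply (is_derive_id (K := R_AbsRing))|apply (is_derive_const (V := R_NormedModule))].
- apply (rder_comp f); [|now destruct z].
  split; simpl; [apply (is_derive_const (V := R_NormedModule))|apply (is_derive_id (K := R_AbsRing))].
Qed.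

(** * Real coordinates on [CD d] *)

(** The index set repeats the doubling as a sum type, so that statements on coordinates go by
    induction on [d] without arithmetic on indices. *)
Fixpoint Ix (d : nat) : Type :=
  match d with O => unit | S d' => (Ix d' + Ix d')%type end.

Fixpoint crd d : Ix d -> CD d -> R :=
  match d return Ix d -> CD d -> R with
  | O => fun _ x => x
  | S d' => fun i x => match i with inl j => crd d' j (fst x) | inr j => crd d' j (snd x) end
  end.
Arguments crd {d} i x.

Fixpoint mkc d : (Ix d -> R) -> CD d :=
  match d return (Ix d -> R) -> CD d with
  | O => fun c => c tt
  | S d' => fun c => (mkc d' (fun j => c (inl j)), mkc d' (fun j => c (inr j)))
  end.
Arguments mkc {d} c.

Lemma crd_mkc d (c : Ix d -> R) i : crd i (mkc c) = c i.
Proof.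
induction d as [|d IH]; [now destruct i|].
destruct i as [j|j]; simpl; [exact (IH (fun j => c (inl j)) j)|exact (IH (fun j => c (inr j)) j)].
Qed.

Lemma crd_ext d (x y : CD d) : (forall i, crd i x = crd i y) -> x = y.
Proof.
induction d as [|d IH]; intros h; [exact (h tt)|].
apply injective_projections; apply IH; intros j; [exact (h (inl j))|exact (h (inr j))].
Qed.

Lemma crd_plus d (i : Ix d) (x y : CD d) : crd i (x + y)%cd = crd i x + crd i y.
Proof. induction d as [|d IH]; [easy|]; destruct i; apply IH. Qed.

Lemma crd_opp d (i : Ix d) (x : CD d) : crd i (- x)%cd = - crd i x.
Proof. induction d as [|d IH]; [easy|]; destruct i; apply IH. Qed.

Lemma crd_minus d (i : Ix d) (x y : CD d) : crd i (x - y)%cd = crd i x - crd i y.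
Proof. unfold minus; rewrite crd_plus, crd_opp; reflexivity. Qed.

Lemma crd_scal d (i : Ix d) r (x : CD d) : crd i (scal r x) = r * crd i x.
Proof. induction d as [|d IH]; [easy|]; destruct i; apply IH. Qed.

Lemma crd_zero d (i : Ix d) : crd i (zero : CD d) = 0.
Proof. induction d as [|d IH]; [easy|]; destruct i; apply IH. Qed.

Ltac crd_simpl :=
  repeat (rewrite crd_plus || rewrite crd_minus || rewrite crd_opp || rewrite crd_scal
          || rewrite crd_zero).
Ltac vec := apply crd_ext; let i := fresh "i" in intros i; crd_simpl; cbn [fst snd]; crd_simpl; (ring || field).

(** The squared norm as a polynomial in the coordinates, within reach of [ring]. *)
Fixpoint nsq d : CD d -> R :=
  match d return CD d -> R with
  | O => fun x => x * x
  | S d' => fun x => nsq d' (fst x) + nsq d' (snd x)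
  end.
Arguments nsq {d} x.

Lemma nsq_ge0 d (x : CD d) : 0 <= nsq x.
Proof.
induction d as [|d IH]; simpl; [apply Rle_0_sqr|].
generalize (IH (fst x)) (IH (snd x)); lra.
Qed.

Lemma norm_nsq d (x : CD d) : norm x = sqrt (nsq x).
Proof.
induction d as [|d IH]; simpl.
- symmetry; exact (sqrt_Rsqr_abs x).
- destruct x as [a b]; change (norm (a, b)) with (sqrt (norm a ^ 2 + norm b ^ 2)).
  rewrite !IH, !pow2_sqrt by apply nsq_ge0; reflexivity.
Qed.

Lemma nsq_norm d (x : CD d) : nsq x = norm x ^ 2.
Proof. now rewrite norm_nsq, pow2_sqrt by apply nsq_ge0. Qed.

Lemma abs_crd_le_norm d (i : Ix d) (x : CD d) : Rabs (crd i x) <= norm x.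
Proof.
rewrite norm_nsq; apply Rsqr_incr_0_var; [|apply sqrt_pos].
rewrite Rsqr_sqrt by apply nsq_ge0; unfold Rsqr; rewrite <- Rabs_mult, Rabs_pos_eq by apply Rle_0_sqr.
induction d as [|d IH]; simpl; [lra|].
destruct i as [j|j]; [generalize (IH j (fst x)) (nsq_ge0 d (snd x))
  |generalize (IH j (snd x)) (nsq_ge0 d (fst x))]; lra.
Qed.

Lemma norm_le_crd d (x : CD d) M : (forall i, Rabs (crd i x) <= M) -> norm x <= 2 ^ d * M.
Proof.
induction d as [|d IH]; intros h.
- rewrite Rmult_1_l; exact (h tt).
- destruct x as [a b]; change (norm (a, b)) with (sqrt (norm a ^ 2 + norm b ^ 2)).
  pose proof (IH a (fun i => h (inl i))) as ha; pose proof (IH b (fun i => h (inr i))) as hb.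
  pose proof (norm_ge_0 a) as pa; pose proof (norm_ge_0 b) as pb.
  apply Rle_trans with (norm a + norm b); [|simpl; lra].
  apply Rsqr_incr_0_var; [|lra]; rewrite Rsqr_sqrt by nra; unfold Rsqr; nra.
Qed.

(** * Algebra of [CD d] *)

Lemma cd_conj_plus d (x y : CD d) : cd_conj (x + y)%cd = (cd_conj x + cd_conj y)%cd.
Proof.
induction d as [|d IH]; [reflexivity|].
destruct x as [a b], y as [a' b']; apply (f_equal2 pair); [apply IH|].
change (opp (b + b') = opp b + opp b')%cd; vec.
Qed.

Lemma cd_conj_scal d r (x : CD d) : cd_conj (scal r x) = scal r (cd_conj x).
Proof.
induction d as [|d IH]; [reflexivity|].
destruct x as [a b]; apply (f_equal2 pair); [apply IH|].
change (opp (scal r b) = scal r (opp b)); vec.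
Qed.

Lemma cd_mul_plus d (x y z : CD d) :
  (x * (y + z) = x * y + x * z)%cd /\ ((y + z) * x = y * x + z * x)%cd.
Proof.
induction d as [|d IH]; [split; [apply Rmult_plus_distr_l|apply Rmult_plus_distr_r]|].
destruct x as [a b], y as [a' b'], z as [a'' b''].
change (plus (a', b') (a'', b'')) with (plus a' a'', plus b' b'').
rewrite !cd_mul_pair, !cd_conj_plus, !(proj1 (IH _ _ _)), !(proj2 (IH _ _ _)).
split; apply (f_equal2 pair); match goal with |- ?u = ?v => change (u = v :> CD d) end; vec.
Qed.

Lemma cd_mul_scal d r (x y : CD d) :
  (x * scal r y = scal r (x * y))%cd /\ (scal r x * y = scal r (x * y))%cd.
Proof.
induction d as [|d IH].
{ split; apply crd_ext; intros i; simpl; unfold scal; simpl; unfold mult; simpl; ring. }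
destruct x as [a b], y as [a' b'].
change (scal r (a', b')) with (scal r a', scal r b').
change (scal r (a, b)) with (scal r a, scal r b).
rewrite !cd_mul_pair, !cd_conj_scal, !(proj1 (IH _ _)), !(proj2 (IH _ _)).
split; apply (f_equal2 pair); match goal with |- ?u = ?v => change (u = v :> CD d) end; vec.
Qed.

Lemma cd_mul_plus_r d (x y z : CD d) : (x * (y + z) = x * y + x * z)%cd.
Proof. apply cd_mul_plus. Qed.
Lemma cd_mul_plus_l d (x y z : CD d) : ((y + z) * x = y * x + z * x)%cd.
Proof. apply cd_mul_plus. Qed.
Lemma cd_mul_scal_r d r (x y : CD d) : (x * scal r y = scal r (x * y))%cd.
Proof. apply cd_mul_scal. Qed.
Lemma cd_mul_scal_l d r (x y : CD d) : (scal r x * y = scal r (x * y))%cd.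
Proof. apply cd_mul_scal. Qed.

Lemma cd_opp_scal d (x : CD d) : opp x = scal (-1) x.
Proof. vec. Qed.
Lemma cd_minus_scal d (x y : CD d) : (x - y = x + scal (-1) y)%cd.
Proof. vec. Qed.

Lemma cd_mul_minus_r d (x y z : CD d) : (x * (y - z) = x * y - x * z)%cd.
Proof. rewrite !cd_minus_scal, cd_mul_plus_r, cd_mul_scal_r; reflexivity. Qed.
Lemma cd_mul_minus_l d (x y z : CD d) : ((y - z) * x = y * x - z * x)%cd.
Proof. rewrite !cd_minus_scal, cd_mul_plus_l, cd_mul_scal_l; reflexivity. Qed.
Lemma cd_mul_opp_r d (x y : CD d) : (x * - y = - (x * y))%cd.
Proof. rewrite !cd_opp_scal, cd_mul_scal_r; reflexivity. Qed.
Lemma cd_mul_opp_l d (x y : CD d) : (- x * y = - (x * y))%cd.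
Proof. rewrite !cd_opp_scal, cd_mul_scal_l; reflexivity. Qed.
Lemma cd_mul_1_l d (x : CD d) : (cd_one * x = x)%cd.
Proof. apply cd_mul_1. Qed.
Lemma cd_mul_1_r d (x : CD d) : (x * cd_one = x)%cd.
Proof. apply cd_mul_1. Qed.
Lemma cd_mul_0_r d (x : CD d) : (x * zero = zero)%cd.
Proof. apply cd_mul_0. Qed.

(* For [d <= 3] polynomial identities are checked in the real coordinates. *)
Ltac cd_brute d hd :=
  destruct d as [|[|[|[|d]]]]; [..|exfalso; clear - hd; lia];
  simpl in *; repeat match goal with x : (_ * _)%type |- _ => destruct x end;
  simpl; repeat apply (f_equal2 pair);
  repeat progress (unfold minus, plus, opp, scal, mult, zero, one; simpl).

(** The substitute for associativity: it makes left multiplication by an imaginary unit a complex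
    structure. *)
Lemma cd_alt d (x y : CD d) : (d <= 3)%nat -> (x * (x * y) = (x * x) * y)%cd.
Proof. intros hd; cd_brute d hd; ring. Qed.

Lemma nsq_mul d (x y : CD d) : (d <= 3)%nat -> nsq (x * y)%cd = nsq x * nsq y.
Proof. intros hd; cd_brute d hd; ring. Qed.

Lemma cd_sq d (x : CD d) : (d <= 3)%nat ->
  (x * x = scal (2 * cd_re x)%R x - scal (nsq x) cd_one)%cd.
Proof. intros hd; cd_brute d hd; ring. Qed.

Lemma cd_n_nsq d (x : CD d) : (d <= 3)%nat -> cd_n x = cd_real (nsq x).
Proof. intros hd; unfold cd_n, cd_real; cd_brute d hd; ring. Qed.

Lemma cd_re_slice d a b (J : CD d) : cd_re (slice_pt a b J) = a + b * cd_re J.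
Proof.
unfold slice_pt, cd_real; induction d as [|d IH]; [|destruct J as [J K]; apply (IH J)].
unfold scal, plus; simpl; unfold mult; simpl; ring.
Qed.

Lemma nsq_slice d a b (J : CD d) : (d <= 3)%nat ->
  nsq (slice_pt a b J) = a ^ 2 + 2 * a * b * cd_re J + b ^ 2 * nsq J.
Proof. intros hd; unfold slice_pt, cd_real; cd_brute d hd; ring. Qed.

(** * Limits, series, derivatives and integrals in coordinates *)

Lemma filterlim_crd T d (F : (T -> Prop) -> Prop) {FF : Filter F} (f : T -> CD d) (l : CD d) :
  filterlim f F (locally l) <->
  forall i, filterlim (fun t => crd i (f t)) F (locally (crd i l)).
Proof.
induction d as [|d IH].
- split; [intros h i; exact h|intros h; exact (h tt)].
- assert (pr : filterlim f F (locally l) <->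
    filterlim (fun t => fst (f t)) F (locally (fst l)) /\
    filterlim (fun t => snd (f t)) F (locally (snd l))).
  { split.
    - intros h; pose proof (proj1 (filterlim_locally f l) h) as h'; split;
        apply filterlim_locally; intros eps; apply filter_imp with (2 := h' eps); now intros t [].
    - intros [h1 h2]; apply filterlim_locally; intros eps.
      pose proof (proj1 (filterlim_locally _ _) h1 eps) as k1.
      pose proof (proj1 (filterlim_locally _ _) h2 eps) as k2.
      apply filter_imp with (2 := filter_and _ _ k1 k2); intros t [t1 t2]; now split. }
  rewrite pr, (IH (fun t => fst (f t)) (fst l)), (IH (fun t => snd (f t)) (snd l)); split.
  + intros [h1 h2] [i|i]; [exact (h1 i)|exact (h2 i)].
  + intros h; split; intros i; [exact (h (inl i))|exact (h (inr i))].
Qed.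

Lemma crd_sum_n d (i : Ix d) (b : nat -> CD d) n : crd i (sum_n b n) = sum_n (fun n => crd i (b n)) n.
Proof.
induction n as [|n IH]; [now rewrite !sum_O|].
rewrite !sum_Sn, <- IH; exact (crd_plus d i (sum_n b n) (b (S n))).
Qed.

Lemma is_series_crd d (b : nat -> CD d) l :
  is_series b l <-> forall i, is_series (fun n => crd i (b n)) (crd i l).
Proof.
unfold is_series; rewrite (filterlim_crd nat d eventually (sum_n b) l); split; intros h i.
- apply filterlim_ext with (2 := h i); intros n; apply crd_sum_n.
- apply filterlim_ext with (2 := h i); intros n; symmetry; apply crd_sum_n.
Qed.

Lemma continuous_crd (T : UniformSpace) d (f : T -> CD d) x :
  continuous f x <-> forall i, continuous (fun t => crd i (f t)) x.
Proof. apply filterlim_crd; apply locally_filter. Qed.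

Lemma is_RInt_crd d (f : R -> CD d) a b l :
  (forall i, is_RInt (fun t => crd i (f t)) a b (crd i l)) -> is_RInt f a b l.
Proof.
induction d as [|d IH]; intros h; [exact (h tt)|].
destruct l as [l1 l2]; apply is_RInt_fct_extend_pair.
- apply (IH (fun t => fst (f t))); intros i; exact (h (inl i)).
- apply (IH (fun t => snd (f t))); intros i; exact (h (inr i)).
Qed.

Lemma is_derive_pair (U V : NormedModule R_AbsRing) (f : R -> prod_NormedModule R_AbsRing U V) t
    (l : prod_NormedModule R_AbsRing U V) :
  is_derive f t l <-> is_derive (fun s => fst (f s)) t (fst l) /\ is_derive (fun s => snd (f s)) t (snd l).
Proof.
split.
- intros h; split.
  + refine (filterdiff_comp' (V := prod_NormedModule R_AbsRing U V) (W := U) f fst t _ fst h _).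
    apply filterdiff_linear, is_linear_fst.
  + refine (filterdiff_comp' (V := prod_NormedModule R_AbsRing U V) (W := V) f snd t _ snd h _).
    apply filterdiff_linear, is_linear_snd.
- intros [h1 h2].
  pose proof (filterdiff_comp'_2 (K := R_AbsRing) (W := prod_NormedModule R_AbsRing U V)
    (fun s => fst (f s)) (fun s => snd (f s)) (fun u v => (u, v)) t _ _ (fun u v => (u, v)) h1 h2) as h.
  apply filterdiff_ext_lin with (fun y => (scal y (fst l), scal y (snd l))); [|now intros].
  apply filterdiff_ext with (fun s => (fst (f s), snd (f s))); [intros s; now destruct (f s)|].
  apply h; apply filterdiff_linear, is_linear_prod; [apply is_linear_fst|apply is_linear_snd].
Qed.

Lemma is_derive_crd d (f : R -> CD d) t (l : CD d) :
  is_derive f t l <-> forall i, is_derive (fun s => crd i (f s)) t (crd i l).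
Proof.
induction d as [|d IH].
- split; [intros h i; exact h|intros h; exact (h tt)].
- pose proof (is_derive_pair (CD d) (CD d) f t l) as pr.
  split.
  + intros h; apply pr in h; destruct h as [h1 h2]; intros [i|i].
    * exact (proj1 (IH (fun t => fst (f t)) (fst l)) h1 i).
    * exact (proj1 (IH (fun t => snd (f t)) (snd l)) h2 i).
  + intros h; apply pr; split; [apply (IH (fun t => fst (f t)))|apply (IH (fun t => snd (f t)))];
      intros i; [exact (h (inl i))|exact (h (inr i))].
Qed.

(* Applied to series, integrals, derivatives and limits: each is compatible with linear maps. *)
Lemma linear_closed T (Q : (T -> R) -> R -> Prop) d (L : CD d -> R) :
  (forall f g l m, Q f l -> Q g m -> Q (fun t => f t + g t) (l + m)) ->
  (forall k f l, Q f l -> Q (fun t => k * f t) (k * l)) ->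
  (forall f g l, (forall t, f t = g t) -> Q f l -> Q g l) ->
  (forall x y, L (x + y)%cd = L x + L y) -> (forall r x, L (scal r x) = r * L x) ->
  forall (f : T -> CD d) l, (forall i, Q (fun t => crd i (f t)) (crd i l)) -> Q (fun t => L (f t)) (L l).
Proof.
intros qp qs qe; induction d as [|d IH]; intros Lp Ls f l h.
- assert (e : forall x : CD 0, L x = L (1 : CD 0) * x).
  { intros x; rewrite Rmult_comm, <- Ls; f_equal; symmetry; exact (Rmult_1_r x). }
  rewrite (e l); apply qe with (fun t => L (1 : CD 0) * f t); [intros; now rewrite <- e|].
  apply qs, (h tt).
- assert (e : forall x : CD (S d), L x = L (fst x, zero) + L (zero, snd x)).
  { intros x; rewrite <- Lp; f_equal; destruct x as [a b]; apply crd_ext; intros i.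
    rewrite crd_plus; destruct i; simpl; rewrite crd_zero; ring. }
  rewrite (e l); apply qe with (fun t => L (fst (f t), zero) + L (zero, snd (f t))).
  { intros; now rewrite <- e. }
  assert (zp : (zero : CD d) = (zero + zero)%cd) by vec.
  assert (zs : forall r, (zero : CD d) = scal r zero) by (intros; vec).
  apply qp.
  + apply (IH (fun x => L (x, zero))) with (f := fun t => fst (f t)) (l := fst l).
    * intros x y; rewrite <- Lp; f_equal; apply (f_equal2 pair); [reflexivity|exact zp].
    * intros r x; rewrite <- Ls; f_equal; apply (f_equal2 pair); [reflexivity|exact (zs r)].
    * intros i; exact (h (inl i)).
  + apply (IH (fun x => L (zero, x))) with (f := fun t => snd (f t)) (l := snd l).
    * intros x y; rewrite <- Lp; f_equal; apply (f_equal2 pair); [exact zp|reflexivity].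
    * intros r x; rewrite <- Ls; f_equal; apply (f_equal2 pair); [exact (zs r)|reflexivity].
    * intros i; exact (h (inr i)).
Qed.

Lemma is_series_mul d (J : CD d) (b : nat -> CD d) l :
  is_series b l -> is_series (fun n => J * b n)%cd (J * l)%cd.
Proof.
rewrite !is_series_crd; intros h i.
apply (linear_closed nat (fun f l => is_series f l) d (fun x => crd i (J * x)%cd)); auto.
- intros f g u v; exact (is_series_plus (V := R_NormedModule) f g u v).
- intros k f u; exact (is_series_scal (V := R_NormedModule) k f u).
- intros f g u; exact (is_series_ext (V := R_NormedModule) f g u).
- intros; now rewrite cd_mul_plus_r, crd_plus.
- intros; now rewrite cd_mul_scal_r, crd_scal.
Qed.

Lemma is_RInt_mul d (J : CD d) (f : R -> CD d) a b l :
  (forall i, is_RInt (fun t => crd i (f t)) a b (crd i l)) ->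
  is_RInt (fun t => J * f t)%cd a b (J * l)%cd.
Proof.
intros h; apply is_RInt_crd; intros i.
apply (linear_closed R (fun f l => is_RInt f a b l) d (fun x => crd i (J * x)%cd)); auto.
- intros u v l1 l2; exact (is_RInt_plus (V := R_NormedModule) u v a b l1 l2).
- intros k u l1; exact (is_RInt_scal (V := R_NormedModule) u a b k l1).
- intros u v l1 e; apply is_RInt_ext; intros; apply e.
- intros; now rewrite cd_mul_plus_r, crd_plus.
- intros; now rewrite cd_mul_scal_r, crd_scal.
Qed.

(** * Slices *)

Definition sl d (J : CD d) (c : C) : CD d := slice_pt (fst c) (snd c) J.
Arguments sl {d} J c.

(* The value at [a + J b] of the slice function whose stem at [a + i b] is [h]. *)
Definition ev d (J : CD d) (h : Ix d -> C) : CD d :=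
  (mkc (fun i => fst (h i)) + J * mkc (fun i => snd (h i)))%cd.
Arguments ev {d} J h.

Lemma crd_mk_ext d (x : CD d) : mkc (fun i => crd i x) = x.
Proof. apply crd_ext; intros; apply crd_mkc. Qed.

Lemma nsq_scal d r (x : CD d) : nsq (scal r x) = r ^ 2 * nsq x.
Proof.
induction d as [|d IH]; [unfold scal; simpl; unfold mult; simpl; ring|].
change (nsq (scal r (fst x)) + nsq (scal r (snd x)) = r ^ 2 * (nsq (fst x) + nsq (snd x))).
rewrite !IH; ring.
Qed.

Lemma nsq_one d : nsq (cd_one : CD d) = 1.
Proof.
induction d as [|d IH]; [simpl; ring|].
change (nsq (cd_one : CD d) + nsq (zero : CD d) = 1); rewrite IH.
replace (nsq (zero : CD d)) with 0; [ring|].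
replace (zero : CD d) with (scal 0 (zero : CD d)) by vec; rewrite nsq_scal; ring.
Qed.

Lemma nsq_zero_iff d (x : CD d) : nsq x = 0 -> x = zero.
Proof.
intros h; apply crd_ext; intros i; rewrite crd_zero.
generalize (abs_crd_le_norm d i x); rewrite norm_nsq, h, sqrt_0; intros k.
destruct (Req_dec (crd i x) 0) as [e|e]; [easy|]; apply Rabs_pos_lt in e; lra.
Qed.

Lemma cd_re_plus d (x y : CD d) : cd_re (x + y)%cd = cd_re x + cd_re y.
Proof. induction d as [|d IH]; [reflexivity|apply (IH (fst x) (fst y))]. Qed.

Lemma cd_re_scal d r (x : CD d) : cd_re (scal r x) = r * cd_re x.
Proof. induction d as [|d IH]; [reflexivity|apply (IH (fst x))]. Qed.

Lemma cd_re_one d : cd_re (cd_one : CD d) = 1.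
Proof. induction d as [|d IH]; [reflexivity|apply IH]. Qed.

(** By the quadratic equation [cd_sq], J^2 = -1 means 2 Re(J) J = (|J|^2 - 1) 1. Comparing real
    parts and squared norms leaves Re(J)^2 (|J|^2 - Re(J)^2) = 0, and the second factor cannot
    vanish. *)
Lemma imag_unit_iff d (J : CD d) : (d <= 3)%nat -> imag_unit J <-> cd_re J = 0 /\ nsq J = 1.
Proof.
intros hd; unfold imag_unit; rewrite cd_sq by easy; split.
- intros h.
  assert (e : scal (2 * cd_re J)%R J = scal (nsq J - 1)%R cd_one).
  { apply crd_ext; intros i; apply (f_equal (crd i)) in h; revert h; crd_simpl; intros h; lra. }
  assert (e1 := f_equal (@cd_re d) e); assert (e2 := f_equal nsq e).
  rewrite !cd_re_scal, cd_re_one in e1; rewrite !nsq_scal, nsq_one in e2.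
  assert (e3 : cd_re J * cd_re J * (nsq J - cd_re J * cd_re J) = 0) by nra.
  apply Rmult_integral in e3; destruct e3 as [e3|e3].
  + apply Rmult_integral in e3; destruct e3; split; nra.
  + exfalso; nra.
- intros [h1 h2]; rewrite h1, h2; vec.
Qed.

Lemma imag_unit_opp d (J : CD d) : imag_unit J -> imag_unit (opp J).
Proof.
unfold imag_unit; intros h; rewrite cd_mul_opp_l, cd_mul_opp_r, h; vec.
Qed.

Lemma unit_mulK d (J x : CD d) : (d <= 3)%nat -> imag_unit J -> (J * (J * x) = - x)%cd.
Proof.
intros hd hJ; rewrite cd_alt, hJ, cd_mul_opp_l, cd_mul_1_l by easy; reflexivity.
Qed.

Lemma sl_mulE d (J x : CD d) c : (sl J c * x = scal (fst c) x + scal (snd c) (J * x))%cd.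
Proof.
unfold sl, slice_pt, cd_real; now rewrite cd_mul_plus_l, !cd_mul_scal_l, cd_mul_1_l.
Qed.

(** Two left factors from one slice associate with an arbitrary [x], although octonions do not
    associate in general. *)
Lemma sl_mulA d (J x : CD d) a b : (d <= 3)%nat -> imag_unit J ->
  (sl J a * (sl J b * x) = sl J (a * b)%C * x)%cd.
Proof.
intros hd hJ; rewrite !sl_mulE, cd_mul_plus_r, !cd_mul_scal_r, (unit_mulK d J x hd hJ).
unfold Cmult; simpl; vec.
Qed.

Lemma sl_mul d (J : CD d) a b : (d <= 3)%nat -> imag_unit J ->
  (sl J a * sl J b = sl J (a * b)%C)%cd.
Proof.
intros hd hJ; rewrite <- (cd_mul_1_r d (sl J b)), sl_mulA by easy; apply cd_mul_1_r.
Qed.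

Lemma sl_plus d (J : CD d) a b : (sl J a + sl J b = sl J (a + b)%C)%cd.
Proof. unfold sl, slice_pt, cd_real, Cplus; simpl; vec. Qed.

Lemma sl_minus d (J : CD d) a b : (sl J a - sl J b = sl J (a - b)%C)%cd.
Proof. unfold sl, slice_pt, cd_real, Cminus, Cplus, Copp; simpl; vec. Qed.

Lemma sl_scal d (J : CD d) r c : scal r (sl J c) = sl J (RtoC r * c)%C.
Proof. unfold sl, slice_pt, cd_real, RtoC, Cmult; simpl; vec. Qed.

Lemma sl_opp d (J : CD d) c : sl (opp J) c = sl J (Cconj c).
Proof. unfold sl, slice_pt, cd_real, Cconj; simpl; vec. Qed.

Lemma sl_real d (J : CD d) r : sl J (RtoC r) = cd_real r.
Proof. unfold sl, slice_pt, cd_real, RtoC; simpl; vec. Qed.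

Lemma sl_one d (J : CD d) : sl J 1%C = cd_one.
Proof. rewrite sl_real; unfold cd_real; vec. Qed.

Lemma norm_sl d (J : CD d) c : (d <= 3)%nat -> imag_unit J -> norm (sl J c) = Cmod c.
Proof.
intros hd hJ; apply imag_unit_iff in hJ as [h1 h2]; [|easy].
rewrite norm_nsq; unfold sl; rewrite nsq_slice, h1, h2 by easy; unfold Cmod; f_equal; ring.
Qed.

Lemma cd_norm_mul d (x y : CD d) : (d <= 3)%nat -> norm (x * y)%cd = norm x * norm y.
Proof.
intros hd; rewrite !norm_nsq, nsq_mul by easy; apply sqrt_mult; apply nsq_ge0.
Qed.

Lemma norm_sl_mul d (J x : CD d) c : (d <= 3)%nat -> imag_unit J ->
  norm (sl J c * x)%cd = Cmod c * norm x.
Proof. intros hd hJ; now rewrite cd_norm_mul, norm_sl by easy. Qed.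

Lemma cd_re_sl d (J : CD d) c : (d <= 3)%nat -> imag_unit J -> cd_re (sl J c) = fst c.
Proof.
intros hd hJ; apply imag_unit_iff in hJ as [h1 h2]; [|easy].
unfold sl; rewrite cd_re_slice, h1; ring.
Qed.

Lemma cd_im_sl d (J : CD d) c : (d <= 3)%nat -> imag_unit J -> cd_im (sl J c) = scal (snd c) J.
Proof.
intros hd hJ; unfold cd_im; rewrite cd_re_sl by easy; unfold sl, slice_pt; vec.
Qed.

Lemma cd_norm_scal d r (x : CD d) : norm (scal r x) = Rabs r * norm x.
Proof.
rewrite !norm_nsq, nsq_scal, sqrt_mult by (try apply nsq_ge0; apply pow2_ge_0).
f_equal; rewrite <- sqrt_Rsqr_abs; unfold Rsqr; f_equal; ring.
Qed.

Lemma norm_unit d (J : CD d) : (d <= 3)%nat -> imag_unit J -> norm J = 1.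
Proof.
intros hd hJ; apply imag_unit_iff in hJ as [_ h]; [|easy]; rewrite norm_nsq, h; apply sqrt_1.
Qed.

Lemma norm_im_sl d (J : CD d) c : (d <= 3)%nat -> imag_unit J -> norm (cd_im (sl J c)) = Rabs (snd c).
Proof.
intros hd hJ; rewrite cd_im_sl, cd_norm_scal, norm_unit by easy; ring.
Qed.

Lemma cd_conj_re d (x : CD d) : cd_conj x = (cd_real (2 * cd_re x) - x)%cd.
Proof. rewrite <- cd_t_re; unfold cd_t; vec. Qed.

Lemma cd_conj_sl d (J : CD d) c : (d <= 3)%nat -> imag_unit J -> cd_conj (sl J c) = sl J (Cconj c).
Proof.
intros hd hJ; rewrite cd_conj_re, cd_re_sl by easy; unfold sl, slice_pt, cd_real, Cconj; simpl; vec.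
Qed.

Lemma cd_inv_sl d (J : CD d) c : (d <= 3)%nat -> imag_unit J -> cd_inv (sl J c) = sl J (/ c)%C.
Proof.
intros hd hJ; unfold cd_inv; rewrite cd_conj_sl, norm_sl, sl_scal by easy; f_equal.
assert (e : Cmod c ^ 2 = fst c ^ 2 + snd c ^ 2).
{ unfold Cmod; rewrite pow2_sqrt by nra; ring. }
rewrite e; unfold Cinv, Cconj, RtoC, Cmult, Rdiv; simpl; apply injective_projections; simpl; ring.
Qed.

Lemma cd_pow_sl d (J : CD d) c n : (d <= 3)%nat -> imag_unit J -> cd_pow (sl J c) n = sl J (c ^ n)%C.
Proof.
intros hd hJ; induction n as [|n IH]; simpl; [symmetry; apply sl_one|]; now rewrite IH, sl_mul.
Qed.

Definition Czpow (c : C) (k : Z) : C :=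
  match k with
  | Z0 => 1%C
  | Zpos p => (c ^ Pos.to_nat p)%C
  | Zneg p => ((/ c) ^ Pos.to_nat p)%C
  end.

Lemma cd_zpow_sl d (J : CD d) c k : (d <= 3)%nat -> imag_unit J -> cd_zpow (sl J c) k = sl J (Czpow c k).
Proof.
intros hd hJ; destruct k; simpl; [symmetry; apply sl_one| |]; rewrite ?cd_inv_sl by easy; now apply cd_pow_sl.
Qed.

Lemma Czpow_shift (c : C) (n m : nat) : c <> 0%C ->
  Czpow c (Z.of_nat n - Z.of_nat m) = (c ^ n * (/ c) ^ m)%C.
Proof.
intros hc; rewrite Cpow_inv by easy.
assert (hn := fun n => Cpow_nz c n hc).
destruct (Z.of_nat n - Z.of_nat m)%Z as [|p|p] eqn:E; simpl.
- assert (n = m) by lia; subst; field; auto.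
- assert (e : n = (Pos.to_nat p + m)%nat) by lia; rewrite e, Cpow_add_r; field; auto.
- assert (e : m = (Pos.to_nat p + n)%nat) by lia; rewrite Cpow_inv by easy.
  rewrite e, Cpow_add_r; field; auto.
Qed.

(** The polynomial z^2 - 2 Re(c) z + |c|^2. Its coefficients are real, so it represents [Delta] on
    every slice, and it does not distinguish [c] from its conjugate. *)
Definition dlt (c z : C) : C := ((z - c) * (z - Cconj c))%C.

Lemma Delta_sl d (J I : CD d) c z : (d <= 3)%nat -> imag_unit J -> imag_unit I ->
  Defs.Delta (sl J c) (sl I z) = sl I (dlt c z).
Proof.
intros hd hJ hI; unfold Defs.Delta; rewrite cd_t_re, cd_n_nsq, cd_re_sl by easy.
rewrite nsq_norm, norm_sl by easy; rewrite <- !(sl_real d I), !sl_mul, sl_minus by easy.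
etransitivity; [exact (sl_plus d I _ _)|]; f_equal; assert (e : Cmod c ^ 2 = fst c ^ 2 + snd c ^ 2).
{ unfold Cmod; rewrite pow2_sqrt by nra; ring. }
rewrite e; unfold dlt; apply injective_projections; simpl; ring.
Qed.

Lemma unit_exists d : (1 <= d)%nat -> exists J : CD d, imag_unit J.
Proof. destruct d as [|d]; [lia|]; intros _; exists J0; apply J0_unit. Qed.

Lemma slice_decomp d (x : CD d) : (1 <= d <= 3)%nat ->
  exists (J : CD d) b, imag_unit J /\ 0 <= b /\ x = sl J (cd_re x, b).
Proof.
intros hd; destruct (Req_dec (norm (cd_im x)) 0) as [e|e].
- destruct (unit_exists d) as [J hJ]; [lia|]; exists J, 0; split; [easy|]; split; [lra|].
  assert (k : cd_im x = zero) by (apply nsq_zero_iff; rewrite nsq_norm, e; ring).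
  apply crd_ext; intros i; apply (f_equal (crd i)) in k; revert k.
  unfold sl, slice_pt, cd_im; simpl; crd_simpl; intros k; lra.
- assert (hp := norm_ge_0 (cd_im x)).
  exists (scal (/ norm (cd_im x)) (cd_im x)), (norm (cd_im x)); split; [|split; [easy|]].
  + apply imag_unit_iff; [lia|]; rewrite cd_re_scal, nsq_scal, nsq_norm; split; [|field; easy].
    unfold cd_im; rewrite cd_minus_scal, cd_re_plus; unfold cd_real; rewrite !cd_re_scal, cd_re_one; ring.
  + apply crd_ext; intros i; unfold sl, slice_pt, cd_real; simpl; crd_simpl.
    transitivity (cd_re x * crd i cd_one + crd i (cd_im x)); [|field; easy].
    unfold cd_im, cd_real; crd_simpl; ring.
Qed.

Lemma sl_inj d (J : CD d) a b : (d <= 3)%nat -> imag_unit J -> sl J a = sl J b -> a = b.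
Proof.
intros hd hJ e.
assert (h : Cmod (a - b) = 0).
{ rewrite <- (norm_sl d J), <- sl_minus, e, norm_nsq by easy.
  replace (sl J b - sl J b)%cd with (scal 0 (sl J b)) by vec.
  rewrite nsq_scal; replace (0 ^ 2 * nsq (sl J b)) with 0 by ring; apply sqrt_0. }
apply Cmod_eq_0 in h; replace a with (a - b + b)%C by ring; rewrite h; ring.
Qed.

(** J(Jx) = -x enters here: the term with two imaginary factors picks up the sign of i^2. *)
Lemma ev_smul d (J : CD d) c h : (d <= 3)%nat -> imag_unit J ->
  (sl J c * ev J h = ev J (fun i => c * h i)%C)%cd.
Proof.
intros hd hJ; unfold ev; rewrite sl_mulE, !cd_mul_plus_r, unit_mulK by easy.
set (p := mkc (fun i => fst (h i))); set (q := mkc (fun i => snd (h i))).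
replace (mkc (fun i => fst (c * h i)%C)) with (scal (fst c) p + scal (- snd c)%R q)%cd
  by (apply crd_ext; intros i; crd_simpl; unfold p, q; rewrite !crd_mkc; simpl; ring).
replace (mkc (fun i => snd (c * h i)%C)) with (scal (fst c) q + scal (snd c) p)%cd
  by (apply crd_ext; intros i; crd_simpl; unfold p, q; rewrite !crd_mkc; simpl; ring).
rewrite cd_mul_plus_r, !cd_mul_scal_r; vec.
Qed.

Lemma ev_plus d (J : CD d) g h : (ev J g + ev J h = ev J (fun i => g i + h i)%C)%cd.
Proof.
unfold ev.
replace (mkc (fun i => fst (g i + h i)%C)) with (mkc (fun i => fst (g i)) + mkc (fun i => fst (h i)))%cd
  by (apply crd_ext; intros i; crd_simpl; rewrite !crd_mkc; simpl; ring).
replace (mkc (fun i => snd (g i + h i)%C)) with (mkc (fun i => snd (g i)) + mkc (fun i => snd (h i)))%cd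
  by (apply crd_ext; intros i; crd_simpl; rewrite !crd_mkc; simpl; ring).
rewrite cd_mul_plus_r; vec.
Qed.

Lemma ev_ext d (J : CD d) g h : (forall i, g i = h i) -> ev J g = ev J h.
Proof.
intros e; unfold ev; f_equal; [|f_equal]; apply crd_ext; intros; rewrite !crd_mkc; now rewrite e.
Qed.

Lemma ev_real d (J : CD d) (x : CD d) : ev J (fun i => RtoC (crd i x)) = x.
Proof.
unfold ev; simpl; rewrite crd_mk_ext.
replace (mkc (fun _ : Ix d => 0)) with (zero : CD d)
  by (apply crd_ext; intros; now rewrite crd_mkc, crd_zero).
rewrite cd_mul_0_r; vec.
Qed.

Lemma is_series_ev d (J : CD d) (h : nat -> Ix d -> C) l :
  (forall i, csum (fun n => h n i) (l i)) -> is_series (fun n => ev J (h n)) (ev J l).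
Proof.
intros H; apply (is_series_plus (V := CD d)); [|apply is_series_mul]; apply is_series_crd; intros i;
  rewrite crd_mkc.
- apply is_series_ext with (2 := proj1 (H i)); intros; now rewrite crd_mkc.
- apply is_series_ext with (2 := proj2 (H i)); intros; now rewrite crd_mkc.
Qed.

Lemma is_RInt_ev d (J : CD d) (h : R -> Ix d -> C) a b :
  (forall i t, rcont (fun t => h t i) t) ->
  is_RInt (fun t => ev J (h t)) a b (ev J (fun i => cI (fun t => h t i) a b)).
Proof.
intros H; apply (is_RInt_plus (V := CD d)); [apply is_RInt_crd|apply is_RInt_mul]; intros i;
  rewrite crd_mkc; destruct (rcont_ex_RInt _ a b (H i)) as [h1 h2].
- apply is_RInt_ext with (fun t => fst (h t i)); [intros; now rewrite crd_mkc|].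
  apply (RInt_correct (V := R_CompleteNormedModule)), h1.
- apply is_RInt_ext with (fun t => snd (h t i)); [intros; now rewrite crd_mkc|].
  apply (RInt_correct (V := R_CompleteNormedModule)), h2.
Qed.

Lemma is_derive_sl d (J : CD d) (g : R -> C) t l : rder g t l ->
  is_derive (fun s => sl J (g s)) t (sl J l).
Proof.
intros [h1 h2]; apply is_derive_crd; intros i.
apply is_derive_ext with (fun s => fst (g s) * crd i (cd_one : CD d) + snd (g s) * crd i J).
- intros s; unfold sl, slice_pt, cd_real; crd_simpl; eqR; ring.
- replace (crd i (sl J l)) with (fst l * crd i (cd_one : CD d) + snd l * crd i J)
    by (unfold sl, slice_pt, cd_real; crd_simpl; ring).
  apply (is_derive_plus (V := R_NormedModule)); apply (is_derive_scal_l (V := R_NormedModule)); assumption.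
Qed.

(** * Slice products and the powers of [x - y] *)

(** In contrast to [slice_stem] there is no domain: the powers of x - y are total functions, and
    their parity holds on the whole plane. *)
Definition sfun d (F1 F2 : C -> CD d) (f : CD d -> CD d) : Prop :=
  (forall z, F1 (Cconj z) = F1 z /\ F2 (Cconj z) = opp (F2 z)) /\
  (forall I z, imag_unit I -> f (sl I z) = (F1 z + I * F2 z)%cd).
Arguments sfun {d} F1 F2 f.

Lemma J0_unit_pos d : (1 <= d)%nat -> imag_unit (J0 : CD d).
Proof. destruct d; [lia|intros _; apply J0_unit]. Qed.

Lemma sfun_stem d (F1 F2 : C -> CD d) f z : (1 <= d <= 3)%nat -> sfun F1 F2 f ->
  stem1 f z = F1 z /\ stem2 f z = F2 z.
Proof.
intros hd [hp hf]; assert (hJ := J0_unit_pos d ltac:(lia)).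
pose proof (hf J0 z hJ) as e1; pose proof (hf J0 (Cconj z) hJ) as e2.
rewrite (proj1 (hp z)), (proj2 (hp z)), cd_mul_opp_r in e2.
unfold sl in e1, e2; simpl in e2; unfold stem1, stem2; rewrite e1, e2; split; [vec|].
replace (scal (/ 2) _) with (J0 * F2 z)%cd by vec.
rewrite unit_mulK by (easy || lia); vec.
Qed.

Lemma Cconj_real (a : R) : Cconj (a, 0) = (a, 0).
Proof. unfold Cconj; simpl; f_equal; ring. Qed.

Lemma induced_sl d (F1 F2 : C -> CD d) I z : (d <= 3)%nat -> imag_unit I ->
  (forall z, F1 (Cconj z) = F1 z /\ F2 (Cconj z) = opp (F2 z)) ->
  induced F1 F2 (sl I z) = (F1 z + I * F2 z)%cd.
Proof.
intros hd hI hp; unfold induced; rewrite cd_re_sl, norm_im_sl, cd_im_sl by easy.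
destruct z as [a b]; simpl fst; simpl snd.
destruct (Rtotal_order b 0) as [h|[h|h]].
- rewrite Rabs_left by easy; destruct (hp (a, b)) as [e1 e2].
  unfold Cconj in e1, e2; simpl in e1, e2; rewrite e1, e2, cd_mul_opp_r.
  replace (scal (/ - b) (scal b I)) with (opp I); [rewrite cd_mul_opp_l; vec|].
  apply crd_ext; intros i; crd_simpl; field; lra.
(* On the real axis oddness forces [F2] to vanish, so the inverse of zero inside [induced] is
   harmless. *)
- subst b; rewrite Rabs_R0; destruct (hp (a, 0)) as [_ e2]; rewrite Cconj_real in e2.
  assert (z2 : F2 (a, 0) = zero).
  { apply crd_ext; intros i; apply (f_equal (crd i)) in e2; revert e2; crd_simpl; lra. }
  rewrite z2, !cd_mul_0_r; reflexivity.
- rewrite Rabs_pos_eq by lra; f_equal; f_equal; apply crd_ext; intros i; crd_simpl; field; lra.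
Qed.

Lemma sfun_mul d (F1 F2 G1 G2 : C -> CD d) f g : (1 <= d <= 3)%nat -> sfun F1 F2 f -> sfun G1 G2 g ->
  sfun (fun z => F1 z * G1 z - F2 z * G2 z)%cd (fun z => F1 z * G2 z + F2 z * G1 z)%cd (slice_mul f g).
Proof.
intros hd hf hg.
assert (par : forall z, (F1 (Cconj z) * G1 (Cconj z) - F2 (Cconj z) * G2 (Cconj z) =
    F1 z * G1 z - F2 z * G2 z)%cd /\
  (F1 (Cconj z) * G2 (Cconj z) + F2 (Cconj z) * G1 (Cconj z) = - (F1 z * G2 z + F2 z * G1 z))%cd).
{ intros z; destruct (proj1 hf z) as [e1 e2], (proj1 hg z) as [k1 k2]; rewrite e1, e2, k1, k2.
  rewrite !cd_mul_opp_l, !cd_mul_opp_r; split; vec. }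
split; [exact par|]; intros I z hI; unfold slice_mul.
transitivity (induced (fun z => F1 z * G1 z - F2 z * G2 z)%cd (fun z => F1 z * G2 z + F2 z * G1 z)%cd (sl I z)).
- unfold induced; set (p := (cd_re (sl I z), norm (cd_im (sl I z)))).
  destruct (sfun_stem d F1 F2 f p hd hf) as [e1 e2], (sfun_stem d G1 G2 g p hd hg) as [k1 k2].
  now rewrite e1, e2, k1, k2.
- apply (induced_sl d (fun z => F1 z * G1 z - F2 z * G2 z)%cd (fun z => F1 z * G2 z + F2 z * G1 z)%cd);
    [lia|easy|exact par].
Qed.

Lemma sfun_ext d (F1 F2 G1 G2 : C -> CD d) f : (forall z, F1 z = G1 z /\ F2 z = G2 z) ->
  sfun F1 F2 f -> sfun G1 G2 f.
Proof.
intros e [h1 h2]; split.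
- intros z; destruct (e z) as [<- <-], (e (Cconj z)) as [<- <-]; apply h1.
- intros I z hI; destruct (e z) as [<- <-]; now apply h2.
Qed.

(** Representation formula on one slice: the stem of the slice function that is [phi] on C_J
    consists of the even part of [phi] under conjugation and of -i times its odd part, transported
    to C_J. *)
Definition evenp (phi : C -> C) (z : C) : C := (/ 2 * (phi z + phi (Cconj z)))%C.
Definition oddp (phi : C -> C) (z : C) : C := (- Ci * / 2 * (phi z - phi (Cconj z)))%C.

(* [f] is the slice function which on [C_J] is the complex function [phi]. *)
Definition isl d (J : CD d) (phi : C -> C) (f : CD d -> CD d) : Prop :=
  sfun (fun z => sl J (evenp phi z)) (fun z => sl J (oddp phi z)) f.
Arguments isl {d} J phi f.

(** All stem values lie in the commutative slice C_J, where the slice product is the product of the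
    complex functions F1 + i F2 and G1 + i G2. *)
Lemma isl_mul d (J : CD d) phi psi f g : (1 <= d <= 3)%nat -> imag_unit J ->
  isl J phi f -> isl J psi g -> isl J (fun z => phi z * psi z)%C (slice_mul f g).
Proof.
intros hd hJ hf hg; apply sfun_ext with (2 := sfun_mul _ _ _ _ _ _ _ hd hf hg); intros z.
assert (i2 : (Ci * Ci = -1)%C) by (apply injective_projections; simpl; ring).
rewrite !sl_mul, sl_plus, sl_minus by (easy || lia); split; f_equal; unfold evenp, oddp.
- set (p := phi z); set (p' := phi (Cconj z)); set (q := psi z); set (q' := psi (Cconj z)).
  replace (- Ci * / 2 * (p - p') * (- Ci * / 2 * (q - q')))%C
    with (Ci * Ci * (/ 2 * / 2 * (p - p') * (q - q')))%C by ring.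
  rewrite i2; field; intros e; apply RtoC_inj in e; lra.
- field; intros e; apply RtoC_inj in e; lra.
Qed.

Lemma isl_one d (J : CD d) : isl J (fun _ => 1%C) (fun _ => cd_one).
Proof.
apply sfun_ext with (fun _ => cd_one) (fun _ => zero).
- intros z; unfold evenp, oddp; split.
  + rewrite <- (sl_one d J); f_equal; field; intros e; apply RtoC_inj in e; lra.
  + replace (- Ci * / 2 * (1 - 1))%C with (RtoC 0) by ring; rewrite sl_real; unfold cd_real; vec.
- split; [split; [easy|vec]|]; intros; rewrite cd_mul_0_r; vec.
Qed.

Lemma isl_pow d (J : CD d) phi f n : (1 <= d <= 3)%nat -> imag_unit J ->
  isl J phi f -> isl J (fun z => phi z ^ n)%C (slice_pow f n).
Proof.
intros hd hJ hf; induction n as [|n IH]; [apply isl_one|].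
apply (isl_mul d J phi (fun z => phi z ^ n)%C); easy.
Qed.

(** Both x - y and its slice inverse have the shape p(x) - q(x) y, where p = a + i b and q = u + i v
    act by the same formula on every slice; the second hypothesis splits p - q y into its stem
    components. *)
Lemma isl_intro d (J : CD d) phi f (a b : C -> R) (u v : C -> R) (y : C) :
  (forall I z, imag_unit I -> f (sl I z) =
    (sl I (a z, b z) - sl I (u z, v z) * sl J y)%cd) ->
  (forall z, evenp phi z = (RtoC (a z) - RtoC (u z) * y)%C /\ oddp phi z = (RtoC (b z) - RtoC (v z) * y)%C) ->
  isl J phi f.
Proof.
intros hf e.
split.
- intros z; unfold evenp, oddp; rewrite Cconj_conj; split; [f_equal; ring|].
  rewrite cd_opp_scal, sl_scal; f_equal; ring.
- intros I z hI; destruct (e z) as [-> ->]; rewrite (hf I z hI), <- !sl_minus, sl_mulE, !sl_real.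
  rewrite <- !sl_scal, cd_mul_minus_r, !cd_mul_scal_r; unfold sl at 1, slice_pt, cd_real; simpl.
  rewrite cd_mul_scal_r, cd_mul_1_r; vec.
Qed.

Lemma isl_sub d (J : CD d) c : imag_unit J -> isl J (fun z => z - c)%C (fun x => x - sl J c)%cd.
Proof.
intros hJ; apply isl_intro with (a := fun z => fst z) (b := fun z => snd z) (u := fun _ => 1) (v := fun _ => 0) (y := c).
- intros I [a b] hI; simpl; f_equal.
  change (1, 0) with (RtoC 1); now rewrite sl_one, cd_mul_1_l.
- intros [a b]; unfold evenp, oddp; split; apply injective_projections; simpl; field.
Qed.

Lemma isl_inv d (J : CD d) c : (d <= 3)%nat -> imag_unit J ->
  isl J (fun z => / dlt c z * (z - Cconj c))%C
    (fun x => cd_inv (Defs.Delta (sl J c) x) * (x - cd_conj (sl J c)))%cd.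
Proof.
intros hd hJ.
apply isl_intro with (a := fun z => fst (/ dlt c z * z)%C) (b := fun z => snd (/ dlt c z * z)%C)
  (u := fun z => fst (/ dlt c z)%C) (v := fun z => snd (/ dlt c z)%C) (y := Cconj c).
- intros I z hI; rewrite Delta_sl, cd_inv_sl, cd_conj_sl, cd_mul_minus_r, sl_mul by easy.
  now rewrite <- !surjective_pairing.
- intros z.
  assert (e : (/ dlt c (Cconj z))%C = Cconj (/ dlt c z)).
  { replace (dlt c (Cconj z)) with (Cconj (dlt c z)).
    - destruct (dlt c z) as [p q]; unfold Cinv, Cconj; simpl; f_equal; [f_equal; ring|].
      unfold Rdiv; rewrite <- Ropp_mult_distr_l; f_equal; f_equal; f_equal; ring.
    - unfold dlt; apply injective_projections; simpl; ring. }
  unfold evenp, oddp; rewrite e; destruct (/ dlt c z)%C as [p q], z as [a b].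
  split; apply injective_projections; simpl; field.
Qed.

(** On the slice of its centre a slice power is the ordinary power, since slice products of
    functions coming from C_J multiply there pointwise; for negative [n] the factor z - conj c
    cancels against [Delta]. The expansion at y thus becomes an ordinary Laurent series on C_J. *)
Lemma bullet_mul_const d (J a : CD d) c n z : (1 <= d <= 3)%nat -> imag_unit J ->
  z <> c -> z <> Cconj c ->
  slice_mul (bullet (sl J c) n) (fun _ => a) (sl J z) = (sl J (Czpow (z - c) n) * a)%cd.
Proof.
intros hd hJ h1 h2.
assert (key : exists phi, isl J phi (bullet (sl J c) n) /\ phi z = Czpow (z - c) n).
{ destruct n as [|p|p]; simpl.
  - exists (fun _ => 1%C); split; [apply isl_one|easy].
  - exists (fun z => (z - c) ^ Pos.to_nat p)%C; split; [|easy].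
    apply (isl_pow d J (fun z => z - c)%C); [easy|easy|now apply isl_sub].
  - exists (fun z => (/ dlt c z * (z - Cconj c)) ^ Pos.to_nat p)%C; split.
    + apply (isl_pow d J (fun z => / dlt c z * (z - Cconj c))%C); [easy|easy|apply isl_inv; [lia|easy]].
    + f_equal; unfold dlt; field; split; now apply Csub_neq0. }
destruct key as [phi [hphi e]].
assert (hc : sfun (fun _ => a) (fun _ => zero) (fun _ => a)).
{ split; [split; [easy|vec]|]; intros; rewrite cd_mul_0_r; vec. }
rewrite (proj2 (sfun_mul _ _ _ _ _ _ _ hd hphi hc) J z hJ), !cd_mul_0_r, <- e.
(* The value is F1 a + J (F2 a) with F1 and F2 in C_J; [sl_mulA] merges both terms into the single
   left factor F1 + J F2, which is [phi z]. *)
assert (k : phi z = (evenp phi z + Ci * oddp phi z)%C).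
{ assert (i2 : (Ci * Ci = -1)%C) by (apply injective_projections; simpl; ring).
  unfold evenp, oddp.
  replace (Ci * (- Ci * / 2 * (phi z - phi (Cconj z))))%C
    with (- (Ci * Ci) * (/ 2 * (phi z - phi (Cconj z))))%C by ring.
  rewrite i2; field; intros k; apply RtoC_inj in k; lra. }
rewrite k, <- sl_plus, cd_mul_plus_l, <- (sl_mulA d J a Ci) by (easy || lia).
rewrite (sl_mulE d J (sl J (oddp phi z) * a)%cd Ci); simpl.
set (x := (sl J (oddp phi z) * a)%cd); replace (zero + x)%cd with x by vec; vec.
Qed.

(** * Slice regular functions as families of holomorphic functions *)

Lemma functional_choice_of T U (P : T -> U -> Prop) : (forall t, exists u, P t u) -> exists F, forall t, P t (F t).
Proof.
intros h; exists (fun t => proj1_sig (constructive_indefinite_description _ (h t))).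
intros t; exact (proj2_sig (constructive_indefinite_description _ (h t))).
Qed.

Lemma sl_eq_cases d (I J : CD d) z w : (d <= 3)%nat -> imag_unit I -> imag_unit J ->
  sl I z = sl J w -> z = w \/ z = Cconj w.
Proof.
intros hd hI hJ e; assert (e1 := f_equal (@cd_re d) e); rewrite !cd_re_sl in e1 by easy.
assert (e2 := f_equal (fun x => norm (cd_im x)) e); cbv beta in e2; rewrite !norm_im_sl in e2 by easy.
destruct z as [a b], w as [a' b']; simpl in *; subst a'.
destruct (Rcase_abs b) as [h|h], (Rcase_abs b') as [h'|h'].
- left; f_equal; rewrite !Rabs_left in e2 by easy; lra.
- right; unfold Cconj; simpl; f_equal; rewrite Rabs_left, Rabs_pos_eq in e2 by lra; lra.
- right; unfold Cconj; simpl; f_equal; rewrite Rabs_pos_eq, Rabs_left in e2 by lra; lra.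
- left; f_equal; rewrite !Rabs_pos_eq in e2 by lra; lra.
Qed.

Lemma Omega_of_sl d (D : C -> Prop) (I : CD d) z : (d <= 3)%nat -> conj_invariant D -> imag_unit I ->
  (Omega_of D (sl I z) <-> D z).
Proof.
intros hd hD hI; split.
- intros (a & b & J & hJ & h & e); destruct (sl_eq_cases d I J z (a, b) hd hI hJ e) as [->| ->]; auto.
- intros h; exists (fst z), (snd z), I; split; [easy|split; [|easy]]; now destruct z.
Qed.

Lemma slice_regular_hol d (Om : CD d -> Prop) f : (d <= 3)%nat -> slice_regular Om f ->
  exists (D : C -> Prop) (h : C -> Ix d -> C),
    open D /\ conj_invariant D /\ (forall I z, imag_unit I -> (Om (sl I z) <-> D z)) /\
    (forall i, hol D (fun z => h z i)) /\ (forall z i, D z -> h (Cconj z) i = Cconj (h z i)) /\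
    (forall I z, D z -> imag_unit I -> f (sl I z) = ev I (h z)).
Proof.
intros hd (D & _ & ho & hD & hOm & F1 & F2 & F1a & F1b & F2a & F2b & (hp & hf) & h1 & h2 & hCR).
exists D, (fun z i => (crd i (F1 z), crd i (F2 z))).
repeat (split; [assumption|]); split; [|split; [|split]].
- intros I z hI; rewrite hOm; now apply Omega_of_sl.
- intros i.
  apply (hol_of_CR D (fun z => crd i (F1 z)) (fun z => crd i (F2 z)) (fun z => crd i (F1a z))
    (fun z => crd i (F1b z)) (fun z => crd i (F2a z)) (fun z => crd i (F2b z)) ho).
  + intros z hz; destruct (h1 z hz) as (k1 & k2 & k3 & _); split; [|split].
    * exact (proj1 (is_derive_crd d _ _ _) k1 i).
    * exact (proj1 (is_derive_crd d _ _ _) k2 i).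
    * exact (proj1 (continuous_crd _ d _ _) k3 i).
  + intros z hz; destruct (h2 z hz) as (k1 & k2 & k3 & _); split; [|split].
    * exact (proj1 (is_derive_crd d _ _ _) k1 i).
    * exact (proj1 (is_derive_crd d _ _ _) k2 i).
    * exact (proj1 (continuous_crd _ d _ _) k3 i).
  + intros z hz; destruct (hCR z hz) as [-> ->]; now rewrite crd_opp.
- intros z i hz; destruct (hp z hz) as [-> ->]; rewrite crd_opp; reflexivity.
- intros I [a b] hz hI; unfold sl, ev; simpl; rewrite !crd_mk_ext; now apply hf.
Qed.

Lemma slice_regular_of_hol d (D : C -> Prop) (Om : CD d -> Prop) f (h : C -> Ix d -> C) :
  (exists z, D z) -> open D -> conj_invariant D -> (forall x, Om x <-> Omega_of D x) ->
  (forall i, hol D (fun z => h z i)) -> (forall z i, D z -> h (Cconj z) i = Cconj (h z i)) ->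
  (forall I z, D z -> imag_unit I -> f (sl I z) = ev I (h z)) -> slice_regular Om f.
Proof.
intros hne ho hD hOm hh hp hf; exists D; repeat (split; [assumption|]).
apply functional_choice_of in hh as [h' H].
assert (Hc : forall i z, D z -> continuous (fun z => fst (h' i z)) z /\ continuous (fun z => snd (h' i z)) z).
{ intros i z hz; apply Ccont_components; apply Ccont_ext with (h' i); [|now apply H].
  exists 1; split; [lra|]; intros w _; apply surjective_pairing. }
exists (fun z => mkc (fun i => fst (h z i))), (fun z => mkc (fun i => snd (h z i))),
  (fun z => mkc (fun i => fst (h' i z))), (fun z => mkc (fun i => - snd (h' i z))),
  (fun z => mkc (fun i => snd (h' i z))), (fun z => mkc (fun i => fst (h' i z))).
split; [split|split; [|split]].
- intros z hz; split; apply crd_ext; intros i; crd_simpl; rewrite !crd_mkc, hp by easy; reflexivity.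
- intros a b J hz hJ; exact (hf J (a, b) hz hJ).
- intros z hz; split; [|split; [|split]].
  + apply is_derive_crd; intros i; rewrite crd_mkc.
    apply is_derive_ext with (2 := proj1 (proj1 (cder_partials _ _ _ (proj1 (H i z hz))))).
    intros; now rewrite crd_mkc.
  + apply is_derive_crd; intros i; rewrite crd_mkc.
    replace (- snd (h' i z)) with (fst (Ci * h' i z)%C) by (simpl; ring).
    apply is_derive_ext with (2 := proj1 (proj2 (cder_partials _ _ _ (proj1 (H i z hz))))).
    intros; now rewrite crd_mkc.
  + apply continuous_crd; intros i; apply continuous_ext with (2 := proj1 (Hc i z hz)).
    intros; now rewrite crd_mkc.
  + apply continuous_crd; intros i.
    apply continuous_ext with (2 := continuous_opp _ _ (proj2 (Hc i z hz))).
    intros; now rewrite crd_mkc.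
- intros z hz; split; [|split; [|split]].
  + apply is_derive_crd; intros i; rewrite crd_mkc.
    apply is_derive_ext with (2 := proj2 (proj1 (cder_partials _ _ _ (proj1 (H i z hz))))).
    intros; now rewrite crd_mkc.
  + apply is_derive_crd; intros i; rewrite crd_mkc.
    replace (fst (h' i z)) with (snd (Ci * h' i z)%C) by (simpl; ring).
    apply is_derive_ext with (2 := proj2 (proj2 (cder_partials _ _ _ (proj1 (H i z hz))))).
    intros; now rewrite crd_mkc.
  + apply continuous_crd; intros i; apply continuous_ext with (2 := proj2 (Hc i z hz)).
    intros; now rewrite crd_mkc.
  + apply continuous_crd; intros i; apply continuous_ext with (2 := proj1 (Hc i z hz)).
    intros; now rewrite crd_mkc.
- intros z hz; split; [reflexivity|]; apply crd_ext; intros i; crd_simpl; now rewrite !crd_mkc.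
Qed.

Lemma locally_CD_norm d (w : CD d) (P : CD d -> Prop) :
  locally w P <-> exists r, 0 < r /\ forall x, norm (x - w)%cd < r -> P x.
Proof.
split.
- intros h; apply (locally_norm_le_locally (V := CD d)) in h; destruct h as [e He].
  exists e; split; [apply cond_pos|]; intros x hx; now apply He.
- intros [r [hr H]]; apply (locally_le_locally_norm (V := CD d)).
  exists (mkposreal r hr); intros x hx; now apply H.
Qed.

Lemma sl_dist d (I : CD d) z w : (d <= 3)%nat -> imag_unit I -> norm (sl I z - sl I w)%cd = Cmod (z - w).
Proof. intros hd hI; now rewrite sl_minus, norm_sl. Qed.

(* [y] is [a0 + b0 J] with [c = a0 + i b0], [b0 > 0]; [Dt] and [h] are the domain and the
   coordinates of the stem function of [f]. *)
Record setting d (Omt : CD d -> Prop) (y : CD d) (f : CD d -> CD d) (c : C) (Dt : C -> Prop)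
    (h : C -> Ix d -> C) : Prop := Setting {
  st_d : (1 <= d <= 3)%nat;
  st_c : 0 < snd c;
  st_y : exists J : CD d, imag_unit J /\ y = sl J c;
  st_open : open Dt;
  st_conj : conj_invariant Dt;
  st_Dc : Dt c;
  st_Om : forall (I : CD d) z, imag_unit I -> (Omt (sl I z) <-> Dt z);
  st_Omega : forall x, Omt x <-> Omega_of Dt x;
  st_sphere : forall w, sphere y w <-> exists I : CD d, imag_unit I /\ w = sl I c;
  st_hol : forall i, hol (fun z => Dt z /\ z <> c /\ z <> Cconj c) (fun z => h z i);
  st_sym : forall z i, Dt z -> z <> c -> z <> Cconj c -> h (Cconj z) i = Cconj (h z i);
  st_f : forall (I : CD d) z, imag_unit I -> Dt z -> z <> c -> z <> Cconj c -> f (sl I z) = ev I (h z)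
}.
Arguments st_d {d Omt y f c Dt h} s.
Arguments st_c {d Omt y f c Dt h} s.
Arguments st_y {d Omt y f c Dt h} s.
Arguments st_open {d Omt y f c Dt h} s.
Arguments st_conj {d Omt y f c Dt h} s.
Arguments st_Dc {d Omt y f c Dt h} s.
Arguments st_Om {d Omt y f c Dt h} s.
Arguments st_Omega {d Omt y f c Dt h} s.
Arguments st_sphere {d Omt y f c Dt h} s.
Arguments st_hol {d Omt y f c Dt h} s.
Arguments st_sym {d Omt y f c Dt h} s.
Arguments st_f {d Omt y f c Dt h} s.

Lemma sphere_sl d (J : CD d) c w : (d <= 3)%nat -> imag_unit J ->
  (sphere (sl J c) w <-> exists I : CD d, imag_unit I /\ w = sl I c).
Proof.
intros hd hJ; split.
- intros (a & b & J' & I & hJ' & hI & e & ->).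
  destruct (sl_eq_cases d J J' c (a, b) hd hJ hJ' e) as [->| ->]; [now exists I|].
  exists (opp I); split; [now apply imag_unit_opp|]; rewrite sl_opp, Cconj_conj; reflexivity.
- intros [I [hI ->]]; exists (fst c), (snd c), J, I; auto.
Qed.

Lemma setting_exists d (hd : (1 <= d <= 3)%nat)
    (Omt : CD d -> Prop) (hcirc : circular Omt) (hopen : open Omt)
    (y : CD d) (hy : Omt y) (hyR : ~ exists r : R, y = cd_real r)
    (f : CD d -> CD d) (hf : slice_regular (off_sphere Omt y) f) :
  exists c Dt h, setting d Omt y f c Dt h.
Proof.
assert (hd3 : (d <= 3)%nat) by lia.
destruct (slice_decomp d y hd) as (J & b & hJ & hb & ey).
destruct hcirc as (Dt & _ & hDt & hOmt).
revert ey; generalize (cd_re y); intros a ey; set (c := (a, b)) in *.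
assert (hb' : 0 < b).
{ destruct (Req_dec b 0) as [e|]; [|lra]; exfalso; apply hyR; exists a.
  rewrite ey; unfold c; rewrite e; change (a, 0) with (RtoC a); apply sl_real. }
assert (hOm : forall (I : CD d) z, imag_unit I -> (Omt (sl I z) <-> Dt z)).
{ intros I z hI; rewrite hOmt; now apply Omega_of_sl. }
destruct (slice_regular_hol d _ f hd3 hf) as (D & h & hD & _ & hOmD & hh & hp & hff).
assert (hs : forall w, sphere y w <-> exists I : CD d, imag_unit I /\ w = sl I c).
{ intros w; rewrite ey; now apply sphere_sl. }
(* For stem functions, removing the sphere means removing exactly the two points [c] and
   [Cconj c]. *)
assert (eD : forall z, D z <-> Dt z /\ z <> c /\ z <> Cconj c).
{ intros z; rewrite <- (hOmD J z hJ), <- (hOm J z hJ); unfold off_sphere; rewrite hs; split.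
  - intros [h1 h2]; split; [easy|]; split; intros ->; apply h2; [now exists J|].
    exists (opp J); split; [now apply imag_unit_opp|]; now rewrite sl_opp.
  - intros (h1 & h2 & h3); split; [easy|]; intros (I & hI & e).
    destruct (sl_eq_cases d J I z c hd3 hJ hI e); auto. }
exists c, Dt, h; split; auto.
- now exists J.
- intros z hz; apply (hOm J) in hz; [|easy]; apply hopen in hz; apply locally_CD_norm in hz.
  destruct hz as [r [hr H]]; apply locally_C_disc; exists r; split; [easy|]; intros w hw.
  apply (hOm J w hJ), H; now rewrite sl_dist.
- apply (hOm J c hJ); now rewrite <- ey.
- intros i; apply (hol_sub D); [intros z hz; now apply eD|apply hh].
- intros z i h1 h2 h3; apply hp, eD; auto.
- intros I z hI h1 h2 h3; apply hff; [now apply eD|easy].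
Qed.

(** * Growth of the stem function and of its slices near the sphere *)

Definition grows_on_slice d (h : C -> Ix d -> C) (c : C) (I : CD d) (k : nat) : Prop :=
  exists M r, 0 < r /\ forall z, pdisc c r z -> Cmod (z - c) ^ k * norm (ev I (h z)) <= M.

Definition grows d (h : C -> Ix d -> C) (c : C) (k : nat) : Prop :=
  exists M r, 0 < r /\ forall z, pdisc c r z -> forall i, Cmod (z - c) ^ k * Cmod (h z i) <= M.

Lemma norm_ev_le d (I : CD d) g M : (d <= 3)%nat -> imag_unit I -> (forall i, Cmod (g i) <= M) ->
  norm (ev I g) <= 2 * 2 ^ d * M.
Proof.
intros hd hI h; unfold ev.
eapply Rle_trans; [exact (norm_triangle (V := CD d) _ _)|].
rewrite cd_norm_mul, (norm_unit d I), Rmult_1_l by easy.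
assert (h1 : norm (mkc (fun i => fst (g i))) <= 2 ^ d * M).
{ apply norm_le_crd; intros i; rewrite crd_mkc; eapply Rle_trans; [apply abs_fst_le_Cmod|apply h]. }
assert (h2 : norm (mkc (fun i => snd (g i))) <= 2 ^ d * M).
{ apply norm_le_crd; intros i; rewrite crd_mkc; eapply Rle_trans; [apply abs_snd_le_Cmod|apply h]. }
lra.
Qed.

Lemma cd_norm_minus d (x y : CD d) : norm (x - y)%cd <= norm x + norm y.
Proof.
eapply Rle_trans; [exact (norm_triangle (V := CD d) x (opp y))|].
right; f_equal; exact (norm_opp (V := CD d) y).
Qed.

Lemma norm_eq0 d (x : CD d) : norm x = 0 -> x = zero.
Proof. intros e; apply nsq_zero_iff; rewrite nsq_norm, e; ring. Qed.

Lemma cd_sub_eq0 d (x y : CD d) : (x - y)%cd = zero -> x = y.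
Proof.
intros e; apply crd_ext; intros i; apply (f_equal (crd i)) in e; revert e; crd_simpl; lra.
Qed.

Lemma norm_sub_pos d (x y : CD d) : x <> y -> 0 < norm (x - y)%cd.
Proof.
intros h; destruct (Rle_lt_or_eq_dec 0 _ (norm_ge_0 (x - y)%cd)) as [k|k]; [easy|].
exfalso; apply h, cd_sub_eq0, norm_eq0; now symmetry.
Qed.

(* [(I - I') F2] is the difference of the two values, so [F2] and then [F1] are controlled. *)
Lemma ev_two_units d (I I' : CD d) : (d <= 3)%nat -> imag_unit I -> imag_unit I' -> I <> I' ->
  exists K, 0 <= K /\ forall g m, norm (ev I g) <= m -> norm (ev I' g) <= m -> forall i, Cmod (g i) <= K * m.
Proof.
intros hd hI hI' hn; assert (hp := norm_sub_pos d I I' hn); set (e := norm (I - I')%cd) in *.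
assert (he : 0 < / e) by now apply Rinv_0_lt_compat.
exists (1 + 4 * / e); split; [lra|]; intros g m h1 h2 i.
set (p := mkc (fun i => fst (g i))); set (q := mkc (fun i => snd (g i))).
assert (hq : e * norm q <= 2 * m).
{ unfold e; rewrite <- cd_norm_mul by easy; rewrite cd_mul_minus_l.
  replace (I * q - I' * q)%cd with (ev I g - ev I' g)%cd by (unfold ev; fold p q; vec).
  eapply Rle_trans; [apply cd_norm_minus|lra]. }
assert (hq' : norm q <= 2 * / e * m).
{ replace (norm q) with (/ e * (e * norm q)) by (field; lra).
  replace (2 * / e * m) with (/ e * (2 * m)) by ring; apply Rmult_le_compat_l; lra. }
assert (hpn : norm p <= m + norm q).
{ replace p with (ev I g - I * q)%cd by (unfold ev; fold p q; vec).
  eapply Rle_trans; [apply cd_norm_minus|]; rewrite cd_norm_mul, (norm_unit d I) by easy; lra. }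
eapply Rle_trans; [apply Cmod_le_sum|].
assert (e1 : Rabs (fst (g i)) <= norm p).
{ eapply Rle_trans; [|apply (abs_crd_le_norm d i p)]; unfold p; rewrite crd_mkc; lra. }
assert (e2 : Rabs (snd (g i)) <= norm q).
{ eapply Rle_trans; [|apply (abs_crd_le_norm d i q)]; unfold q; rewrite crd_mkc; lra. }
lra.
Qed.

Lemma pow_le_le1 t k l : 0 <= t <= 1 -> (k <= l)%nat -> t ^ l <= t ^ k.
Proof.
intros ht hl; replace l with (k + (l - k))%nat by lia; rewrite pow_add.
rewrite <- (Rmult_1_r (t ^ k)) at 2; apply Rmult_le_compat_l; [now apply pow_le|].
rewrite <- (pow1 (l - k)); now apply pow_incr.
Qed.

Lemma pdisc_mono c r s z : r <= s -> pdisc c r z -> pdisc c s z.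
Proof. intros h [h1 h2]; split; [easy|now apply disc_mono with (2 := h2)]. Qed.

Lemma grows_mono d (h : C -> Ix d -> C) c k l : (k <= l)%nat -> grows d h c k -> grows d h c l.
Proof.
intros hkl (M & r & hr & H); exists M, (Rmin r 1); split; [apply Rmin_pos; lra|].
intros z hz i; eapply Rle_trans; [|apply (H z (pdisc_mono _ _ _ _ (Rmin_l _ _) hz) i)].
apply Rmult_le_compat_r; [apply Cmod_ge_0|]; apply pow_le_le1; [|easy].
split; [apply Cmod_ge_0|]; destruct (pdisc_mono _ _ _ _ (Rmin_r r 1) hz) as [_ k1]; unfold disc in k1; lra.
Qed.

Lemma grows_on_slice_mono d (h : C -> Ix d -> C) c I k l : (k <= l)%nat ->
  grows_on_slice d h c I k -> grows_on_slice d h c I l.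
Proof.
intros hkl (M & r & hr & H); exists M, (Rmin r 1); split; [apply Rmin_pos; lra|].
intros z hz; eapply Rle_trans; [|apply (H z (pdisc_mono _ _ _ _ (Rmin_l _ _) hz))].
apply Rmult_le_compat_r; [apply norm_ge_0|]; apply pow_le_le1; [|easy].
split; [apply Cmod_ge_0|]; destruct (pdisc_mono _ _ _ _ (Rmin_r r 1) hz) as [_ k1]; unfold disc in k1; lra.
Qed.

Lemma Rmult_le_swap a b c : 0 < a -> (a * b <= c <-> b <= / a * c).
Proof.
intros ha; split; intros h.
- apply Rmult_le_reg_l with a; [easy|]; now rewrite <- Rmult_assoc, Rinv_r, Rmult_1_l by lra.
- apply Rmult_le_reg_l with (/ a); [now apply Rinv_0_lt_compat|].
  now rewrite <- Rmult_assoc, Rinv_l, Rmult_1_l by lra.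
Qed.

Lemma pdisc_pow_pos c r z k : pdisc c r z -> 0 < Cmod (z - c) ^ k.
Proof. intros [h _]; now apply pow_lt, Cmod_ineq0, Csub_neq0. Qed.

Lemma grows_slice d (h : C -> Ix d -> C) c I k : (d <= 3)%nat -> imag_unit I ->
  grows d h c k -> grows_on_slice d h c I k.
Proof.
intros hd hI (M & r & hr & H); exists (2 * 2 ^ d * M), r; split; [easy|]; intros z hz.
assert (hp := pdisc_pow_pos c r z k hz); apply Rmult_le_swap; [easy|].
eapply Rle_trans; [apply norm_ev_le with (M := / (Cmod (z - c) ^ k) * M); auto|].
- intros i; apply Rmult_le_swap; auto.
- right; ring.
Qed.

Lemma grows_of_two_slices d (h : C -> Ix d -> C) c I I' k l : (d <= 3)%nat -> imag_unit I -> imag_unit I' ->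
  I <> I' -> grows_on_slice d h c I k -> grows_on_slice d h c I' l -> grows d h c (Nat.max k l).
Proof.
intros hd hI hI' hn h1 h2.
apply grows_on_slice_mono with (l := Nat.max k l) in h1; [|lia].
apply grows_on_slice_mono with (l := Nat.max k l) in h2; [|lia].
destruct h1 as (M & r & hr & H), h2 as (M' & r' & hr' & H').
destruct (ev_two_units d I I' hd hI hI' hn) as [K [hK HK]].
exists (K * Rmax M M'), (Rmin r r'); split; [now apply Rmin_pos|]; intros z hz i.
assert (hp := pdisc_pow_pos c _ z (Nat.max k l) hz); apply Rmult_le_swap; [easy|].
rewrite <- Rmult_assoc, (Rmult_comm _ K), Rmult_assoc; apply HK; apply Rmult_le_swap; try easy.
- eapply Rle_trans; [apply H, (pdisc_mono _ _ _ _ (Rmin_l _ _) hz)|apply Rmax_l].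
- eapply Rle_trans; [apply H', (pdisc_mono _ _ _ _ (Rmin_r _ _) hz)|apply Rmax_r].
Qed.

(* Near [c] the other factor [z - conj c] of [dlt c z] has modulus in [snd c, 3 snd c]. *)
Lemma conj_dist c z : 0 < snd c -> disc c (snd c) z -> snd c <= Cmod (z - Cconj c) <= 3 * snd c.
Proof.
intros hc hz; unfold disc in hz.
assert (e : Cmod (c - Cconj c) = 2 * snd c).
{ replace (c - Cconj c)%C with ((0, 2 * snd c) : C) by (apply injective_projections; simpl; ring).
  unfold Cmod; simpl; replace (0 * (0 * 1) + 2 * snd c * (2 * snd c * 1)) with (Rsqr (2 * snd c))
    by (unfold Rsqr; ring); apply sqrt_Rsqr; lra. }
split.
- generalize (Cmod_sub_trans c z (Cconj c)); rewrite (Cmod_sub_sym c z); lra.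
- generalize (Cmod_sub_trans z c (Cconj c)); lra.
Qed.

Lemma near_neq_conj c z : 0 < snd c -> disc c (snd c) z -> z <> Cconj c.
Proof.
intros hc hz ->; generalize (conj_dist c _ hc hz); rewrite Cmod_zero_sub; lra.
Qed.

Lemma Cmod_dlt c z : Cmod (dlt c z) = Cmod (z - c) * Cmod (z - Cconj c).
Proof. apply Cmod_mult. Qed.

(** * Series indexed by the integers *)

Lemma is_series_delta d (v : CD d) m : is_series (fun n => if Nat.eqb n m then v else zero) v.
Proof.
assert (z : is_series (fun _ : nat => (zero : CD d)) zero).
{ apply is_series_crd; intros i; rewrite crd_zero.
  apply is_series_of_geom_rem with 0 0; [lra|]; intros N.
  replace (sum_n _ N) with 0; [rewrite Rminus_0_r, Rabs_R0; lra|].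
  induction N as [|N IH]; [now rewrite sum_O|]; rewrite sum_Sn, <- IH; unfold plus; simpl; ring. }
induction m as [|m IH].
- apply (is_series_decr_1 (V := CD d)); simpl.
  replace (plus v (opp v)) with (zero : CD d); [exact z|change (zero = (v + - v)%cd); vec].
- apply (is_series_decr_1 (V := CD d)); simpl.
  refine (eq_rect _ (fun l => is_series _ l) IH _ _); change (v = (v + - zero)%cd); vec.
Qed.

Definition zset d (b : Z -> CD d) (n0 : Z) (v : CD d) (n : Z) : CD d := if Z.eqb n n0 then v else b n.

(** Only finitely many negative terms occur, so the two halves are one series started at -m. The
    induction replaces the lowest term by zero with [zset] and moves its value in or out of the
    limit by a series with a single term. *)
Lemma is_zseries_shift d (m : nat) : forall (b : Z -> CD d) l, (forall n, (n < - Z.of_nat m)%Z -> b n = zero) ->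
  (is_zseries b l <-> is_series (fun N => b (Z.of_nat N - Z.of_nat m)%Z) l).
Proof.
induction m as [|m IH]; intros b l hb.
- assert (z : is_series (fun n : nat => b (- Z.of_nat (S n))%Z) zero).
  { apply is_series_ext with (fun n => if Nat.eqb n 0 then zero else zero).
    - intros n; rewrite hb by lia; now destruct (Nat.eqb n 0).
    - apply is_series_delta. }
  split.
  + intros (l1 & l2 & h1 & h2 & ->).
    assert (e : l2 = zero).
    { apply crd_ext; intros i.
      rewrite <- (is_series_unique _ _ (proj1 (is_series_crd d _ _) h2 i)).
      apply (is_series_unique _ _ (proj1 (is_series_crd d _ _) z i)). }
    subst l2; replace (l1 + zero)%cd with l1 by vec.
    apply is_series_ext with (2 := h1); intros; f_equal; lia.
  + intros h; exists l, zero; split; [|split; [exact z|vec]].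
    apply is_series_ext with (2 := h); intros; f_equal; lia.
- set (n0 := (- Z.of_nat (S m))%Z); set (v := b n0); set (b' := zset d b n0 zero).
  assert (hb' : forall n, (n < - Z.of_nat m)%Z -> b' n = zero).
  { intros n hn; unfold b', zset; destruct (Z.eqb_spec n n0); [easy|]; apply hb; unfold n0 in *; lia. }
  assert (e1 : forall N, b' (Z.of_nat N - Z.of_nat m)%Z = b (Z.of_nat (S N) - Z.of_nat (S m))%Z).
  { intros N; unfold b', zset; destruct (Z.eqb_spec (Z.of_nat N - Z.of_nat m) n0);
      [unfold n0 in *; lia|f_equal; lia]. }
  assert (e2 : forall n : nat, b' (Z.of_nat n) = b (Z.of_nat n)).
  { intros n; unfold b', zset; destruct (Z.eqb_spec (Z.of_nat n) n0); [unfold n0 in *; lia|easy]. }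
  assert (e3 : forall n : nat, b (- Z.of_nat (S n))%Z =
    (b' (- Z.of_nat (S n))%Z + if Nat.eqb n m then v else zero)%cd).
  { intros n; unfold b', zset, v, n0; destruct (Nat.eqb_spec n m) as [->|hn].
    - rewrite Z.eqb_refl; vec.
    - destruct (Z.eqb_spec (- Z.of_nat (S n)) (- Z.of_nat (S m))); [lia|vec]. }
  assert (e4 : b (Z.of_nat 0 - Z.of_nat (S m))%Z = v) by (unfold v, n0; f_equal; lia).
  assert (k : is_series (fun N => b (Z.of_nat N - Z.of_nat (S m))%Z) l <->
              is_series (fun N => b' (Z.of_nat N - Z.of_nat m)%Z) (l - v)%cd).
  { split; intros h.
    - apply is_series_ext with (fun N => b (Z.of_nat (S N) - Z.of_nat (S m))%Z); [now intros; rewrite e1|].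
      apply (is_series_incr_1 (V := CD d) (fun N => b (Z.of_nat N - Z.of_nat (S m))%Z)).
      rewrite e4; refine (eq_rect _ (fun l => is_series _ l) h _ _).
      change (l = (l - v + v)%cd); vec.
    - apply (is_series_decr_1 (V := CD d)); rewrite e4.
      apply is_series_ext with (2 := h); intros; now rewrite e1. }
  rewrite k, <- (IH b' (l - v)%cd hb'); split; intros (l1 & l2 & h1 & h2 & e).
  + exists l1, (l2 - v)%cd; split; [|split].
    * apply is_series_ext with (2 := h1); intros; now rewrite e2.
    * apply is_series_ext with (2 := is_series_minus (V := CD d) _ _ _ _ h2 (is_series_delta d v m)).
      intros n; rewrite e3; set (w := if Nat.eqb n m then v else zero).
      change ((b' (- Z.of_nat (S n))%Z + w - w)%cd = b' (- Z.of_nat (S n))%Z); vec.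
    * subst l; vec.
  + exists l1, (l2 + v)%cd; split; [|split].
    * apply is_series_ext with (2 := h1); intros; now rewrite e2.
    * apply is_series_ext with (2 := is_series_plus (V := CD d) _ _ _ _ h2 (is_series_delta d v m)).
      intros n; now rewrite e3.
    * replace l with (l - v + v)%cd by vec; rewrite e; vec.
Qed.

Lemma is_zseries_ext d (a b : Z -> CD d) l : (forall n, a n = b n) -> is_zseries a l -> is_zseries b l.
Proof.
intros e (l1 & l2 & h1 & h2 & el); exists l1, l2; split; [|split; [|easy]].
- apply is_series_ext with (2 := h1); intros; apply e.
- apply is_series_ext with (2 := h2); intros; apply e.
Qed.

Lemma series_geom_norm_le d (b : nat -> CD d) l M : is_series b l ->
  (forall n, norm (b n) <= M * (/ 2) ^ n) -> norm l <= 2 ^ d * (2 * M).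
Proof.
intros h hb; apply norm_le_crd; intros i.
apply is_series_geom_le with (1 := proj1 (is_series_crd d b l) h i); intros n.
eapply Rle_trans; [apply abs_crd_le_norm|apply hb].
Qed.

Lemma series_norm_bounded d (b : nat -> CD d) l : is_series b l ->
  exists M, 0 <= M /\ forall n, norm (b n) <= M.
Proof.
intros h.
pose proof (fun i => series_terms_bounded _ _ (proj1 (is_series_crd d b l) h i)) as H.
clear h; assert (K : exists M, forall i n, Rabs (crd i (b n)) <= M).
{ clear l; induction d as [|d IH].
  - destruct (H tt) as [M HM]; exists M; now intros [].
  - destruct (IH (fun n => fst (b n)) (fun i => H (inl i))) as [M1 H1].
    destruct (IH (fun n => snd (b n)) (fun i => H (inr i))) as [M2 H2].
    exists (Rmax M1 M2); intros [i|i] n.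
    + eapply Rle_trans; [apply (H1 i n)|apply Rmax_l].
    + eapply Rle_trans; [apply (H2 i n)|apply Rmax_r]. }
destruct K as [M HM]; exists (2 ^ d * M).
assert (k : forall n, norm (b n) <= 2 ^ d * M) by (intros n; apply norm_le_crd; auto).
split; [|easy]; exact (Rle_trans _ _ _ (norm_ge_0 (b O)) (k O)).
Qed.

Lemma unit_neq_opp d (J : CD d) : (d <= 3)%nat -> imag_unit J -> J <> opp J.
Proof.
intros hd hJ e; assert (z : J = zero).
{ apply crd_ext; intros i; apply (f_equal (crd i)) in e; revert e; crd_simpl; lra. }
assert (k := norm_unit d J hd hJ); rewrite z, norm_zero in k; lra.
Qed.

(** Two units suffice, here [J] and [-J]; near [c] they give the values of the function around the
    two points of the sphere in C_J. *)
Lemma grows_of_all_slices d (h : C -> Ix d -> C) c k : (1 <= d <= 3)%nat ->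
  (forall I : CD d, imag_unit I -> grows_on_slice d h c I k) -> grows d h c k.
Proof.
intros hd H; destruct (unit_exists d) as [J hJ]; [lia|].
rewrite <- (Nat.max_id k); apply (grows_of_two_slices d h c J (opp J)); try lia; auto.
- now apply imag_unit_opp.
- apply unit_neq_opp; [lia|easy].
- now apply H, imag_unit_opp.
Qed.

Lemma sl_eq_nonreal d (I J : CD d) c w : (d <= 3)%nat -> imag_unit I -> imag_unit J -> 0 < snd c ->
  sl I c = sl J w -> (J = I /\ w = c) \/ (J = opp I /\ w = Cconj c).
Proof.
intros hd hI hJ hc e; assert (e2 := f_equal (@cd_im d) e); rewrite !cd_im_sl in e2 by easy.
destruct (sl_eq_cases d J I w c hd hJ hI (eq_sym e)) as [->| ->]; [left|right]; split; auto;
  apply crd_ext; intros i; apply (f_equal (crd i)) in e2; revert e2; simpl; crd_simpl; intros k; nra.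
Qed.

Lemma slice_sl d (J : CD d) x : slice J x <-> exists z, x = sl J z.
Proof.
split; [intros (a & b & ->); now exists (a, b)|intros [z ->]; now exists (fst z), (snd z)].
Qed.

Lemma slice_opp d (J x : CD d) : slice (opp J) x <-> slice J x.
Proof.
rewrite !slice_sl; split; intros [z ->]; exists (Cconj z).
- apply sl_opp.
- rewrite sl_opp, Cconj_conj; reflexivity.
Qed.

(** A point outside the slice of the centre has [sigma] at least |Im y|, so a shell of radius at
    most |Im y| contains none. *)
Lemma shell_sl d (I : CD d) c r x : (d <= 3)%nat -> imag_unit I -> 0 < snd c -> r <= snd c ->
  Shell (sl I c) 0 r x -> exists z, x = sl I z /\ pdisc c r z.
Proof.
intros hd hI hc hr; unfold Shell, tau, Defs.sigma.
destruct (excluded_middle_informative (same_slice x (sl I c))) as [(J & hJ & h1 & h2)|_]; intros [k1 k2].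
- apply slice_sl in h2 as [w e].
  assert (hx : slice I x).
  { destruct (sl_eq_nonreal d I J c w hd hI hJ hc e) as [[-> _]|[-> _]]; [easy|now apply slice_opp]. }
  apply slice_sl in hx as [z ->]; exists z; split; [easy|].
  rewrite sl_dist in k1, k2 by easy; split; [|exact k2].
  intros ->; rewrite Cmod_zero_sub in k1; lra.
- exfalso; rewrite norm_im_sl, (Rabs_pos_eq (snd c)) in k2 by (easy || lra).
  assert (k : snd c <= sqrt ((cd_re x - cd_re (sl I c)) ^ 2 + (norm (cd_im x) + snd c) ^ 2)).
  { rewrite <- (sqrt_Rsqr (snd c)) at 1 by lra; apply sqrt_le_1_alt; unfold Rsqr.
    generalize (norm_ge_0 (cd_im x)) (pow2_ge_0 (cd_re x - cd_re (sl I c))); nra. }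
  lra.
Qed.

Lemma sl_shell d (I : CD d) c r z : (d <= 3)%nat -> imag_unit I -> pdisc c r z -> Shell (sl I c) 0 r (sl I z).
Proof.
intros hd hI [h1 h2]; unfold Shell, tau, Defs.sigma.
destruct (excluded_middle_informative (same_slice (sl I z) (sl I c))) as [_|n].
- rewrite sl_dist by easy; split; [|exact h2]; now apply Cmod_ineq0, Csub_neq0.
- exfalso; apply n; exists I; split; [easy|]; split; apply slice_sl; eauto.
Qed.

Lemma setting_radius d Omt y f c Dt h : setting d Omt y f c Dt h ->
  exists r0, 0 < r0 <= snd c /\ forall z, disc c r0 z -> Dt z.
Proof.
intros S; assert (l := st_open S c (st_Dc S)).
apply locally_C_disc in l as [r [hr H]]; assert (hc := st_c S).
exists (Rmin r (snd c)); split.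
- split; [now apply Rmin_pos|apply Rmin_r].
- intros z hz; apply H; now apply disc_mono with (1 := Rmin_l r (snd c)).
Qed.

Lemma near_domain (c : C) (Dt : C -> Prop) r0 z : 0 < snd c -> 0 < r0 <= snd c ->
  (forall z, disc c r0 z -> Dt z) -> pdisc c r0 z -> Dt z /\ z <> c /\ z <> Cconj c.
Proof.
intros hc hr H [h1 h2]; split; [now apply H|]; split; [easy|].
apply near_neq_conj; [easy|apply disc_mono with (2 := h2); lra].
Qed.

Lemma off_sphere_sl d Omt y f c Dt h (I : CD d) z : setting d Omt y f c Dt h -> imag_unit I ->
  (off_sphere Omt y (sl I z) <-> Dt z /\ z <> c /\ z <> Cconj c).
Proof.
intros S hI; assert (hd := st_d S); unfold off_sphere.
rewrite (st_Om S I z hI), (st_sphere S); split.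
- intros [h1 h2]; split; [easy|]; split; intros ->; apply h2; [now exists I|].
  exists (opp I); split; [now apply imag_unit_opp|]; now rewrite sl_opp.
- intros (h1 & h2 & h3); split; [easy|]; intros (J & hJ & e).
  destruct (sl_eq_cases d I J z c ltac:(lia) hI hJ e); auto.
Qed.

(** * Expansions, bounds and extensions force growth bounds *)

Lemma series_slice_bound d (I : CD d) (a : nat -> CD d) (w0 : C) l0 : (d <= 3)%nat -> imag_unit I ->
  w0 <> 0%C -> is_series (fun n => sl I (w0 ^ n)%C * a n)%cd l0 ->
  exists M, 0 <= M /\ forall n, Cmod w0 ^ n * norm (a n) <= M.
Proof.
intros hd hI hw h; destruct (series_norm_bounded d _ _ h) as [M [hM H]].
exists M; split; [easy|]; intros n; specialize (H n).
now rewrite norm_sl_mul, Cmod_pow in H.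
Qed.

(** Multiplied by (z - c)^m the expansion is a power series on the slice. Convergence at one point
    bounds its terms there, and at half that distance it has a geometric majorant. *)
Lemma pole_bound_grows d Omt y f c Dt h (I : CD d) m : setting d Omt y f c Dt h -> imag_unit I ->
  pole_bound (off_sphere Omt y) f (sl I c) m -> grows_on_slice d h c I m.
Proof.
intros S hI (a & (r & hr & _ & H) & ha).
assert (hd := st_d S); assert (hc := st_c S).
destruct (setting_radius _ _ _ _ _ _ _ S) as (r0 & hr0 & HD).
assert (key : forall z, pdisc c (Rmin r r0) z ->
  is_series (fun N => sl I ((z - c) ^ N)%C * a (Z.of_nat N - Z.of_nat m)%Z)%cd
    (sl I ((z - c) ^ m)%C * ev I (h z))%cd).
{ intros z hz; assert (hz1 := pdisc_mono _ _ _ _ (Rmin_l _ _) hz).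
  assert (hz2 := pdisc_mono _ _ _ _ (Rmin_r _ _) hz).
  destruct (near_domain c Dt r0 z hc hr0 HD hz2) as (k1 & k2 & k3).
  pose proof (H (sl I z) (sl_shell d I c r z ltac:(lia) hI hz1)) as s.
  rewrite (st_f S I z hI k1 k2 k3) in s.
  apply (is_zseries_ext d _ (fun n => sl I (Czpow (z - c) n) * a n)%cd) in s;
    [|intros n; now apply bullet_mul_const].
  apply (is_zseries_shift d m) in s; [|intros n hn; rewrite ha by easy; apply cd_mul_0_r].
  apply (is_series_mul d (sl I ((z - c) ^ m)%C)) in s.
  apply is_series_ext with (2 := s); intros N.
  assert (hn := Csub_neq0 _ _ k2).
  rewrite sl_mulA, Czpow_shift, Cpow_inv by (easy || lia).
  f_equal; f_equal; field; now apply Cpow_nz. }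
assert (hp : 0 < Rmin r r0) by (apply Rmin_pos; lra).
set (w0 := RtoC (Rmin r r0 / 2)).
assert (hw0 : w0 <> 0%C) by (intros e; apply RtoC_inj in e; lra).
assert (mw0 : Cmod w0 = Rmin r r0 / 2) by (unfold w0; rewrite Cmod_R, Rabs_pos_eq; lra).
assert (ew : (c + w0 - c)%C = w0) by ring.
assert (hz0 : pdisc c (Rmin r r0) (c + w0)%C).
{ split; [intros e; apply hw0; rewrite <- ew, e; ring|unfold disc; rewrite ew; lra]. }
pose proof (key _ hz0) as s0; rewrite ew in s0.
destruct (series_slice_bound d I _ w0 _ ltac:(lia) hI hw0 s0) as [M [hM HM]].
(* The radius is half of |w0|, which produces the ratio 1/2. *)
exists (2 ^ d * (2 * M)), (Rmin r r0 / 4); split; [lra|]; intros z hz.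
pose proof (key z (pdisc_mono c (Rmin r r0 / 4) (Rmin r r0) z ltac:(lra) hz)) as s.
rewrite <- Cmod_pow, <- (norm_sl_mul d I) by (easy || lia).
apply series_geom_norm_le with (1 := s); intros n.
rewrite norm_sl_mul, Cmod_pow by (easy || lia).
apply Rle_trans with ((Cmod w0 * / 2) ^ n * norm (a (Z.of_nat n - Z.of_nat m)%Z)).
- apply Rmult_le_compat_r; [apply norm_ge_0|]; apply pow_incr; split; [apply Cmod_ge_0|].
  destruct hz as [_ hz]; unfold disc in hz; rewrite mw0; lra.
- rewrite Rpow_mult_distr, Rmult_assoc, (Rmult_comm ((/ 2) ^ n)), <- Rmult_assoc.
  apply Rmult_le_compat_r; [apply pow_le; lra|apply HM].
Qed.

(** The two expressions differ by |z - conj c|^k, which lies between positive constants near [c]. *)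
Lemma dlt_grows d (h : C -> Ix d -> C) c (I : CD d) k : 0 < snd c ->
  (grows_on_slice d h c I k <->
   exists M r, 0 < r /\ forall z, pdisc c r z -> Cmod (dlt c z) ^ k * norm (ev I (h z)) <= M).
Proof.
intros hc; split; intros (M & r & hr & H).
- exists ((3 * snd c) ^ k * M), (Rmin r (snd c)); split; [now apply Rmin_pos|]; intros z hz.
  assert (hz1 := pdisc_mono _ _ _ _ (Rmin_l _ _) hz).
  destruct (pdisc_mono _ _ _ _ (Rmin_r _ _) hz) as [_ hz2].
  destruct (conj_dist c z hc hz2) as [b1 b2].
  rewrite Cmod_dlt, Rpow_mult_distr, (Rmult_comm (Cmod (z - c) ^ k)), Rmult_assoc.
  apply Rmult_le_compat; [apply pow_le, Cmod_ge_0| | |now apply H].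
  + apply Rmult_le_pos; [apply pow_le, Cmod_ge_0|apply norm_ge_0].
  + apply pow_incr; split; [apply Cmod_ge_0|easy].
- exists (/ snd c ^ k * M), (Rmin r (snd c)); split; [now apply Rmin_pos|]; intros z hz.
  assert (hz1 := pdisc_mono _ _ _ _ (Rmin_l _ _) hz).
  destruct (pdisc_mono _ _ _ _ (Rmin_r _ _) hz) as [_ hz2].
  destruct (conj_dist c z hc hz2) as [b1 b2].
  apply (proj1 (Rmult_le_swap (snd c ^ k) _ _ ltac:(now apply pow_lt))).
  eapply Rle_trans; [|exact (H z hz1)]; rewrite Cmod_dlt, Rpow_mult_distr.
  replace (Cmod (z - c) ^ k * Cmod (z - Cconj c) ^ k * norm (ev I (h z)))
    with (Cmod (z - Cconj c) ^ k * (Cmod (z - c) ^ k * norm (ev I (h z)))) by ring.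
  apply Rmult_le_compat_r; [|apply pow_incr; lra].
  apply Rmult_le_pos; [apply pow_le, Cmod_ge_0|apply norm_ge_0].
Qed.

Lemma bounded_near_grows d Omt y f c Dt h (J I : CD d) k : setting d Omt y f c Dt h ->
  imag_unit J -> slice J y -> I = J \/ I = opp J ->
  (bounded_near (off_sphere Omt y) J y f k (sl I c) <-> grows_on_slice d h c I k).
Proof.
intros S hJ hy hI.
assert (hd := st_d S); assert (hc := st_c S).
assert (uI : imag_unit I) by (destruct hI as [->| ->]; [easy|now apply imag_unit_opp]).
assert (sI : forall x, slice J x <-> slice I x).
{ intros x; destruct hI as [->| ->]; [tauto|]; now rewrite slice_opp. }
(* In the coordinates of the unit [I] the point y is [c] or its conjugate; the product of the
   factors for y and y^c is [dlt c z] in both cases. *)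
assert (ey : exists c', y = sl I c' /\ (c' = c \/ c' = Cconj c)).
{ apply sI, slice_sl in hy as [c' e]; exists c'; split; [easy|].
  destruct (st_y S) as (Jy & hJy & e').
  destruct (sl_eq_cases d I Jy c' c ltac:(lia) uI hJy); auto; congruence. }
destruct ey as (c' & ey & hc').
assert (val : forall z, Dt z -> z <> c -> z <> Cconj c ->
  norm ((cd_pow (sl I z - y) k * cd_pow (sl I z - cd_conj y) k) * f (sl I z))%cd =
  Cmod (dlt c z) ^ k * norm (ev I (h z))).
{ intros z k1 k2 k3; rewrite (st_f S I z uI k1 k2 k3), ey.
  rewrite cd_conj_sl, !sl_minus, !cd_pow_sl, sl_mul, norm_sl_mul by (easy || lia).
  f_equal; rewrite <- Cmod_pow, <- Cpow_mult_l; f_equal; f_equal; unfold dlt.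
  destruct hc' as [->| ->]; [easy|rewrite Cconj_conj; ring]. }
destruct (setting_radius _ _ _ _ _ _ _ S) as (r0 & hr0 & HD).
rewrite dlt_grows by easy; split.
- intros [M HM]; apply locally_CD_norm in HM as (r & hr & H).
  exists M, (Rmin r r0); split; [apply Rmin_pos; lra|]; intros z hz.
  destruct (near_domain c Dt r0 z hc hr0 HD (pdisc_mono _ _ _ _ (Rmin_r _ _) hz)) as (k1 & k2 & k3).
  destruct (pdisc_mono _ _ _ _ (Rmin_l _ _) hz) as [_ hz1].
  rewrite <- val by easy; apply H; [now rewrite sl_dist by (easy || lia)|].
  split; [now apply (off_sphere_sl _ _ _ _ _ _ _ _ _ S uI)|apply sI, slice_sl; eauto].
- intros (M & r & hr & H); exists M; apply locally_CD_norm; exists r; split; [easy|].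
  intros x hx [h1 h2]; apply sI, slice_sl in h2 as [z ->].
  apply (off_sphere_sl _ _ _ _ _ _ _ _ _ S uI) in h1 as (k1 & k2 & k3).
  rewrite val by easy; apply H; split; [easy|].
  now rewrite sl_dist in hx by (easy || lia).
Qed.

Lemma cassini_u_sl d Omt y f c Dt h (I : CD d) z : setting d Omt y f c Dt h -> imag_unit I ->
  Defs.Delta y (sl I z) = sl I (dlt c z) /\ cassini_u (sl I z) y = sqrt (Cmod (dlt c z)).
Proof.
intros S hI; assert (hd := st_d S).
destruct (st_y S) as (J & hJ & ->).
assert (e : Defs.Delta (sl J c) (sl I z) = sl I (dlt c z)) by (apply Delta_sl; easy || lia).
split; [exact e|]; unfold cassini_u; now rewrite e, norm_sl by (easy || lia).
Qed.

Lemma sqrt_shell r t : 0 < r -> 0 < t < r ^ 2 -> 0 < sqrt t < r.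
Proof.
intros hr [h1 h2]; split; [now apply sqrt_lt_R0|].
rewrite <- (sqrt_pow2 r) by lra; now apply sqrt_lt_1_alt; split; [lra|].
Qed.

Lemma dlt_conj c z : dlt c (Cconj z) = Cconj (dlt c z).
Proof. unfold dlt; apply injective_projections; simpl; ring. Qed.

(* The coefficients are controlled by evaluating at [z0] and [conj z0], which have the same
   value of [dlt]. *)
Lemma spherical_grows d Omt y f c Dt h u v k0 : setting d Omt y f c Dt h ->
  spherical_laurent (off_sphere Omt y) f y u v ->
  (forall k : Z, (k < - Z.of_nat k0)%Z -> u k = zero /\ v k = zero) -> grows d h c k0.
Proof.
intros S (r2 & hr2 & _ & H & _) huv.
assert (hd := st_d S); assert (hd3 : (d <= 3)%nat) by lia.
assert (hc := st_c S).
apply grows_of_all_slices; [easy|]; intros I hI; apply dlt_grows; [easy|].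
set (u' := fun N => u (Z.of_nat N - Z.of_nat k0)%Z); set (v' := fun N => v (Z.of_nat N - Z.of_nat k0)%Z).
assert (key : forall z, Dt z -> z <> c -> z <> Cconj c -> Cmod (dlt c z) < r2 ^ 2 ->
  is_series (fun N => sl I (dlt c z ^ N)%C * (sl I z * u' N + v' N))%cd
    (sl I (dlt c z ^ k0)%C * ev I (h z))%cd).
{ intros z k1 k2 k3 k4.
  assert (hw : dlt c z <> 0%C) by (apply Cmult_neq_0; now apply Csub_neq0).
  destruct (cassini_u_sl _ _ _ _ _ _ _ I z S hI) as [e1 e2].
  pose proof (H (sl I z)) as s; unfold cassini_shell in s; rewrite e2 in s.
  specialize (s (sqrt_shell r2 _ hr2 (conj (Cmod_ineq0 _ hw) k4))).
  rewrite (st_f S I z hI k1 k2 k3) in s.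
  apply (is_zseries_ext d _ (fun n => sl I (Czpow (dlt c z) n) * (sl I z * u n + v n))%cd) in s;
    [|intros n; now rewrite e1, cd_zpow_sl].
  apply (is_zseries_shift d k0) in s.
  2:{ intros n hn; destruct (huv n hn) as [-> ->]; rewrite cd_mul_0_r.
      replace (zero + zero)%cd with (zero : CD d) by vec; apply cd_mul_0_r. }
  apply (is_series_mul d (sl I (dlt c z ^ k0)%C)) in s.
  apply is_series_ext with (2 := s); intros N.
  rewrite sl_mulA, Czpow_shift, Cpow_inv by (easy || lia).
  f_equal; f_equal; field; now apply Cpow_nz. }
destruct (setting_radius _ _ _ _ _ _ _ S) as (r0 & hr0 & HD).
set (b := snd c) in *; assert (hb : 0 < b) by exact hc.
(* The first bound keeps [z0] in the domain; 4 b s <= r2^2 puts it into the Cassini shell, because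
   [dlt] has the value s (2 b - s) there. *)
set (s := Rmin (r0 / 2) (r2 ^ 2 / (4 * b))).
assert (hs : 0 < s) by (apply Rmin_pos; [lra|apply Rdiv_lt_0_compat; [apply pow_lt|]; lra]).
assert (hs1 : s <= r0 / 2) by apply Rmin_l.
assert (hs2 : s * (4 * b) <= r2 ^ 2).
{ apply Rle_trans with (r2 ^ 2 / (4 * b) * (4 * b)); [apply Rmult_le_compat_r; [lra|apply Rmin_r]|].
  right; field; lra. }
(* Vertically below [c] the value of [dlt] is real, so [z0] and its conjugate share it; they are
   distinct since s < b. *)
set (z0 := (fst c, b - s) : C).
assert (ez0 : (z0 - c)%C = (0, - s)) by (apply injective_projections; simpl; fold b; ring).
assert (dz0 : disc c r0 z0).
{ unfold disc; rewrite ez0; eapply Rle_lt_trans; [apply Cmod_le_sum|]; simpl.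
  rewrite Rabs_R0, Rabs_Ropp, Rabs_pos_eq; lra. }
assert (nz0 : z0 <> c) by (intros e; apply (f_equal snd) in e; unfold z0 in e; simpl in e; fold b in e; lra).
destruct (near_domain c Dt r0 z0 hc hr0 HD (conj nz0 dz0)) as (k1 & k2 & k3).
assert (ew : dlt c z0 = RtoC (s * (2 * b - s))).
{ unfold dlt, z0; apply injective_projections; simpl; fold b; ring. }
assert (hw1 : 0 < s * (2 * b - s)) by (apply Rmult_lt_0_compat; lra).
assert (hw0 : dlt c z0 <> 0%C) by (intros e; rewrite ew in e; apply RtoC_inj in e; lra).
assert (mw0 : Cmod (dlt c z0) = s * (2 * b - s)) by (rewrite ew, Cmod_R, Rabs_pos_eq; lra).
assert (hw2 : Cmod (dlt c z0) < r2 ^ 2) by (rewrite mw0; nra).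
assert (ecz : dlt c (Cconj z0) = dlt c z0).
{ rewrite dlt_conj, ew; apply injective_projections; simpl; ring. }
assert (s1 := key z0 k1 k2 k3 hw2).
assert (s2 : is_series (fun N => sl I (dlt c z0 ^ N)%C * (sl I (Cconj z0) * u' N + v' N))%cd
    (sl I (dlt c (Cconj z0) ^ k0)%C * ev I (h (Cconj z0)))%cd).
{ pose proof (key (Cconj z0)) as s2; rewrite !ecz in s2; rewrite ecz; apply s2.
  - now apply (st_conj S).
  - intros e; apply k3; now rewrite <- e, Cconj_conj.
  - intros e; apply k2; now rewrite <- (Cconj_conj z0), e, Cconj_conj.
  - easy. }
destruct (series_slice_bound d I _ (dlt c z0) _ hd3 hI hw0 s1) as [M1 [hM1 H1]].
destruct (series_slice_bound d I _ (dlt c z0) _ hd3 hI hw0 s2) as [M2 [hM2 H2]].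
clear s1 s2; set (m0 := Cmod (dlt c z0)) in *.
set (Mu := (M1 + M2) / (2 * (b - s))).
assert (hMu : 0 <= Mu) by (apply Rle_mult_inv_pos; lra).
(* The terms of index [N] at the two points differ by (z0 - conj z0) u_N, up to the common power of
   [dlt], and |z0 - conj z0| = 2 (b - s). *)
assert (bu : forall N, m0 ^ N * norm (u' N) <= Mu).
{ intros N; specialize (H1 N); specialize (H2 N).
  assert (e : norm (sl I (z0 - Cconj z0)%C * u' N)%cd = 2 * (b - s) * norm (u' N)).
  { rewrite norm_sl_mul by easy; f_equal.
    replace (z0 - Cconj z0)%C with (Ci * RtoC (2 * (b - s)))%C
      by (unfold z0; apply injective_projections; simpl; ring).
    rewrite Cmod_mult, Cmod_Ci, Cmod_R, Rabs_pos_eq; lra. }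
  assert (t : norm (sl I (z0 - Cconj z0)%C * u' N)%cd <=
    norm (sl I z0 * u' N + v' N)%cd + norm (sl I (Cconj z0) * u' N + v' N)%cd).
  { replace (sl I (z0 - Cconj z0)%C * u' N)%cd
      with (sl I z0 * u' N + v' N - (sl I (Cconj z0) * u' N + v' N))%cd; [apply cd_norm_minus|].
    rewrite <- sl_minus, cd_mul_minus_l; vec. }
  rewrite e in t; assert (p : 0 < m0 ^ N) by (apply pow_lt; lra).
  apply Rmult_le_reg_l with (2 * (b - s)); [lra|].
  replace (2 * (b - s) * Mu) with (M1 + M2) by (unfold Mu; field; lra).
  nra. }
set (Mv := M1 + Cmod z0 * Mu).
assert (bv : forall N, m0 ^ N * norm (v' N) <= Mv).
{ intros N; specialize (H1 N); specialize (bu N).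
  assert (t : norm (v' N) <= norm (sl I z0 * u' N + v' N)%cd + Cmod z0 * norm (u' N)).
  { rewrite <- (norm_sl_mul d I) by easy.
    replace (v' N) with (sl I z0 * u' N + v' N - sl I z0 * u' N)%cd at 1 by vec; apply cd_norm_minus. }
  assert (p : 0 < m0 ^ N) by (apply pow_lt; lra).
  assert (q := Cmod_ge_0 z0); unfold Mv; nra. }
(* The radius m0 / (6 b) makes |dlt c z| at most m0 / 2, the other factor being at most 3 b; the
   terms then decay with ratio 1/2 relative to the bounds obtained at [z0]. *)
exists (2 ^ d * (2 * ((Cmod c + 1) * Mu + Mv))), (Rmin (Rmin r0 1) (m0 / (6 * b))); split.
{ repeat apply Rmin_pos; try lra; apply Rdiv_lt_0_compat; lra. }
intros z hz.
assert (hz1 := pdisc_mono _ _ _ _ (Rmin_l _ _) hz).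
assert (hz2 := pdisc_mono _ _ _ _ (Rmin_l _ _) hz1).
destruct (pdisc_mono _ _ _ _ (Rmin_r _ _) hz1) as [_ hz3].
destruct (pdisc_mono _ _ _ _ (Rmin_r _ _) hz) as [_ hz4].
unfold disc in hz3, hz4.
destruct (near_domain c Dt r0 z hc hr0 HD hz2) as (j1 & j2 & j3).
assert (hm : Cmod (dlt c z) <= m0 * / 2).
{ rewrite Cmod_dlt; destruct (conj_dist c z hc) as [_ b2].
  - destruct hz2 as [_ hz2]; apply disc_mono with (2 := hz2); fold b; lra.
  - apply Rle_trans with (m0 / (6 * b) * (3 * b)).
    + apply Rmult_le_compat; try apply Cmod_ge_0; [lra|exact b2].
    + right; field; lra. }
assert (hcz : Cmod z <= Cmod c + 1).
{ generalize (Cmod_triangle (z - c) c); replace (z - c + c)%C with z by ring; lra. }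
pose proof (key z j1 j2 j3 ltac:(lra)) as sz.
rewrite <- Cmod_pow, <- (norm_sl_mul d I) by easy.
apply series_geom_norm_le with (1 := sz); intros N.
rewrite norm_sl_mul, Cmod_pow by easy.
apply Rle_trans with ((m0 * / 2) ^ N * ((Cmod c + 1) * norm (u' N) + norm (v' N))).
- apply Rmult_le_compat; [apply pow_le, Cmod_ge_0|apply norm_ge_0| |].
  + apply pow_incr; split; [apply Cmod_ge_0|easy].
  + eapply Rle_trans; [exact (norm_triangle (V := CD d) _ _)|]; apply Rplus_le_compat_r.
    rewrite norm_sl_mul by easy; apply Rmult_le_compat_r; [apply norm_ge_0|easy].
- rewrite Rpow_mult_distr; specialize (bu N); specialize (bv N).
  replace (m0 ^ N * (/ 2) ^ N * ((Cmod c + 1) * norm (u' N) + norm (v' N)))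
    with (((Cmod c + 1) * (m0 ^ N * norm (u' N)) + m0 ^ N * norm (v' N)) * (/ 2) ^ N) by ring.
  apply Rmult_le_compat_r; [apply pow_le; lra|].
  apply Rplus_le_compat; [|easy]; apply Rmult_le_compat_l; [|easy].
  generalize (Cmod_ge_0 c); lra.
Qed.

Lemma bounded_on_neighbourhood_grows d Omt y f c Dt h (U : CD d -> Prop) k M : setting d Omt y f c Dt h ->
  (forall w, sphere y w -> locally w U) ->
  (forall x, U x -> ~ sphere y x -> norm (cd_pow (Defs.Delta y x) k * f x)%cd <= M) -> grows d h c k.
Proof.
intros S hU H; assert (hd := st_d S); assert (hc := st_c S).
apply grows_of_all_slices; [easy|]; intros I hI; apply dlt_grows; [easy|].
assert (l : locally (sl I c) U) by (apply hU, (st_sphere S); now exists I).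
apply locally_CD_norm in l as (r & hr & Hr).
destruct (setting_radius _ _ _ _ _ _ _ S) as (r0 & hr0 & HD).
exists M, (Rmin r r0); split; [apply Rmin_pos; lra|]; intros z hz.
destruct (near_domain c Dt r0 z hc hr0 HD (pdisc_mono _ _ _ _ (Rmin_r _ _) hz)) as (k1 & k2 & k3).
destruct (pdisc_mono _ _ _ _ (Rmin_l _ _) hz) as [_ hz1].
destruct (cassini_u_sl _ _ _ _ _ _ _ I z S hI) as [e1 _].
rewrite <- Cmod_pow, <- (norm_sl_mul d I), <- (st_f S I z hI k1 k2 k3) by (easy || lia).
rewrite <- cd_pow_sl, <- e1 by (easy || lia); apply H.
- apply Hr; now rewrite sl_dist by (easy || lia).
- apply (off_sphere_sl _ _ _ _ _ _ _ I z S hI); auto.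
Qed.

(** The index set is finite, so the constants of the coordinates are replaced by their maximum and
    the radii by their minimum. *)
Lemma Ix_uniform d (Q : Ix d -> R -> R -> Prop) :
  (forall i M M' r r', M <= M' -> r' <= r -> Q i M r -> Q i M' r') ->
  (forall i, exists M r, 0 < r /\ Q i M r) -> exists M r, 0 < r /\ forall i, Q i M r.
Proof.
induction d as [|d IH]; intros hm h.
- destruct (h tt) as (M & r & hr & H); exists M, r; split; [easy|]; now intros [].
- destruct (IH (fun i => Q (inl i))) as (M1 & r1 & h1 & H1); [intros i; apply hm|intros i; apply h|].
  destruct (IH (fun i => Q (inr i))) as (M2 & r2 & h2 & H2); [intros i; apply hm|intros i; apply h|].
  exists (Rmax M1 M2), (Rmin r1 r2); split; [now apply Rmin_pos|]; intros [i|i].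
  + apply hm with (3 := H1 i); [apply Rmax_l|apply Rmin_l].
  + apply hm with (3 := H2 i); [apply Rmax_r|apply Rmin_r].
Qed.

Lemma Ccont_family_bounded d (g : C -> Ix d -> C) c : (forall i, Ccont (fun z => g z i) c) ->
  exists M r, 0 < r /\ forall i z, disc c r z -> Cmod (g z i) <= M.
Proof.
intros h; apply (Ix_uniform d (fun i M r => forall z, disc c r z -> Cmod (g z i) <= M)).
- intros i M M' r r' h1 h2 H z hz; eapply Rle_trans; [apply H; now apply disc_mono with (2 := hz)|easy].
- intros i; destruct (Ccont_bound _ _ (h i)) as [r [hr H]]; eauto.
Qed.

(** A circular set containing one point of the sphere contains all of it; the stem function of the
    extension is continuous at [c] and bounds [f] on all slices at once. *)
Lemma removable_grows d Omt y f c Dt h (I : CD d) : setting d Omt y f c Dt h -> imag_unit I ->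
  removable (off_sphere Omt y) f (sl I c) -> grows d h c 0.
Proof.
intros S hI (_ & Om' & g & _ & _ & hw & hg & hext).
assert (hd := st_d S); assert (hc := st_c S).
destruct (slice_regular_hol d Om' g ltac:(lia) hg) as (D' & h' & _ & _ & hD' & hh & _ & hf').
assert (hDc : D' c) by (now apply (hD' I)).
destruct (Ccont_family_bounded d h' c (fun i => hol_cont _ _ c (hh i) hDc)) as (M & r & hr & HM).
destruct (setting_radius _ _ _ _ _ _ _ S) as (r0 & hr0 & HD).
apply grows_of_all_slices; [easy|]; intros J hJ.
exists (2 * 2 ^ d * M), (Rmin r r0); split; [apply Rmin_pos; lra|]; intros z hz.
destruct (near_domain c Dt r0 z hc hr0 HD (pdisc_mono _ _ _ _ (Rmin_r _ _) hz)) as (k1 & k2 & k3).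
destruct (pdisc_mono _ _ _ _ (Rmin_l _ _) hz) as [_ hz1].
assert (ho : off_sphere Omt y (sl J z)) by (apply (off_sphere_sl _ _ _ _ _ _ _ J z S hJ); auto).
simpl; rewrite Rmult_1_l, <- (st_f S J z hJ k1 k2 k3), <- (proj2 hext _ ho).
rewrite hf'; [|apply (hD' J z hJ); now apply (proj1 hext)|easy].
apply norm_ev_le; [lia|easy|]; intros i; now apply HM.
Qed.

(** * Extension across the sphere *)

(** [g] is the stem, in coordinates, of the extension of Delta^k f across the sphere. *)
Record extension d (c : C) (Dt : C -> Prop) (h : C -> Ix d -> C) (k : nat) (g : C -> Ix d -> C) : Prop := Extension {
  ext_hol : forall i, hol Dt (fun z => g z i);
  ext_sym : forall z i, Dt z -> g (Cconj z) i = Cconj (g z i);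
  ext_eq : forall z i, z <> c -> z <> Cconj c -> g z i = (dlt c z ^ k * h z i)%C
}.
Arguments ext_hol {d c Dt h k g} e.
Arguments ext_sym {d c Dt h k g} e.
Arguments ext_eq {d c Dt h k g} e.

Lemma open_avoid (Dt : C -> Prop) c z : open Dt -> Dt z -> z <> c -> z <> Cconj c ->
  exists r, 0 < r /\ forall w, disc z r w -> Dt w /\ w <> c /\ w <> Cconj c.
Proof.
intros ho hz h1 h2; assert (l := ho z hz); apply locally_C_disc in l as [r [hr H]].
exists (Rmin r (Rmin (Cmod (z - c)) (Cmod (z - Cconj c)))); split.
{ repeat apply Rmin_pos; auto; now apply Cmod_ineq0, Csub_neq0. }
intros w hw; assert (w1 := disc_mono _ _ _ _ (Rmin_l _ _) hw); assert (w2 := disc_mono _ _ _ _ (Rmin_r _ _) hw).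
assert (w3 := disc_mono _ _ _ _ (Rmin_l _ _) w2); assert (w4 := disc_mono _ _ _ _ (Rmin_r _ _) w2).
unfold disc in w3, w4; split; [auto|split; intros ->].
- rewrite Cmod_sub_sym in w3; lra.
- rewrite Cmod_sub_sym in w4; lra.
Qed.

Lemma hol_dlt U c k : hol U (fun z => dlt c z ^ k)%C.
Proof.
apply hol_pow; unfold dlt; apply hol_mult; apply hol_sub_const.
Qed.

Lemma extension_exists d Omt y f c Dt h k : setting d Omt y f c Dt h -> grows d h c k ->
  exists g, extension d c Dt h k g.
Proof.
intros S (M & r1 & hr1 & HM).
assert (hc := st_c S); assert (ho := st_open S).
assert (hDc := st_conj S).
destruct (setting_radius _ _ _ _ _ _ _ S) as (r0 & hr0 & HD).
set (r := Rmin r1 r0); assert (hr : 0 < r) by (apply Rmin_pos; lra).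
assert (hrr0 : r <= r0) by apply Rmin_r.
set (F := fun (i : Ix d) z => (dlt c z ^ k * h z i)%C).
assert (near : forall z, pdisc c r z -> Dt z /\ z <> c /\ z <> Cconj c).
{ intros z hz; apply (near_domain c Dt r0 z hc hr0 HD), (pdisc_mono _ _ _ _ hrr0 hz). }
assert (hF : forall i, hol (fun z => Dt z /\ z <> c /\ z <> Cconj c) (F i)).
{ intros i; apply hol_mult; [apply hol_dlt|apply (st_hol S)]. }
assert (rm : forall i, exists v, hol (disc c r) (fill (F i) c v)).
{ intros i; apply riemann with ((3 * snd c) ^ k * M); [easy|apply hol_sub with (2 := hF i); exact near|].
  intros z hz; unfold F; rewrite Cmod_mult, Cmod_pow, Cmod_dlt, Rpow_mult_distr.
  rewrite (Rmult_comm (Cmod (z - c) ^ k)), Rmult_assoc.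
  destruct (conj_dist c z hc) as [_ b2].
  { destruct hz as [_ hz]; apply disc_mono with (2 := hz); lra. }
  apply Rmult_le_compat.
  - apply pow_le, Cmod_ge_0.
  - apply Rmult_le_pos; [apply pow_le, Cmod_ge_0|apply Cmod_ge_0].
  - apply pow_incr; split; [apply Cmod_ge_0|easy].
  - apply HM, (pdisc_mono _ _ _ _ (Rmin_l _ _) hz). }
apply functional_choice_of in rm as [v hv].
assert (ncc : Cconj c <> c).
{ intros e; apply (f_equal snd) in e; simpl in e; lra. }
assert (symF : forall z i, Dt z -> z <> c -> z <> Cconj c -> F i (Cconj z) = Cconj (F i z)).
{ intros z i h1 h2 h3; unfold F.
  rewrite (st_sym S z i h1 h2 h3), dlt_conj, <- Cpow_conj, Cmult_conj; reflexivity. }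
(* Riemann's theorem supplies the value at [c]; the conjugate value is prescribed at [Cconj c], so
   that holomorphy there follows by reflection. *)
set (g := fun z i => fill (fill (F i) c (v i)) (Cconj c) (Cconj (v i)) z).
assert (gc : forall i, g c i = v i) by (intros i; unfold g; rewrite fill_off, fill_at; auto).
assert (gcc : forall i, g (Cconj c) i = Cconj (v i)) by (intros i; unfold g; now rewrite fill_at).
assert (gF : forall z i, z <> c -> z <> Cconj c -> g z i = F i z)
  by (intros z i h1 h2; unfold g; now rewrite !fill_off).
exists g; split.
- intros i; apply hol_local; intros z hz.
  destruct (Ceq_dec z c) as [->|n1]; [|destruct (Ceq_dec z (Cconj c)) as [->|n2]].
  + exists r; split; [easy|]; apply hol_ext with (fill (F i) c (v i)); [intros w; apply disc_open| |apply hv].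
    intros w hw; unfold g; rewrite (fill_off (fill (F i) c (v i))); [easy|].
    apply near_neq_conj; [easy|apply disc_mono with (2 := hw); lra].
  + exists r; split; [easy|].
    apply hol_ext with (fun w => Cconj (fill (F i) c (v i) (Cconj w)));
      [intros w; apply disc_open| |apply hol_reflect, hv].
    intros w hw; apply disc_conj in hw; destruct (Ceq_dec w (Cconj c)) as [->|n3].
    * rewrite Cconj_conj, fill_at, gcc; reflexivity.
    * assert (n4 : Cconj w <> c) by (intros e; apply n3; now rewrite <- e, Cconj_conj).
      destruct (near (Cconj w) (conj n4 hw)) as (j1 & j2 & j3).
      rewrite fill_off, <- symF, Cconj_conj by easy; symmetry; apply gF; [|easy].
      intros ->; now apply j3.
  + destruct (open_avoid Dt c z ho hz n1 n2) as (r' & hr' & H); exists r'; split; [easy|].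
    apply hol_ext with (F i); [intros w; apply disc_open| |].
    * intros w hw; destruct (H w hw) as (j1 & j2 & j3); symmetry; now apply gF.
    * apply hol_sub with (2 := hF i); exact H.
- intros z i hz; destruct (Ceq_dec z c) as [->|n1]; [now rewrite gcc, gc|].
  destruct (Ceq_dec z (Cconj c)) as [->|n2]; [now rewrite gcc, !Cconj_conj, gc|].
  rewrite !gF, symF; auto; intros e.
  + apply n2; now rewrite <- e, Cconj_conj.
  + apply n1; now rewrite <- (Cconj_conj z), e, Cconj_conj.
- exact gF.
Qed.

Lemma slice_decomp_sl d (x : CD d) : (1 <= d <= 3)%nat ->
  exists (J : CD d) (z : C), imag_unit J /\ 0 <= snd z /\ x = sl J z.
Proof.
intros hd; destruct (slice_decomp d x hd) as (J & b & hJ & hb & e); now exists J, (cd_re x, b).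
Qed.

Lemma slice_extension d Omt y f c Dt h k g : setting d Omt y f c Dt h -> extension d c Dt h k g ->
  exists G, slice_regular Omt G /\
    extends (off_sphere Omt y) (fun x => cd_pow (Defs.Delta y x) k * f x)%cd Omt G /\
    forall (I : CD d) z, imag_unit I -> Dt z -> G (sl I z) = ev I (g z).
Proof.
intros S E; assert (hd := st_d S); assert (hDc := st_conj S).
(* Outside [Dt] the stem is set to zero, because [induced_sl] asks for parity on the whole plane. *)
set (g0 := fun z i => if excluded_middle_informative (Dt z) then g z i else RtoC 0).
set (G := induced (fun z => mkc (fun i => fst (g0 z i))) (fun z => mkc (fun i => snd (g0 z i)))).
assert (sym0 : forall z i, g0 (Cconj z) i = Cconj (g0 z i)).
{ intros z i; unfold g0.
  destruct (excluded_middle_informative (Dt z)) as [k1|k1],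
    (excluded_middle_informative (Dt (Cconj z))) as [k2|k2].
  - now apply (ext_sym E).
  - now apply hDc in k1.
  - apply hDc in k2; now rewrite Cconj_conj in k2.
  - apply injective_projections; simpl; ring. }
assert (HG : forall (I : CD d) z, imag_unit I -> Dt z -> G (sl I z) = ev I (g z)).
{ intros I z hI hz; unfold G.
  rewrite (induced_sl d (fun z => mkc (fun i => fst (g0 z i))) (fun z => mkc (fun i => snd (g0 z i))) I z);
    [|lia|easy|].
  - apply ev_ext; intros i; unfold g0; now destruct (excluded_middle_informative (Dt z)).
  - intros w; split; apply crd_ext; intros i; crd_simpl; rewrite !crd_mkc, sym0; reflexivity. }
exists G; split; [|split; [split|exact HG]].
- apply slice_regular_of_hol with Dt g; try exact HG.
  + exists c; apply (st_Dc S).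
  + apply (st_open S).
  + exact hDc.
  + apply (st_Omega S).
  + apply (ext_hol E).
  + apply (ext_sym E).
  + intros I z hz hI; now apply HG.
- now intros x [hx _].
- intros x hx; destruct (slice_decomp_sl d x hd) as (I & z & hI & _ & ->).
  apply (off_sphere_sl _ _ _ _ _ _ _ I z S hI) in hx as (k1 & k2 & k3).
  destruct (cassini_u_sl _ _ _ _ _ _ _ I z S hI) as [e1 _].
  rewrite HG, (st_f S I z hI k1 k2 k3), e1, cd_pow_sl, ev_smul by (easy || lia).
  apply ev_ext; intros i; now apply (ext_eq E).
Qed.

(** * Laurent expansions, orders and limits read off from the extension *)

Lemma singularity_sphere d Omt y f c Dt h w : setting d Omt y f c Dt h -> sphere y w ->
  singularity (off_sphere Omt y) w.
Proof.
intros S hw; assert (hd := st_d S); assert (hc := st_c S).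
apply (st_sphere S) in hw as (I & hI & ->).
destruct (setting_radius _ _ _ _ _ _ _ S) as (r0 & hr0 & HD); exists r0; split; [lra|].
intros x hx; destruct (shell_sl d I c r0 x ltac:(lia) hI hc ltac:(lra) hx) as (z & -> & hz).
now apply (off_sphere_sl _ _ _ _ _ _ _ I z S hI), (near_domain c Dt r0 z hc hr0 HD).
Qed.

(** Off [c] the function (z - c)^k h equals (z - conj c)^(-k) g, which is holomorphic near [c]. Its
    Taylor coefficients, moved down by [k], are Laurent coefficients of [f] at [sl I c]; the lowest
    one is a left multiple of [ev I (g c)]. *)
Lemma laurent_exists d Omt y f c Dt h k g (I : CD d) : setting d Omt y f c Dt h ->
  extension d c Dt h k g -> imag_unit I ->
  exists a, laurent (off_sphere Omt y) f (sl I c) a /\ (forall n, (n < - Z.of_nat k)%Z -> a n = zero) /\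
    (ev I (g c) = zero -> a (- Z.of_nat k)%Z = zero).
Proof.
intros S E hI; assert (hd := st_d S); assert (hc := st_c S).
assert (hd3 : (d <= 3)%nat) by lia.
destruct (setting_radius _ _ _ _ _ _ _ S) as (r0 & hr0 & HD).
set (e := fun (i : Ix d) z => ((/ (z - Cconj c)) ^ k * g z i)%C).
assert (he : forall i, hol (disc c r0) (e i)).
{ intros i; apply hol_mult.
  - apply hol_pow, (hol_inv _ (fun z => z - Cconj c)%C); [|apply hol_sub_const].
    intros z hz; apply Csub_neq0, near_neq_conj; [easy|apply disc_mono with (2 := hz); lra].
  - apply hol_sub with (2 := ext_hol E i); exact HD. }
assert (tl := fun i => taylor (e i) c r0 ltac:(lra) (he i)).
apply functional_choice_of in tl as [A hA'].
assert (hA := fun i => proj1 (hA' i)); clear hA'.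
set (a := fun n => if Z.ltb n (- Z.of_nat k) then zero else ev I (fun i => A i (Z.to_nat (n + Z.of_nat k)))).
assert (ha : forall n, (n < - Z.of_nat k)%Z -> a n = zero).
{ intros n hn; unfold a; now rewrite (proj2 (Z.ltb_lt _ _) hn). }
assert (ha' : forall N, a (Z.of_nat N - Z.of_nat k)%Z = ev I (fun i => A i N)).
{ intros N; unfold a; destruct (Z.ltb_spec (Z.of_nat N - Z.of_nat k) (- Z.of_nat k)); [lia|].
  apply ev_ext; intros i; f_equal; lia. }
exists a; split; [|split; [exact ha|]].
- exists r0; split; [lra|]; split.
  + intros x hx; destruct (shell_sl d I c r0 x hd3 hI hc ltac:(lra) hx) as (z & -> & hz).
    now apply (off_sphere_sl _ _ _ _ _ _ _ I z S hI), (near_domain c Dt r0 z hc hr0 HD).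
  + intros x hx; destruct (shell_sl d I c r0 x hd3 hI hc ltac:(lra) hx) as (z & -> & hz).
    destruct (near_domain c Dt r0 z hc hr0 HD hz) as (k1 & k2 & k3).
    rewrite (st_f S I z hI k1 k2 k3).
    apply is_zseries_ext with (fun n => sl I (Czpow (z - c) n) * a n)%cd;
      [intros n; symmetry; now apply bullet_mul_const|].
    apply (is_zseries_shift d k); [intros n hn; rewrite ha by easy; apply cd_mul_0_r|].
    assert (hn := Csub_neq0 _ _ k2); assert (hn' := Csub_neq0 _ _ k3).
    apply is_series_ext with (fun N => ev I (fun i => (/ (z - c)) ^ k * (A i N * (z - c) ^ N))%C).
    { intros N; rewrite ha', Czpow_shift, ev_smul by easy; apply ev_ext; intros i; ring. }
    apply is_series_ev; intros i.
    replace (h z i) with ((/ (z - c)) ^ k * e i z)%C; [apply csum_scal, hA, hz|].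
    unfold e; rewrite (ext_eq E z i k2 k3); unfold dlt.
    rewrite Cpow_mult_l, !Cpow_inv by easy; field; split; now apply Cpow_nz.
- intros h0; replace (- Z.of_nat k)%Z with (Z.of_nat 0 - Z.of_nat k)%Z by lia; rewrite ha'.
  transitivity (sl I ((/ (c - Cconj c)) ^ k)%C * ev I (g c))%cd; [|rewrite h0; apply cd_mul_0_r].
  rewrite ev_smul by easy; apply ev_ext; intros i.
  symmetry; apply (taylor_coef0 (A i) c), hA, disc_center; lra.
Qed.

Lemma pole_bound_exists d Omt y f c Dt h k g (I : CD d) : setting d Omt y f c Dt h ->
  extension d c Dt h k g -> imag_unit I -> pole_bound (off_sphere Omt y) f (sl I c) k.
Proof.
intros S E hI; destruct (laurent_exists _ _ _ _ _ _ _ _ _ I S E hI) as (a & h1 & h2 & _).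
now exists a.
Qed.

Lemma pole_bound_pred d Omt y f c Dt h k g (I : CD d) : setting d Omt y f c Dt h ->
  extension d c Dt h (S k) g -> imag_unit I -> ev I (g c) = zero ->
  pole_bound (off_sphere Omt y) f (sl I c) k.
Proof.
intros S E hI h0; destruct (laurent_exists _ _ _ _ _ _ _ _ _ I S E hI) as (a & h1 & h2 & h3).
exists a; split; [easy|]; intros n hn; destruct (Z.eq_dec n (- Z.of_nat (Datatypes.S k))) as [->|hne].
- now apply h3.
- apply h2; lia.
Qed.

Lemma extension_lip d c Dt h k g : extension d c Dt h k g -> Dt c ->
  exists L r, 0 < r /\ forall i z, disc c r z -> Cmod (g z i - g c i) <= L * Cmod (z - c).
Proof.
intros E hc.
apply (Ix_uniform d (fun i L r => forall z, disc c r z -> Cmod (g z i - g c i) <= L * Cmod (z - c))).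
- intros i L L' r r' h1 h2 H z hz; eapply Rle_trans; [apply H; now apply disc_mono with (2 := hz)|].
  apply Rmult_le_compat_r; [apply Cmod_ge_0|easy].
- intros i; destruct (ext_hol E i) as [g' hg]; destruct (hg c hc) as [(q & _ & hq & e) _].
  destruct (Ccont_bound _ _ hq) as [r [hr H]]; exists (Cmod (q c) + 1), r; split; [easy|].
  intros z hz; rewrite (e z); replace (g c i + (z - c) * q z - g c i)%C with (q z * (z - c))%C by ring.
  rewrite Cmod_mult; apply Rmult_le_compat_r; [apply Cmod_ge_0|now apply H].
Qed.

Lemma real_small_zero x L r c : 0 < r -> 0 <= x -> (forall z, pdisc c r z -> x <= L * Cmod (z - c)) -> x = 0.
Proof.
intros hr hx H; assert (e : RtoC x = 0%C); [|now apply RtoC_inj in e].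
apply small_zero with L r; [easy|]; intros z h1 h2; rewrite Cmod_R, Rabs_pos_eq by easy.
assert (ez : (z + c - c)%C = z) by ring; rewrite <- ez; apply H; split.
- intros k; apply h1; rewrite <- ez, k; ring.
- unfold disc; now rewrite ez.
Qed.

Lemma ev_minus d (I : CD d) g h : (ev I g - ev I h = ev I (fun i => g i - h i)%C)%cd.
Proof.
transitivity (ev I g + scal (-1) (ev I h))%cd; [vec|].
replace (scal (-1) (ev I h)) with (ev I (fun i => - h i)%C); [apply ev_plus|].
unfold ev.
replace (mkc (fun i => fst (- h i)%C)) with (scal (-1) (mkc (fun i => fst (h i))))
  by (apply crd_ext; intros i; crd_simpl; rewrite !crd_mkc; simpl; ring).
replace (mkc (fun i => snd (- h i)%C)) with (scal (-1) (mkc (fun i => snd (h i))))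
  by (apply crd_ext; intros i; crd_simpl; rewrite !crd_mkc; simpl; ring).
rewrite cd_mul_scal_r; vec.
Qed.

(** Growth below [k] makes Delta^k f of order |z - c| on the slice, while it differs from
    [ev I (g c)] by another O(|z - c|); so this constant is O(|z - c|), hence zero. *)
Lemma low_growth_zero d Omt y f c Dt h k m g (I : CD d) : setting d Omt y f c Dt h ->
  extension d c Dt h k g -> imag_unit I -> grows_on_slice d h c I m -> (m < k)%nat ->
  ev I (g c) = zero.
Proof.
intros S E hI hm hk; assert (hd := st_d S); assert (hc := st_c S).
apply (grows_on_slice_mono d h c I m (k - 1)) in hm; [|lia].
destruct k as [|k]; [lia|]; replace (Datatypes.S k - 1)%nat with k in hm by lia.
destruct hm as (M & r & hr & HM).
destruct (extension_lip _ _ _ _ _ _ E (st_Dc S)) as (L & r' & hr' & HL).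
apply norm_eq0.
apply (real_small_zero _ (2 * 2 ^ d * L + (3 * snd c) ^ Datatypes.S k * M) (Rmin (Rmin r r') (snd c)) c);
  [repeat apply Rmin_pos; easy|apply norm_ge_0|].
intros z hz; assert (z1 := pdisc_mono _ _ _ _ (Rmin_l _ _) hz).
assert (z2 := pdisc_mono _ _ _ _ (Rmin_l _ _) z1); destruct (pdisc_mono _ _ _ _ (Rmin_r _ _) z1) as [_ z3].
destruct (pdisc_mono _ _ _ _ (Rmin_r _ _) hz) as [_ z4].
replace (ev I (g c)) with (ev I (g z) - (ev I (g z) - ev I (g c)))%cd by vec.
eapply Rle_trans; [apply cd_norm_minus|]; rewrite Rplus_comm, Rmult_plus_distr_r; apply Rplus_le_compat.
- rewrite ev_minus, Rmult_assoc; apply norm_ev_le; [lia|easy|]; intros i; now apply HL.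
- rewrite (ev_ext d I _ (fun i => dlt c z ^ Datatypes.S k * h z i)%C).
  2:{ intros i; apply (ext_eq E); [apply hz|now apply near_neq_conj]. }
  rewrite <- ev_smul, norm_sl_mul, Cmod_pow, Cmod_dlt, Rpow_mult_distr by (easy || lia).
  destruct (conj_dist c z hc z4) as [_ b2].
  replace (Cmod (z - c) ^ Datatypes.S k * Cmod (z - Cconj c) ^ Datatypes.S k * norm (ev I (h z)))
    with (Cmod (z - Cconj c) ^ Datatypes.S k * (Cmod (z - c) ^ k * norm (ev I (h z))) * Cmod (z - c))
    by (simpl; ring).
  apply Rmult_le_compat_r; [apply Cmod_ge_0|]; apply Rmult_le_compat.
  + apply pow_le, Cmod_ge_0.
  + apply Rmult_le_pos; [apply pow_le, Cmod_ge_0|apply norm_ge_0].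
  + apply pow_incr; split; [apply Cmod_ge_0|easy].
  + now apply HM.
Qed.

(** A zero at [c] gives g = O(|z - c|), and one factor |z - c| cancels. *)
Lemma zero_lowers_growth d Omt y f c Dt h k g : setting d Omt y f c Dt h ->
  extension d c Dt h (S k) g -> (forall i, g c i = 0%C) -> grows d h c k.
Proof.
intros S E h0; assert (hc := st_c S).
destruct (extension_lip _ _ _ _ _ _ E (st_Dc S)) as (L & r & hr & HL).
exists (/ (snd c) ^ Datatypes.S k * L), (Rmin r (snd c)); split; [now apply Rmin_pos|]; intros z hz i.
destruct (pdisc_mono _ _ _ _ (Rmin_l _ _) hz) as [z0 z1].
destruct (pdisc_mono _ _ _ _ (Rmin_r _ _) hz) as [_ z2].
specialize (HL i z z1); rewrite h0, (ext_eq E z i z0) in HL by (now apply near_neq_conj).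
replace (dlt c z ^ Datatypes.S k * h z i - 0)%C with (dlt c z ^ Datatypes.S k * h z i)%C in HL by ring.
rewrite Cmod_mult, Cmod_pow, Cmod_dlt, Rpow_mult_distr in HL.
destruct (conj_dist c z hc z2) as [b1 _]; assert (hp := Cmod_ineq0 _ (Csub_neq0 _ _ z0)).
apply (proj1 (Rmult_le_swap (snd c ^ Datatypes.S k) _ _ ltac:(now apply pow_lt))).
apply Rmult_le_reg_r with (Cmod (z - c)); [easy|]; eapply Rle_trans; [|exact HL].
replace (Cmod (z - c) ^ Datatypes.S k * Cmod (z - Cconj c) ^ Datatypes.S k * Cmod (h z i))
  with (Cmod (z - Cconj c) ^ Datatypes.S k * (Cmod (z - c) ^ k * Cmod (h z i)) * Cmod (z - c))
  by (simpl; ring).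
apply Rmult_le_compat_r; [lra|]; apply Rmult_le_compat_r; [|apply pow_incr; lra].
apply Rmult_le_pos; [apply pow_le; lra|apply Cmod_ge_0].
Qed.

Lemma nsq_re_im d (x : CD d) : (d <= 3)%nat -> nsq x = cd_re x ^ 2 + nsq (cd_im x).
Proof. intros hd; unfold cd_im, cd_real; cd_brute d hd; ring. Qed.

Lemma re_im_le_norm d (x : CD d) : (d <= 3)%nat -> Rabs (cd_re x) <= norm x /\ norm (cd_im x) <= norm x.
Proof.
intros hd; assert (e := nsq_re_im d x hd); rewrite !nsq_norm in e.
assert (h1 := norm_ge_0 x); assert (h2 := norm_ge_0 (cd_im x)).
split; [rewrite <- (Rabs_pos_eq (norm x)) by easy; apply Rsqr_le_abs_0; unfold Rsqr; nra|nra].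
Qed.

Lemma cd_im_minus d (x y : CD d) : (cd_im x - cd_im y = cd_im (x - y))%cd.
Proof.
unfold cd_im, cd_real; rewrite cd_minus_scal, (cd_minus_scal d x y), cd_re_plus, cd_re_scal; vec.
Qed.

Lemma cd_norm_sub_sym d (x y : CD d) : norm (x - y)%cd = norm (y - x)%cd.
Proof.
assert (e : (y - x)%cd = scal (-1) (x - y)%cd) by vec.
rewrite e, cd_norm_scal, Rabs_left by lra; ring.
Qed.

Lemma cd_norm_sub_ge d (x y : CD d) : norm x - norm y <= norm (x - y)%cd.
Proof.
assert (e : ((x - y) - (scal (-1) y))%cd = x) by vec.
generalize (cd_norm_minus d (x - y)%cd (scal (-1) y)); rewrite e, cd_norm_scal, Rabs_left by lra; lra.
Qed.

(** The limit is taken through all slices: x = sl I' z with [I'] near [I] and [z] near [c]. The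
    extension stays away from zero at x while Delta^k tends to zero. *)
Lemma pole_limit d Omt y f c Dt h k g (I : CD d) : setting d Omt y f c Dt h ->
  extension d c Dt h k g -> (0 < k)%nat -> imag_unit I -> ev I (g c) <> zero ->
  filterlim (fun x => norm (f x)) (within (off_sphere Omt y) (locally (sl I c))) (Rbar_locally p_infty).
Proof.
intros S E hk hI hne; assert (hd := st_d S); assert (hd3 : (d <= 3)%nat) by lia.
assert (hb := st_c S); set (b := snd c) in *.
destruct (extension_lip _ _ _ _ _ _ E (st_Dc S)) as (L & r & hr & HL).
set (e := norm (ev I (g c))).
assert (he : 0 < e).
{ destruct (Rle_lt_or_eq_dec 0 e (norm_ge_0 _)) as [h1|h1]; [easy|]; exfalso; now apply hne, norm_eq0. }
set (q := mkc (fun i => snd (g c i))).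
intros P [M HM]; apply locally_CD_norm.
(* [C1] collects two errors per unit of the distance [N] from x to the limit point: replacing [g z]
   by [g c], with |z - c| <= 2 N, and replacing [I'] by [I], with |I' - I| <= 2 N / b. *)
set (C1 := 2 * 2 ^ d * Rabs L * 2 + 2 / b * norm q + 1).
assert (hp2 : 0 < 2 ^ d) by (apply pow_lt; lra).
assert (hC1 : 0 < C1).
{ unfold C1; assert (0 <= 2 / b * norm q) by (apply Rmult_le_pos; [apply Rle_mult_inv_pos; lra|apply norm_ge_0]).
  assert (0 <= 2 * 2 ^ d * Rabs L) by (apply Rmult_le_pos; [lra|apply Rabs_pos]); lra. }
(* With this value, e / 2 <= t |f x| gives |f x| >= |M| + 1. *)
set (t := e / (2 * (Rabs M + 1))).
assert (hM := Rabs_pos M).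
assert (ht : 0 < t) by (apply Rdiv_lt_0_compat; lra).
(* The four bounds keep [z] where the Lipschitz estimate holds, the error at most e / 2, [z] within
   [b] of [c], and |dlt c z| below 1 and [t]. *)
set (del := Rmin (Rmin (r / 2) (e / (2 * C1))) (Rmin (b / 2) (Rmin 1 t / (6 * b)))).
assert (hdel : 0 < del).
{ unfold del; repeat apply Rmin_pos; try lra; apply Rdiv_lt_0_compat; try lra; apply Rmin_pos; lra. }
assert (d1 : del <= r / 2) by (eapply Rle_trans; [apply Rmin_l|apply Rmin_l]).
assert (d2 : del <= e / (2 * C1)) by (eapply Rle_trans; [apply Rmin_l|apply Rmin_r]).
assert (d3 : del <= b / 2) by (eapply Rle_trans; [apply Rmin_r|apply Rmin_l]).
assert (d4 : del <= Rmin 1 t / (6 * b)) by (eapply Rle_trans; [apply Rmin_r|apply Rmin_r]).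
exists del; split; [easy|]; intros x hx hO; apply HM.
destruct (slice_decomp_sl d x hd) as (I' & z & hI' & hz & ->).
apply (off_sphere_sl _ _ _ _ _ _ _ I' z S hI') in hO as (k1 & k2 & k3).
rewrite (st_f S I' z hI' k1 k2 k3).
destruct (re_im_le_norm d (sl I' z - sl I c)%cd hd3) as [n1 n2].
rewrite cd_minus_scal, cd_re_plus, cd_re_scal, !cd_re_sl, <- cd_minus_scal in n1 by easy.
rewrite <- cd_im_minus, !cd_im_sl in n2 by easy; fold b in n2.
set (N := norm (sl I' z - sl I c)%cd) in *.
assert (n3 : Rabs (snd z - b) <= N).
{ assert (e1 : norm (scal (snd z) I') = snd z) by (rewrite cd_norm_scal, norm_unit, Rabs_pos_eq by easy; ring).
  assert (e2 : norm (scal b I) = b) by (rewrite cd_norm_scal, norm_unit, Rabs_pos_eq by (easy || lra); ring).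
  assert (t1 := cd_norm_sub_ge d (scal (snd z) I') (scal b I)).
  assert (t2 := cd_norm_sub_ge d (scal b I) (scal (snd z) I')).
  rewrite (cd_norm_sub_sym d (scal b I)) in t2.
  rewrite e1, e2 in t1, t2; apply Rabs_le; lra. }
assert (hzc : Cmod (z - c) <= 2 * N).
{ eapply Rle_trans; [apply Cmod_le_sum|]; simpl; fold b.
  replace (fst z + -1 * fst c) with (fst z + - fst c) in n1 by ring; unfold Rminus in n3; lra. }
(* b (I' - I) is the difference of the imaginary parts minus (snd z - b) I', and each of the two has
   norm at most [N]. *)
assert (hII : norm (I' - I)%cd <= 2 / b * N).
{ replace (2 / b * N) with (/ b * (2 * N)) by (field; lra); apply Rmult_le_swap; [easy|].
  set (u := (I' - I)%cd : CD d).
  set (p := (scal (snd z) I' - scal b I)%cd : CD d); change (norm p <= N) in n2.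
  assert (eu : scal b u = (p - scal (snd z - b)%R I')%cd) by (unfold u, p; vec).
  assert (hu : norm (scal b u) <= 2 * N).
  { rewrite eu; eapply Rle_trans; [apply cd_norm_minus|].
    rewrite (cd_norm_scal d (snd z - b)), (norm_unit d I') by easy; lra. }
  rewrite cd_norm_scal, Rabs_pos_eq in hu by lra; exact hu. }
assert (hN : 0 <= N) by apply norm_ge_0.
assert (hdisc : disc c r z) by (unfold disc; lra).
assert (hval : e / 2 <= norm (ev I' (g z))).
{ assert (t1 : norm (ev I' (g z) - ev I' (g c))%cd <= 2 * 2 ^ d * (Rabs L * (2 * N))).
  { rewrite ev_minus; apply norm_ev_le; [easy|easy|]; intros i; eapply Rle_trans; [now apply HL|].
    apply Rle_trans with (Rabs L * Cmod (z - c)).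
    - apply Rmult_le_compat_r; [apply Cmod_ge_0|apply Rle_abs].
    - apply Rmult_le_compat_l; [apply Rabs_pos|easy]. }
  assert (t2 : norm (ev I' (g c) - ev I (g c))%cd <= 2 / b * N * norm q).
  { replace (ev I' (g c) - ev I (g c))%cd with ((I' - I) * q)%cd
      by (unfold ev; fold q; rewrite cd_mul_minus_l; vec).
    rewrite cd_norm_mul by easy; apply Rmult_le_compat_r; [apply norm_ge_0|easy]. }
  assert (t3 : C1 * N <= e / 2).
  { apply Rle_trans with (C1 * (e / (2 * C1))); [apply Rmult_le_compat_l; lra|right; field; lra]. }
  assert (t4 : e <= norm (ev I' (g z)) + norm (ev I' (g z) - ev I' (g c))%cd + norm (ev I' (g c) - ev I (g c))%cd).
  { unfold e.
    replace (ev I (g c)) with (ev I' (g z) - (ev I' (g z) - ev I' (g c)) - (ev I' (g c) - ev I (g c)))%cd at 1 by vec.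
    eapply Rle_trans; [apply cd_norm_minus|]; apply Rplus_le_compat_r; apply cd_norm_minus. }
  unfold C1 in t3; nra. }
destruct (conj_dist c z hb) as [b1 b2].
{ unfold disc; fold b; lra. }
fold b in b1, b2.
assert (hm : 0 < Cmod (dlt c z)) by (apply Cmod_ineq0, Cmult_neq_0; now apply Csub_neq0).
assert (hm1 : Cmod (dlt c z) < Rmin 1 t).
{ rewrite Cmod_dlt; apply Rle_lt_trans with (2 * N * (3 * b)).
  - apply Rmult_le_compat; try apply Cmod_ge_0; easy.
  - apply Rlt_le_trans with (Rmin 1 t / (6 * b) * (6 * b)); [nra|right; field; lra]. }
assert (hm2 := Rmin_l 1 t); assert (hm3 := Rmin_r 1 t).
rewrite (ev_ext d I' _ (fun i => dlt c z ^ k * h z i)%C) in hval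
  by (intros i; now apply (ext_eq E)).
rewrite <- ev_smul, norm_sl_mul, Cmod_pow in hval by easy.
assert (hpw : Cmod (dlt c z) ^ k <= t).
{ apply Rle_trans with (Cmod (dlt c z) ^ 1); [apply pow_le_le1; [lra|lia]|rewrite pow_1; lra]. }
assert (hf0 : 0 <= norm (ev I' (h z))) by apply norm_ge_0.
assert (hfin : e / 2 <= t * norm (ev I' (h z))).
{ eapply Rle_trans; [exact hval|now apply Rmult_le_compat_r]. }
apply Rlt_le_trans with (Rabs M + 1); [generalize (Rle_abs M); lra|].
apply Rmult_le_reg_l with t; [easy|]; eapply Rle_trans; [|exact hfin].
right; unfold t; field; lra.
Qed.

(** * The two branches of the inverse of [z |-> dlt c z] *)

(** The principal root by the half-angle formula, meant for arguments with positive real part. *)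
Definition csqrt (u : C) : C :=
  (sqrt ((Cmod u + fst u) / 2), snd u / (2 * sqrt ((Cmod u + fst u) / 2))).

Lemma csqrt_spec (u : C) : 0 < fst u -> 0 < fst (csqrt u) /\ (csqrt u * csqrt u = u)%C.
Proof.
intros hu; assert (hm : fst u <= Cmod u).
{ eapply Rle_trans; [apply Rle_abs|apply abs_fst_le_Cmod]. }
assert (hA : 0 < sqrt ((Cmod u + fst u) / 2)) by (apply sqrt_lt_R0; lra).
split; [exact hA|].
assert (hA2 : sqrt ((Cmod u + fst u) / 2) * sqrt ((Cmod u + fst u) / 2) = (Cmod u + fst u) / 2)
  by (apply sqrt_sqrt; lra).
assert (e : Cmod u * Cmod u = fst u * fst u + snd u * snd u).
{ unfold Cmod; rewrite sqrt_sqrt by nra; ring. }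
unfold csqrt; set (A := sqrt ((Cmod u + fst u) / 2)) in *; apply injective_projections; simpl.
- apply Rmult_eq_reg_l with (4 * (A * A)); [|nra].
  replace (4 * (A * A) * (A * A - snd u / (2 * A) * (snd u / (2 * A))))
    with (4 * (A * A) * (A * A) - snd u * snd u) by (field; lra).
  rewrite hA2; nra.
- field; lra.
Qed.

Lemma csqrt_conj (u : C) : csqrt (Cconj u) = Cconj (csqrt u).
Proof.
unfold csqrt; rewrite Cmod_conj; unfold Cconj; simpl; f_equal; unfold Rdiv; ring.
Qed.

Lemma sum_re_ge (p q : C) : 0 < fst p -> 0 < fst q -> fst q <= Cmod (p + q).
Proof.
intros hp hq; eapply Rle_trans; [|apply abs_fst_le_Cmod]; simpl; rewrite Rabs_pos_eq; lra.
Qed.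

(** Rationalising the difference provides continuity and a Caratheodory quotient at once; the
    denominator has positive real part. *)
Lemma csqrt_diff (u v : C) : 0 < fst u -> 0 < fst v ->
  (csqrt v + csqrt u <> 0 /\ csqrt v - csqrt u = (v - u) * / (csqrt v + csqrt u))%C.
Proof.
intros hu hv; destruct (csqrt_spec u hu) as [u1 u2], (csqrt_spec v hv) as [v1 v2].
assert (hn : (csqrt v + csqrt u)%C <> 0%C).
{ intros e; apply (f_equal fst) in e; simpl in e; simpl in u1, v1; lra. }
split; [easy|].
rewrite <- u2 at 2; rewrite <- v2 at 2; field; easy.
Qed.

Lemma right_half_plane_near u v : 0 < fst u -> disc u (fst u) v -> 0 < fst v.
Proof.
intros hu hv; unfold disc in hv; assert (k := abs_fst_le_Cmod (v - u)); simpl in k.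
unfold Rabs in k; destruct Rcase_abs in k; lra.
Qed.

Lemma csqrt_cont (u : C) : 0 < fst u -> Ccont csqrt u.
Proof.
intros hu; destruct (csqrt_spec u hu) as [u1 _].
apply Ccont_lip with (/ fst (csqrt u)) (fst u); [easy|left; now apply Rinv_0_lt_compat|]; intros v hv.
assert (hv' := right_half_plane_near u v hu hv).
destruct (csqrt_diff u v hu hv') as [hn ->]; destruct (csqrt_spec v hv') as [v1 _].
rewrite Cmod_mult, Cmod_inv, Rmult_comm by easy; apply Rmult_le_compat_r; [apply Cmod_ge_0|].
apply Rinv_le_contravar; [easy|now apply sum_re_ge].
Qed.

Lemma csqrt_cder (u : C) : 0 < fst u -> cder csqrt u (/ (csqrt u + csqrt u)).
Proof.
intros hu; apply cder_ext_loc with (fun v => csqrt u + (v - u) * / (csqrt v + csqrt u))%C.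
- exists (fst u); split; [easy|]; intros v hv; assert (hv' := right_half_plane_near u v hu hv).
  destruct (csqrt_diff u v hu hv') as [_ <-]; ring.
- exists (fun v => / (csqrt v + csqrt u))%C; split; [easy|split].
  + apply (Ccont_comp Cinv (fun v => csqrt v + csqrt u)%C).
    * apply Ccont_plus; [now apply csqrt_cont|apply Ccont_const].
    * apply Ccont_inv; now apply csqrt_diff.
  + intros v; ring.
Qed.

(** Since dlt c z = (z - a0)^2 + b0^2, solving dlt c z = w asks for a root of b0^2 - w, whose real
    part is positive for |w| < b0^2. *)
Definition rt (c w : C) : C := csqrt (RtoC (snd c ^ 2) - w).
(* The two solutions [z] of [dlt c z = w]; [e] is 1 or -1. *)
Definition br (c e w : C) : C := (RtoC (fst c) + e * (Ci * rt c w))%C.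

Lemma rt_dom (c w : C) : disc 0 (snd c ^ 2) w -> 0 < fst (RtoC (snd c ^ 2) - w)%C.
Proof.
unfold disc; replace (w - 0)%C with w by ring; intros h; assert (k := abs_fst_le_Cmod w); simpl.
unfold Rabs in k; destruct Rcase_abs in k; simpl in h; lra.
Qed.

Lemma rt_spec (c w : C) : disc 0 (snd c ^ 2) w ->
  0 < fst (rt c w) /\ (rt c w * rt c w = RtoC (snd c ^ 2) - w)%C /\ rt c w <> 0%C.
Proof.
intros h; destruct (csqrt_spec _ (rt_dom c w h)) as [h1 h2]; split; [exact h1|split; [exact h2|]].
intros e; unfold rt in e; rewrite e in h1; simpl in h1; lra.
Qed.

Lemma rt_conj (c w : C) : rt c (Cconj w) = Cconj (rt c w).
Proof.
unfold rt; rewrite <- csqrt_conj; f_equal; apply injective_projections; simpl; ring.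
Qed.

Lemma rt_cder (c w : C) : disc 0 (snd c ^ 2) w -> cder (rt c) w (- / (2 * rt c w)).
Proof.
intros h; unfold rt.
apply cder_eq with ((0 + (0 * w + RtoC (-1) * 1)) * / (csqrt (RtoC (snd c ^ 2) - w) + csqrt (RtoC (snd c ^ 2) - w)))%C.
- apply cder_ext_loc with (fun w => csqrt (RtoC (snd c ^ 2) + RtoC (-1) * w)%C).
  + exists 1; split; [lra|]; intros; f_equal; ring.
  + apply (cder_comp csqrt (fun w => RtoC (snd c ^ 2) + RtoC (-1) * w)%C).
    * apply cder_plus; [apply cder_const|]; apply cder_mult; [apply cder_const|apply cder_id].
    * replace (RtoC (snd c ^ 2) + RtoC (-1) * w)%C with (RtoC (snd c ^ 2) - w)%C by ring.
      apply csqrt_cder, rt_dom, h.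
- destruct (rt_spec c w h) as (_ & _ & hn); unfold rt in hn; set (q := csqrt _) in *.
  replace (q + q)%C with (2 * q)%C by ring; field; easy.
Qed.

Definition sign (e : C) : Prop := e = RtoC 1 \/ e = RtoC (-1).

Lemma sign_sq e : sign e -> (e * e = 1)%C.
Proof. intros [->| ->]; ring. Qed.

Lemma Ci_sq : (Ci * Ci = RtoC (-1))%C.
Proof. apply injective_projections; simpl; ring. Qed.

Lemma Ci_neq0 : Ci <> 0%C.
Proof. intros e; apply (f_equal snd) in e; simpl in e; lra. Qed.

Lemma dlt_alt (c z : C) : dlt c z = ((z - RtoC (fst c)) * (z - RtoC (fst c)) + RtoC (snd c ^ 2))%C.
Proof. unfold dlt; apply injective_projections; simpl; ring. Qed.

Lemma dlt_br (c e w : C) : sign e -> disc 0 (snd c ^ 2) w -> dlt c (br c e w) = w.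
Proof.
intros he hw; destruct (rt_spec c w hw) as (_ & h & _); rewrite dlt_alt; unfold br.
replace ((RtoC (fst c) + e * (Ci * rt c w) - RtoC (fst c)) * (RtoC (fst c) + e * (Ci * rt c w) - RtoC (fst c)))%C
  with (e * e * (Ci * Ci) * (rt c w * rt c w))%C by ring.
rewrite (sign_sq e he), Ci_sq, h; ring.
Qed.

Lemma br_conj (c w : C) : br c 1 (Cconj w) = Cconj (br c (-1) w) /\ br c (-1) (Cconj w) = Cconj (br c 1 w).
Proof. unfold br; rewrite rt_conj; split; apply injective_projections; simpl; ring. Qed.

(** The distances of [br c e w] to [c] and to [Cconj c] have product |w| < b0 r0. By the sign of the
    imaginary part the farther of the two points is at distance at least b0, so the nearer one is
    within [r0]. *)
Lemma br_domain (c : C) (Dt : C -> Prop) r0 e w : 0 < snd c -> 0 < r0 <= snd c -> conj_invariant Dt ->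
  (forall z, disc c r0 z -> Dt z) -> sign e -> disc 0 (snd c * r0) w -> Dt (br c e w).
Proof.
intros hc hr hD H he hw.
assert (hw2 : disc 0 (snd c ^ 2) w) by (apply disc_mono with (2 := hw); nra).
destruct (rt_spec c w hw2) as (h1 & _ & _).
assert (hm : Cmod (br c e w - c) * Cmod (br c e w - Cconj c) < snd c * r0).
{ rewrite <- Cmod_dlt, dlt_br by easy; unfold disc in hw; now replace (w - 0)%C with w in hw by ring. }
assert (near : forall p q, snd c <= p -> 0 <= q -> p * q < snd c * r0 -> q < r0) by (intros; nra).
destruct he as [->| ->].
- apply H; unfold disc; rewrite Rmult_comm in hm.
  apply (near (Cmod (br c 1 w - Cconj c))); [|apply Cmod_ge_0|easy].
  eapply Rle_trans; [|apply abs_snd_le_Cmod]; unfold br; revert h1; generalize (rt c w); intros s hs; simpl; rewrite Rabs_pos_eq; lra.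
- rewrite <- (Cconj_conj (br c _ w)); apply hD, H, disc_conj; unfold disc.
  apply (near (Cmod (br c (-1) w - c))); [|apply Cmod_ge_0|easy].
  eapply Rle_trans; [|apply abs_snd_le_Cmod]; unfold br; revert h1; generalize (rt c w); intros s hs; simpl; rewrite Rabs_left; lra.
Qed.

Lemma br_cder (c e w : C) : disc 0 (snd c ^ 2) w -> cder (br c e) w (e * / (2 * (Ci * rt c w))).
Proof.
intros hw; destruct (rt_spec c w hw) as (_ & _ & hn).
apply cder_eq with (0 + (0 * (Ci * rt c w) + e * (0 * rt c w + Ci * - / (2 * rt c w))))%C.
- apply (cder_plus (fun _ => RtoC (fst c)) (fun w => e * (Ci * rt c w))%C); [apply cder_const|].
  apply (cder_mult (fun _ => e) (fun w => Ci * rt c w)%C); [apply cder_const|].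
  apply (cder_mult (fun _ => Ci) (rt c)); [apply cder_const|now apply rt_cder].
- assert (hi := Ci_neq0); transitivity (e * (- (Ci * Ci)) * / (2 * (Ci * rt c w)))%C;
    [field; easy|rewrite Ci_sq; field; easy].
Qed.

Lemma rt_hol (c : C) : hol (disc 0 (snd c ^ 2)) (rt c).
Proof.
exists (fun w => - / (2 * rt c w))%C; intros w hw; split; [now apply rt_cder|].
destruct (rt_spec c w hw) as (_ & _ & hn).
apply Ccont_ext with (fun w => RtoC (-1) * / (2 * rt c w))%C; [exists 1; split; [lra|]; intros; ring|].
apply Ccont_mult; [apply Ccont_const|]; apply (Ccont_comp Cinv (fun w => 2 * rt c w)%C).
- apply Ccont_mult; [apply Ccont_const|exact (cder_cont _ _ _ (rt_cder c w hw))].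
- apply Ccont_inv, Cmult_neq_0; [intros k; apply RtoC_inj in k; lra|easy].
Qed.

Lemma br_hol (c e : C) : hol (disc 0 (snd c ^ 2)) (br c e).
Proof.
apply (hol_plus _ (fun _ => RtoC (fst c)) (fun w => e * (Ci * rt c w))%C); [apply hol_const|].
apply (hol_mult _ (fun _ => e) (fun w => Ci * rt c w)%C); [apply hol_const|].
apply (hol_mult _ (fun _ => Ci) (rt c)); [apply hol_const|apply rt_hol].
Qed.

Lemma br_surj (c z : C) : disc 0 (snd c ^ 2) (dlt c z) -> exists e, sign e /\ z = br c e (dlt c z).
Proof.
intros hw; destruct (rt_spec c _ hw) as (_ & h & _); set (s := rt c (dlt c z)) in *.
assert (k : ((z - RtoC (fst c) - Ci * s) * (z - RtoC (fst c) + Ci * s) = 0)%C).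
{ transitivity ((z - RtoC (fst c)) * (z - RtoC (fst c)) - (Ci * Ci) * (s * s))%C; [ring|].
  rewrite h, Ci_sq, dlt_alt; ring. }
destruct (Ceq_dec (z - RtoC (fst c) - Ci * s) 0) as [k1|k1].
- exists (RtoC 1); split; [now left|]; unfold br; fold s.
  transitivity (z - RtoC (fst c) - Ci * s + (RtoC (fst c) + Ci * s))%C; [ring|rewrite k1; ring].
- destruct (Ceq_dec (z - RtoC (fst c) + Ci * s) 0) as [k2|k2]; [|now apply Cmult_neq_0 in k].
  exists (RtoC (-1)); split; [now right|]; unfold br; fold s.
  transitivity (z - RtoC (fst c) + Ci * s + (RtoC (fst c) - Ci * s))%C; [ring|rewrite k2; ring].
Qed.

(** The conjugated coefficients expand the same function, so uniqueness makes them real. Reality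
    lets one element of the algebra serve as coefficient on every slice, by [ev_real]. *)
Lemma taylor_real phi r : 0 < r -> hol (disc 0 r) phi ->
  (forall w, disc 0 r w -> phi (Cconj w) = Cconj (phi w)) -> exists A : nat -> R,
  (forall w, disc 0 r w -> csum (fun n => RtoC (A n) * w ^ n)%C (phi w)) /\
  (forall rho n, 0 < rho < r -> circ_coef phi 0 rho n = (RtoC (2 * PI) * RtoC rho ^ n * RtoC (A n))%C).
Proof.
intros hr hphi hs; destruct (taylor phi 0 r hr hphi) as [a [h1 h2]].
assert (h1' : forall w, Cmod w < r -> csum (fun n => a n * w ^ n)%C (phi w)).
{ intros w hw; assert (e : (w - 0)%C = w) by ring.
  pose proof (h1 w) as k; unfold disc in k; rewrite e in k; auto. }
assert (ha : forall n, a n = RtoC (fst (a n))).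
{ intros n; assert (e : a n = Cconj (a n)).
  { apply (psum_unique a (fun n => Cconj (a n)) r phi hr).
    - intros w _ hw; now apply h1'.
    - intros w _ hw; replace (phi w) with (Cconj (phi (Cconj w))).
      + assert (hw' : Cmod (Cconj w) < r) by now rewrite Cmod_conj.
        apply csum_ext with (2 := csum_conj _ _ (h1' _ hw')); intros m.
        now rewrite Cmult_conj, <- Cpow_conj, Cconj_conj.
      + rewrite hs, Cconj_conj; [easy|]; unfold disc; now replace (w - 0)%C with w by ring. }
  apply (f_equal snd) in e; simpl in e; apply injective_projections; simpl; lra. }
exists (fun n => fst (a n)); split.
- intros w hw; apply csum_ext with (2 := h1 w hw); intros n; rewrite <- ha.
  now replace (w - 0)%C with w by ring.
- intros rho n hrho; rewrite <- ha; now apply h2.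
Qed.

(** The part of the contour integrand that depends on w = dlt c z alone: i w from dw, the power of
    exponent -q - 1, and w^(-k) from h = w^(-k) g. *)
Definition moment_kernel (k : nat) (q : Z) (w : C) : C := (Ci * w * Czpow w (- q - 1) * (/ w) ^ k)%C.

(** The kernel is i w^(-q - k). For q < -k this is a positive power and the integral vanishes by
    [circ_coef_neg]; otherwise the Taylor coefficient of index q + k is extracted. *)
Lemma circle_moment phi r R0 k q (A : nat -> R) : hol (disc 0 r) phi -> 0 < R0 < r ->
  (forall rho n, 0 < rho < r -> circ_coef phi 0 rho n = (RtoC (2 * PI) * RtoC rho ^ n * RtoC (A n))%C) ->
  cI (fun t => moment_kernel k q (csc R0 (cis t)) * phi (csc R0 (cis t)))%C 0 (2 * PI) =
  (RtoC (2 * PI) * Ci * RtoC (if Z.ltb q (- Z.of_nat k) then 0 else A (Z.to_nat (q + Z.of_nat k))))%C.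
Proof.
intros hphi hR hA.
assert (hR0 : RtoC R0 <> 0%C) by (intros e; apply RtoC_inj in e; lra).
assert (hw : forall t, csc R0 (cis t) <> 0%C).
{ intros t; apply Cmult_neq_0; [easy|apply cis_neq0]. }
assert (cphi : forall t, rcont (fun t => phi (0 + csc R0 (cis t)))%C t)
  by (intros t; apply (rcont_circle phi 0 R0 r); [intros; now apply (hol_cont _ _ _ hphi)|easy]).
destruct (Z.ltb_spec q (- Z.of_nat k)) as [hq|hq].
- set (m := Z.to_nat (- q - 1 - Z.of_nat k)).
  rewrite (cI_ext _ (fun t => Ci * RtoC R0 ^ S m * (phi (0 + csc R0 (cis t)) * cis t ^ S m))%C).
  + rewrite cI_scal, (circ_coef_neg phi 0 r R0 m hphi hR); [ring|].
    intros t; apply rcont_mult; [apply cphi|apply rcont_pow, rcont_cis].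
  + intros t; replace (0 + csc R0 (cis t))%C with (csc R0 (cis t)) by ring.
    unfold moment_kernel; replace (- q - 1)%Z with (Z.of_nat (k + m) - Z.of_nat 0)%Z by (unfold m; lia).
    rewrite Czpow_shift by easy; assert (hwt := hw t); set (w := csc R0 (cis t)) in *.
    replace (Ci * RtoC R0 ^ S m * (phi w * cis t ^ S m))%C with (Ci * w ^ S m * phi w)%C
      by (unfold w, csc; rewrite Cpow_mult_l; ring).
    rewrite Cpow_add_r, !Cpow_inv by easy; assert (hk := Cpow_nz w k hwt); simpl; field; easy.
- set (n := Z.to_nat (q + Z.of_nat k)).
  rewrite (cI_ext _ (fun t => Ci * / RtoC R0 ^ n * (phi (0 + csc R0 (cis t)) * cis (- t) ^ n))%C).
  + rewrite cI_scal.
    * change (cI (fun t => phi (0 + csc R0 (cis t)) * cis (- t) ^ n)%C 0 (2 * PI)) with (circ_coef phi 0 R0 n).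
      rewrite hA by easy; assert (hn := Cpow_nz _ n hR0); field; easy.
    * intros t; apply rcont_mult; [apply cphi|apply rcont_pow, rcont_cis_opp].
  + intros t; replace (0 + csc R0 (cis t))%C with (csc R0 (cis t)) by ring.
    unfold moment_kernel; replace (- q - 1)%Z with (Z.of_nat k - Z.of_nat (S n))%Z by (unfold n; lia).
    rewrite Czpow_shift by easy; assert (hwt := hw t); set (w := csc R0 (cis t)) in *.
    replace (Ci * / RtoC R0 ^ n * (phi w * cis (- t) ^ n))%C with (Ci * / w ^ n * phi w)%C.
    * rewrite !Cpow_inv by easy; assert (hk := Cpow_nz w k hwt); assert (hn := Cpow_nz w n hwt).
      simpl; field; easy.
    * unfold w, csc; rewrite Cpow_mult_l, cis_opp, Cpow_inv by apply cis_neq0.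
      assert (h1 := Cpow_nz _ n hR0); assert (h2 := Cpow_nz _ n (cis_neq0 t)); field; easy.
Qed.

Lemma hol_Czpow q : hol (fun w : C => w <> 0%C) (fun w => Czpow w q).
Proof.
destruct q as [|p|p]; simpl; [apply hol_const|apply hol_pow, hol_id|].
apply hol_pow, (hol_inv _ (fun w => w)); [easy|apply hol_id].
Qed.

Lemma hol_moment_kernel k q : hol (fun w : C => w <> 0%C) (moment_kernel k q).
Proof.
apply hol_mult; [apply hol_mult; [apply hol_mult; [apply hol_const|apply hol_id]|apply hol_Czpow]|].
apply hol_pow, (hol_inv _ (fun w => w)); [easy|apply hol_id].
Qed.

(* The divided difference of [m g] along the two branches: [m = 1] gives the coefficient of
   [x] and [m = z - 2 Re y] the constant one, because the branches add up to [2 Re y]. *)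
Definition branch_diff (c : C) (m g : C -> C) (w : C) : C :=
  ((m (br c 1 w) * g (br c 1 w) - m (br c (-1) w) * g (br c (-1) w)) * / (2 * (Ci * rt c w)))%C.

Lemma branch_denom (c w : C) : disc 0 (snd c ^ 2) w -> (2 * (Ci * rt c w))%C <> 0%C.
Proof.
intros hw; destruct (rt_spec c w hw) as (_ & _ & hn); apply Cmult_neq_0.
- intros k; apply RtoC_inj in k; lra.
- apply Cmult_neq_0; [apply Ci_neq0|easy].
Qed.

Lemma branch_diff_hol (c : C) (Dt : C -> Prop) m g r : r <= snd c ^ 2 -> hol Dt g -> hol (fun _ => True) m ->
  (forall e w, sign e -> disc 0 r w -> Dt (br c e w)) -> hol (disc 0 r) (branch_diff c m g).
Proof.
intros hr hg hm hin.
assert (hs : forall w, disc 0 r w -> disc 0 (snd c ^ 2) w) by (intros w; now apply disc_mono).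
assert (hb : forall e, hol (disc 0 r) (br c e)) by (intros e; apply hol_sub with (1 := hs), br_hol).
assert (hmg : forall e, sign e -> hol (disc 0 r) (fun w => m (br c e w) * g (br c e w))%C).
{ intros e he; apply hol_mult.
  - now apply (hol_comp (disc 0 r) (fun _ => True) m (br c e)).
  - apply (hol_comp (disc 0 r) Dt g (br c e)); auto. }
apply hol_mult.
- apply hol_minus; apply hmg; [now left|now right].
- apply (hol_inv _ (fun w => 2 * (Ci * rt c w))%C).
  + intros w hw; now apply branch_denom, hs.
  + apply hol_mult; [apply hol_const|]; apply hol_mult; [apply hol_const|].
    apply hol_sub with (1 := hs), rt_hol.
Qed.

(** Conjugation exchanges the two branches, and the signs of numerator and denominator change
    together. *)
Lemma branch_diff_conj (c : C) (Dt : C -> Prop) m g w : (forall z, m (Cconj z) = Cconj (m z)) ->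
  (forall z, Dt z -> g (Cconj z) = Cconj (g z)) -> (forall e, sign e -> Dt (br c e w)) ->
  disc 0 (snd c ^ 2) w -> branch_diff c m g (Cconj w) = Cconj (branch_diff c m g w).
Proof.
intros hm hg hin hw; unfold branch_diff; destruct (br_conj c w) as [-> ->].
rewrite !hm, !hg, rt_conj by (apply hin; (now left) || now right).
destruct (rt_spec c w hw) as (_ & _ & hn).
assert (hnc : Cconj (rt c w) <> 0%C).
{ intros k; apply hn; rewrite <- (Cconj_conj (rt c w)), k; apply injective_projections; simpl; ring. }
rewrite Cmult_conj, Cinv_conj by now apply branch_denom.
rewrite !Cmult_conj.
assert (e1 : Cconj Ci = (- Ci)%C) by (apply injective_projections; simpl; ring).
assert (e2 : Cconj 2 = RtoC 2) by (apply injective_projections; simpl; ring).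
rewrite e1, e2; set (s := Cconj (rt c w)) in *; assert (hi := Ci_neq0).
replace (Cconj (m (br c 1 w) * g (br c 1 w) - m (br c (-1) w) * g (br c (-1) w)))%C
  with (Cconj (m (br c 1 w)) * Cconj (g (br c 1 w)) - Cconj (m (br c (-1) w)) * Cconj (g (br c (-1) w)))%C
  by (rewrite <- !Cmult_conj; apply injective_projections; simpl; ring).
field; split; easy.
Qed.

Lemma rder_circle R0 t : rder (fun t => csc R0 (cis t)) t (Ci * csc R0 (cis t))%C.
Proof. split; simpl; auto_derive; try easy; ring. Qed.

Definition zcoef d (k : nat) (A : Ix d -> nat -> R) (q : Z) : CD d :=
  mkc (fun i => if Z.ltb q (- Z.of_nat k) then 0 else A i (Z.to_nat (q + Z.of_nat k))).

(* On [C_J] the integrand is [ev J] of a family of complex functions; adding both branches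
   turns [dzeta] into [dw] times a divided difference. *)
Lemma cassini_coef d Omt y f c Dt h k g m r0 A (J : CD d) (H : CD d -> CD d) r q :
  setting d Omt y f c Dt h -> extension d c Dt h k g ->
  hol (fun _ => True) m -> 0 < r0 <= snd c -> (forall z, disc c r0 z -> Dt z) ->
  (forall i rho n, 0 < rho < snd c * r0 ->
    circ_coef (branch_diff c m (fun z => g z i)) 0 rho n = (RtoC (2 * PI) * RtoC rho ^ n * RtoC (A i n))%C) ->
  imag_unit J -> 0 < r -> r ^ 2 < snd c * r0 ->
  (forall z, Dt z -> z <> c -> z <> Cconj c ->
    H (sl J z) = ev J (fun i => m z * (Czpow (dlt c z) (- q - 1) * h z i))%C) ->
  is_cassini_coef J y r H (zcoef d k A q).
Proof.
intros S E hm hr0 HD hA hJ hr hr2 hH.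
assert (hd := st_d S); assert (hd3 : (d <= 3)%nat) by lia.
assert (hc := st_c S); assert (hDc := st_conj S).
set (rho := snd c * r0) in *; assert (hrho : rho <= snd c ^ 2) by (unfold rho; nra).
set (R0 := r ^ 2) in *; assert (hR0 : 0 < R0) by (apply pow_lt; easy).
assert (s1 : sign 1) by now left.
assert (s2 : sign (-1)) by now right.
set (wt := fun t => csc R0 (cis t)).
assert (hwt : forall t, disc 0 rho (wt t)).
{ intros t; unfold disc, wt, csc; replace (RtoC R0 * cis t - 0)%C with (RtoC R0 * cis t)%C by ring.
  rewrite Cmod_mult, Cmod_cis, Cmod_R, Rabs_pos_eq; lra. }
assert (hwb : forall t, disc 0 (snd c ^ 2) (wt t)) by (intros t; now apply disc_mono with (2 := hwt t)).
assert (hw0 : forall t, wt t <> 0%C).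
{ intros t; apply Cmult_neq_0; [intros e; apply RtoC_inj in e; lra|apply cis_neq0]. }
assert (hin : forall e w, sign e -> disc 0 rho w -> Dt (br c e w))
  by (intros; now apply (br_domain c Dt r0)).
assert (hpt : forall e t, sign e -> Dt (br c e (wt t)) /\ br c e (wt t) <> c /\ br c e (wt t) <> Cconj c).
{ intros e t he; split; [now apply hin|]; split; intros k1; apply (hw0 t);
    rewrite <- (dlt_br c e (wt t) he (hwb t)), k1; unfold dlt; ring. }
(* The factor e / (2 i rt) is dz/dw along the branch [e]; adding both signs produces
   [branch_diff]. *)
set (Psi := fun e i w => (moment_kernel k q w * (e * (m (br c e w) * g (br c e w) i * / (2 * (Ci * rt c w)))))%C).
assert (cPsi : forall e i t, sign e -> rcont (fun t => Psi e i (wt t)) t).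
{ intros e i t he; apply rcont_comp; [exact (rder_cont _ _ _ (rder_circle R0 t))|].
  apply Ccont_mult; [exact (hol_cont _ _ _ (hol_moment_kernel k q) (hw0 t))|].
  assert (hs : forall w, disc 0 rho w -> disc 0 (snd c ^ 2) w) by (intros w; now apply disc_mono).
  assert (hb : hol (disc 0 rho) (br c e)) by apply (hol_sub _ _ _ hs), br_hol.
  apply (hol_cont (disc 0 rho)); [|apply hwt].
  apply hol_mult; [apply hol_const|]; apply hol_mult; [apply hol_mult|].
  - now apply (hol_comp (disc 0 rho) (fun _ => True) m (br c e)).
  - apply (hol_comp (disc 0 rho) Dt (fun z => g z i) (br c e)); auto; apply (ext_hol E).
  - apply (hol_inv _ (fun w => 2 * (Ci * rt c w))%C).
    + intros w hw; now apply branch_denom, hs.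
    + apply hol_mult; [apply hol_const|]; apply hol_mult; [apply hol_const|].
      apply hol_sub with (1 := hs), rt_hol. }
set (gam := fun e t => sl J (br c e (wt t))).
set (dgam := fun e t => sl J (Ci * wt t * (e * / (2 * (Ci * rt c (wt t)))))%C).
assert (hint : forall e, sign e -> is_RInt (fun t => dgam e t * H (gam e t))%cd 0 (2 * PI)
  (ev J (fun i => cI (fun t => Psi e i (wt t)) 0 (2 * PI)))).
{ intros e he; apply is_RInt_ext with (fun t => ev J (fun i => Psi e i (wt t))).
  2:{ apply (is_RInt_ev d J (fun t i => Psi e i (wt t))); intros i t; now apply cPsi. }
  intros t _; unfold dgam, gam; destruct (hpt e t he) as (k1 & k2 & k3).
  rewrite (hH _ k1 k2 k3), ev_smul by easy; apply ev_ext; intros i.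
  unfold Psi, moment_kernel; rewrite (ext_eq E _ i k2 k3), (dlt_br c e (wt t) he (hwb t)).
  rewrite Cpow_inv by easy; assert (hp := Cpow_nz _ k (hw0 t)).
  assert (hn := branch_denom c _ (hwb t)).
  set (s := (2 * (Ci * rt c (wt t)))%C) in *; field; easy. }
exists (ev J (fun i => cI (fun t => Psi 1 i (wt t)) 0 (2 * PI)) + ev J (fun i => cI (fun t => Psi (-1) i (wt t)) 0 (2 * PI)))%cd.
split.
- exists (gam 1), (gam (-1)), (dgam 1), (dgam (-1)), (ev J (fun i => cI (fun t => Psi 1 i (wt t)) 0 (2 * PI))),
    (ev J (fun i => cI (fun t => Psi (-1) i (wt t)) 0 (2 * PI))).
  split; [|split; [apply hint, s1|split; [apply hint, s2|reflexivity]]].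
  assert (hD : forall e t, sign e -> Defs.Delta y (gam e t) = slice_pt (r ^ 2 * cos t) (r ^ 2 * sin t) J).
  { intros e t he; unfold gam; rewrite (proj1 (cassini_u_sl _ _ _ _ _ _ _ J _ S hJ)), dlt_br by easy.
    unfold sl, wt, csc; simpl; f_equal; unfold R0; simpl; ring. }
  assert (hder : forall e t, is_derive (gam e) t (dgam e t)).
  { intros e t; apply is_derive_sl; apply (rder_comp (br c e) wt); [apply rder_circle|].
    apply br_cder, hwb. }
  intros t; split; [apply slice_sl; eexists; reflexivity|].
  split; [apply slice_sl; eexists; reflexivity|]; split; [|auto].
  intros e; apply sl_inj in e; [|easy|easy]; apply (branch_denom c _ (hwb t)).
  transitivity (br c 1 (wt t) - br c (-1) (wt t))%C; [unfold br; ring|rewrite e; ring].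
- rewrite ev_plus.
  rewrite (ev_ext d J _ (fun i => RtoC (2 * PI) * Ci * RtoC (crd i (zcoef d k A q)))%C).
  2:{ intros i; rewrite <- cI_plus by (intros; now apply cPsi).
      unfold zcoef; rewrite crd_mkc.
      rewrite <- (circle_moment (branch_diff c m (fun z => g z i)) rho R0 k q (A i)).
      - apply cI_ext; intros t; unfold Psi, branch_diff; fold (wt t); ring.
      - apply (branch_diff_hol c Dt); auto; apply (ext_hol E).
      - lra.
      - apply hA. }
  (* In the slice of [J] this is 2 PI i, which cancels the factor of [circle_moment] and leaves real
     coordinates. *)
  replace (scal (2 * PI)%R J) with (sl J (Ci * RtoC (2 * PI))%C)
    by (unfold sl, slice_pt, cd_real; apply crd_ext; intros i; crd_simpl; simpl; ring).
  rewrite cd_inv_sl, ev_smul by easy.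
  rewrite <- (ev_real d J (zcoef d k A q)) at 1; apply ev_ext; intros i.
  generalize PI_RGT_0; intros hpi; assert (hi := Ci_neq0).
  field; split; [intros e; apply RtoC_inj in e; lra|easy].
Qed.

Lemma zcoef_low d k A q : (q < - Z.of_nat k)%Z -> zcoef d k A q = zero.
Proof.
intros hq; apply crd_ext; intros i; unfold zcoef; rewrite crd_mkc, crd_zero.
now rewrite (proj2 (Z.ltb_lt _ _) hq).
Qed.

Lemma zcoef_shift d k A N : zcoef d k A (Z.of_nat N - Z.of_nat k) = mkc (fun i => A i N).
Proof.
apply crd_ext; intros i; unfold zcoef; rewrite !crd_mkc.
destruct (Z.ltb_spec (Z.of_nat N - Z.of_nat k) (- Z.of_nat k)); [lia|f_equal; lia].
Qed.

(** Linear interpolation: as the branches add up to 2 a0, the two divided differences are the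
    coefficients of the affine function through the values of [g] at the branches. *)
Lemma branch_recombine (c e w : C) g : sign e -> disc 0 (snd c ^ 2) w ->
  g (br c e w) = (br c e w * branch_diff c (fun _ => 1%C) g w +
    branch_diff c (fun z => z - RtoC (2 * fst c))%C g w)%C.
Proof.
intros he hw; assert (hn := branch_denom c w hw); unfold branch_diff.
destruct (rt_spec c w hw) as (_ & _ & hr); assert (hi := Ci_neq0).
assert (h2 : RtoC 2 <> 0%C) by (intros k; apply RtoC_inj in k; lra).
set (g1 := g (br c 1 w)); set (g2 := g (br c (-1) w)).
assert (hg : g (br c e w) = g1 \/ g (br c e w) = g2) by (destruct he as [->| ->]; auto).
rewrite RtoC_mult; destruct he as [->| ->]; unfold g1, g2, br; field; easy.
Qed.

Lemma spherical_exists d Omt y f c Dt h k g : setting d Omt y f c Dt h -> extension d c Dt h k g ->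
  exists u v, spherical_laurent (off_sphere Omt y) f y u v /\
    forall q, (q < - Z.of_nat k)%Z -> u q = zero /\ v q = zero.
Proof.
intros S E.
assert (hd := st_d S); assert (hd3 : (d <= 3)%nat) by lia.
assert (hc := st_c S); assert (hDc := st_conj S).
destruct (setting_radius _ _ _ _ _ _ _ S) as (r0 & hr0 & HD).
(* For |w| < b0 r0 both branches take values in [Dt], and r0 <= b0 keeps [w] where the root is
   holomorphic. *)
set (rho := snd c * r0); assert (hrho : 0 < rho <= snd c ^ 2) by (unfold rho; nra).
assert (hin : forall e w, sign e -> disc 0 rho w -> Dt (br c e w))
  by (intros; now apply (br_domain c Dt r0)).
set (m2 := fun z => (z - RtoC (2 * fst c))%C).
assert (hm1 : hol (fun _ => True) (fun _ => 1%C)) by apply hol_const.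
assert (hm2 : hol (fun _ => True) m2) by apply hol_sub_const.
assert (T : forall m, hol (fun _ => True) m -> (forall z, m (Cconj z) = Cconj (m z)) -> forall i, exists A : nat -> R,
  (forall w, disc 0 rho w -> csum (fun n => RtoC (A n) * w ^ n)%C (branch_diff c m (fun z => g z i) w)) /\
  (forall p n, 0 < p < rho -> circ_coef (branch_diff c m (fun z => g z i)) 0 p n =
    (RtoC (2 * PI) * RtoC p ^ n * RtoC (A n))%C)).
{ intros m hm hs i; apply taylor_real; [easy| |].
  - apply (branch_diff_hol c Dt); try easy; apply (ext_hol E).
  - intros w hw; apply (branch_diff_conj c Dt); auto.
    + intros z; apply (ext_sym E).
    + apply disc_mono with (2 := hw); lra. }
assert (T1 := T (fun _ => 1%C) hm1 ltac:(intros; apply injective_projections; simpl; ring)).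
assert (T2 := T m2 hm2 ltac:(intros; unfold m2; apply injective_projections; simpl; ring)).
apply functional_choice_of in T1 as [AU hU]; apply functional_choice_of in T2 as [AV hV].
clear T; exists (zcoef d k AU), (zcoef d k AV).
split; [|intros q hq; split; now apply zcoef_low].
assert (shell : forall (I : CD d) z, imag_unit I -> cassini_shell y 0 (sqrt rho) (sl I z) ->
  disc 0 rho (dlt c z) /\ dlt c z <> 0%C /\ (exists e, sign e /\ z = br c e (dlt c z)) /\ Dt z /\ z <> c /\ z <> Cconj c).
{ intros I z hI; unfold cassini_shell; rewrite (proj2 (cassini_u_sl _ _ _ _ _ _ _ I z S hI)).
  intros [h1 h2]; apply sqrt_lt_0_alt in h2.
  assert (hw : disc 0 rho (dlt c z)) by (unfold disc; now replace (dlt c z - 0)%C with (dlt c z) by ring).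
  assert (hw0 : dlt c z <> 0%C) by (intros k0; rewrite k0, Cmod_0, sqrt_0 in h1; lra).
  destruct (br_surj c z) as (e & he & ez); [apply disc_mono with (2 := hw); lra|].
  split; [easy|split; [easy|split; [now exists e|]]]; split; [rewrite ez; now apply hin|].
  split; intros ->; apply hw0; unfold dlt; ring. }
(* [cassini_u] is the square root of |Delta|, so the radius rho for [w] corresponds to the Cassini
   radius sqrt rho. *)
exists (sqrt rho); split; [now apply sqrt_lt_R0|]; split; [|split].
- intros x hx; destruct (slice_decomp_sl d x hd) as (I & z & hI & _ & ->).
  apply (off_sphere_sl _ _ _ _ _ _ _ I z S hI); now apply (shell I z hI).
- intros x hx; destruct (slice_decomp_sl d x hd) as (I & z & hI & _ & ->).
  destruct (shell I z hI hx) as (hw & hw0 & (e & he & ez) & k1 & k2 & k3); set (w := dlt c z) in *.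
  rewrite (st_f S I z hI k1 k2 k3), (proj1 (cassini_u_sl _ _ _ _ _ _ _ I z S hI)); fold w.
  apply is_zseries_ext with (fun q => sl I (Czpow w q) * (sl I z * zcoef d k AU q + zcoef d k AV q))%cd;
    [intros q; now rewrite cd_zpow_sl|].
  apply (is_zseries_shift d k).
  { intros q hq; rewrite !zcoef_low, cd_mul_0_r by easy.
    replace (zero + zero)%cd with (zero : CD d) by vec; apply cd_mul_0_r. }
  apply is_series_ext with (fun N => ev I (fun i =>
    (/ w) ^ k * (z * (RtoC (AU i N) * w ^ N) + RtoC (AV i N) * w ^ N))%C).
  { intros N; rewrite !zcoef_shift, Czpow_shift by easy.
    rewrite <- (ev_real d I (mkc (fun i => AU i N))), <- (ev_real d I (mkc (fun i => AV i N))).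
    rewrite ev_smul, ev_plus, ev_smul by easy; apply ev_ext; intros i; rewrite !crd_mkc; ring. }
  apply is_series_ev; intros i.
  (* The point [z] is one of the two branches over its own [w], so interpolation returns the value
     of [g] at [z]. *)
  assert (hh : h z i = ((/ w) ^ k * (z * branch_diff c (fun _ => 1%C) (fun z => g z i) w +
    branch_diff c m2 (fun z => g z i) w))%C).
  { rewrite ez at 2; unfold m2; rewrite <- (branch_recombine c e w (fun z => g z i) he), <- ez
      by (apply disc_mono with (2 := hw); lra).
    rewrite (ext_eq E z i k2 k3); fold w; rewrite Cpow_inv by easy.
    assert (hp := Cpow_nz _ k hw0); field; easy. }
  rewrite hh; apply csum_scal, csum_plus; [apply csum_scal|]; [now apply hU|now apply hV].
- intros J r q hJ hy [hr1 hr2] _.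
  assert (hr : r ^ 2 < snd c * r0).
  { fold rho; rewrite <- (pow2_sqrt rho) by lra; simpl; nra. }
  assert (ere : cd_re y = fst c).
  { destruct (st_y S) as (Jy & hJy & ->); now apply cd_re_sl. }
  split.
  + apply (cassini_coef _ _ _ _ _ _ _ _ _ (fun _ => 1%C) r0 AU J _ r q S E); auto.
    { intros i p n hp; now apply hU. }
    intros z k1 k2 k3; rewrite (proj1 (cassini_u_sl _ _ _ _ _ _ _ J z S hJ)), cd_zpow_sl by easy.
    rewrite (st_f S J z hJ k1 k2 k3), ev_smul by easy; apply ev_ext; intros i; ring.
  + apply (cassini_coef _ _ _ _ _ _ _ _ _ m2 r0 AV J _ r q S E); auto.
    { intros i p n hp; now apply hV. }
    intros z k1 k2 k3; rewrite (proj1 (cassini_u_sl _ _ _ _ _ _ _ J z S hJ)), cd_zpow_sl by easy.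
    rewrite (st_f S J z hJ k1 k2 k3), ere, <- (sl_real d J), sl_minus, !ev_smul by easy.
    apply ev_ext; intros i; unfold m2; ring.
Qed.

(** * The three cases *)

Lemma least_nat (P : nat -> Prop) : (exists n, P n) -> exists n, P n /\ forall m, P m -> (n <= m)%nat.
Proof.
intros [n hn]; revert hn; induction n as [n IH] using (well_founded_induction Wf_nat.lt_wf); intros hn.
destruct (classic (exists m, (m < n)%nat /\ P m)) as [(m & h1 & h2)|h]; [now apply (IH m)|].
exists n; split; [easy|]; intros m hm; destruct (Nat.le_gt_cases n m); [easy|].
exfalso; apply h; now exists m.
Qed.

Lemma Glb_INR_min (phi : nat -> nat) (P : nat -> Prop) k : P k -> (forall m, P m -> (phi k <= phi m)%nat) ->
  Glb_Rbar (fun r => exists m, r = INR (phi m) /\ P m) = Finite (INR (phi k)).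
Proof.
intros hk hm; apply is_glb_Rbar_unique; split.
- intros x (m & -> & h); apply le_INR; auto.
- intros b hb; apply hb; now exists k.
Qed.

Lemma Glb_empty (E : R -> Prop) : (forall r, ~ E r) -> Glb_Rbar E = p_infty.
Proof.
intros h; apply is_glb_Rbar_unique; split; [intros x hx; now apply h in hx|].
intros b _; now destruct b.
Qed.

Lemma ord_cases d (Om : CD d -> Prop) f w :
  (ord Om f w = p_infty /\ forall m, ~ pole_bound Om f w m) \/
  (exists k, ord Om f w = Finite (INR k) /\ pole_bound Om f w k /\ forall m, pole_bound Om f w m -> (k <= m)%nat).
Proof.
destruct (classic (exists m, pole_bound Om f w m)) as [h|h].
- right; destruct (least_nat _ h) as (k & h1 & h2); exists k; split; [|easy].
  now apply (Glb_INR_min (fun m => m) (pole_bound Om f w)).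
- left; split; [|intros m hm; apply h; now exists m].
  apply Glb_empty; intros r (m & _ & hm); apply h; now exists m.
Qed.

Lemma removable_case_of_growth d Omt y f c Dt h : circular Omt -> open Omt ->
  setting d Omt y f c Dt h -> grows d h c 0 -> removable_case Omt y f.
Proof.
intros hcirc hopen S hg; assert (hd := st_d S).
destruct (extension_exists _ _ _ _ _ _ _ _ S hg) as [g E].
destruct (slice_extension _ _ _ _ _ _ _ _ _ S E) as (G & hG & [hx1 hx2] & _).
assert (hext : extends (off_sphere Omt y) f Omt G).
{ split; [easy|]; intros x hx; rewrite hx2 by easy; simpl; apply cd_mul_1_l. }
assert (hO : forall w, sphere y w -> Omt w).
{ intros w hw; apply (st_sphere S) in hw as (I & hI & ->).
  apply (st_Om S I c hI), (st_Dc S). }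
split; [|split; [now exists G|split]].
- intros w hw; split; [now apply (singularity_sphere _ _ _ _ _ _ _ _ S)|].
  exists Omt, G; exact (conj hcirc (conj hopen (conj (hO w hw) (conj hG hext)))).
- apply (Glb_INR_min (fun k => 2 * k)%nat) with (k := O); [|intros; lia].
  exact (spherical_exists _ _ _ _ _ _ _ _ _ S E).
- intros w hw; apply (st_sphere S) in hw as (I & hI & ->).
  apply (Glb_INR_min (fun m => m) (pole_bound _ f (sl I c)) O); [|intros; lia].
  exact (pole_bound_exists _ _ _ _ _ _ _ _ _ I S E hI).
Qed.

Lemma polar_case_of_growth d Omt y f c Dt h k :
  setting d Omt y f c Dt h -> grows d h c (S k) -> ~ grows d h c k -> polar_case Omt y f.
Proof.
intros St hg hng; assert (hd := st_d St); assert (hd3 : (d <= 3)%nat) by lia.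
assert (hDc := st_Dc St).
destruct (extension_exists _ _ _ _ _ _ _ _ St hg) as [g E].
destruct (slice_extension _ _ _ _ _ _ _ _ _ St E) as (G & hG & hext & hval).
assert (hmin : forall m, grows d h c m -> (S k <= m)%nat).
{ intros m hm; destruct (Nat.le_gt_cases (S k) m); [easy|]; exfalso; apply hng.
  apply grows_mono with (2 := hm); lia. }
assert (sp := st_sphere St).
split.
- intros w hw; apply sp in hw as (I & hI & ->); split.
  + exists (S k); exact (pole_bound_exists _ _ _ _ _ _ _ _ _ I St E hI).
  + intros hr; apply (removable_grows _ _ _ _ _ _ _ I St hI) in hr; apply hmin in hr; lia.
- exists (S k); split; [easy|]; exists G; split; [easy|split; [exact hext|split; [|split; [|split]]]].
  + intros w1 w2 h1 h2 z1 z2; apply sp in h1 as (I1 & hI1 & ->); apply sp in h2 as (I2 & hI2 & ->).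
    rewrite hval in z1, z2 by easy; destruct (classic (I1 = I2)) as [->|hn]; [easy|].
    (* Two zeros of the extension on the sphere annihilate the stem value at [c], which lowers the
       growth and contradicts minimality. *)
    destruct (ev_two_units d I1 I2 hd3 hI1 hI2 hn) as (K & _ & HK).
    exfalso; apply hng, (zero_lowers_growth _ _ _ _ _ _ _ _ _ St E); intros i.
    apply Cmod_eq_0, Rle_antisym; [|apply Cmod_ge_0].
    assert (n0 : norm (zero : CD d) <= 0) by (rewrite norm_zero; lra).
    replace 0 with (K * 0) by ring; apply HK; [rewrite z1|rewrite z2]; exact n0.
  + apply (Glb_INR_min (fun k => 2 * k)%nat) with (k := S k).
    * exact (spherical_exists _ _ _ _ _ _ _ _ _ St E).
    * intros m (u & v & h1 & h2); assert (S k <= m)%nat; [|lia].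
      apply hmin, (spherical_grows _ _ _ _ _ _ _ u v m St h1 h2).
  + intros w hw hnz; apply sp in hw as (I & hI & ->); rewrite hval in hnz by easy; split.
    * apply (Glb_INR_min (fun m => m) (pole_bound _ f (sl I c)) (S k)).
      -- exact (pole_bound_exists _ _ _ _ _ _ _ _ _ I St E hI).
      -- intros m hm; destruct (Nat.le_gt_cases (S k) m) as [|hlt]; [easy|]; exfalso; apply hnz.
         apply (low_growth_zero _ _ _ _ _ _ _ _ m _ I St E hI); [|easy].
         exact (pole_bound_grows _ _ _ _ _ _ _ I m St hI hm).
    * apply (pole_limit _ _ _ _ _ _ _ (S k) g I St E); auto; lia.
  (* The leading Laurent coefficient is zero here, so already [k], one less than the minimal
     exponent, bounds the pole order. *)
  + intros w hw hz; apply sp in hw as (I & hI & ->); rewrite hval in hz by easy.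
    pose proof (pole_bound_pred _ _ _ _ _ _ _ _ _ I St E hI hz) as hp.
    destruct (ord_cases d (off_sphere Omt y) f (sl I c)) as [[_ hno]|(m & -> & _ & hm)].
    * now apply hno in hp.
    * apply lt_INR; apply hm in hp; lia.
Qed.

Lemma essential_case_of_growth d Omt y f c Dt h :
  setting d Omt y f c Dt h -> (forall k, ~ grows d h c k) -> essential_case Omt y f.
Proof.
intros S hn; assert (hd := st_d S); assert (hd3 : (d <= 3)%nat) by lia.
assert (sp := st_sphere S).
assert (two : forall I I' m m', imag_unit I -> imag_unit I' -> I <> I' ->
  pole_bound (off_sphere Omt y) f (sl I c) m -> pole_bound (off_sphere Omt y) f (sl I' c) m' -> False).
{ intros I I' m m' hI hI' hne h1 h2; apply (hn (Nat.max m m')).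
  apply (grows_of_two_slices d h c I I'); auto.
  - exact (pole_bound_grows _ _ _ _ _ _ _ I m S hI h1).
  - exact (pole_bound_grows _ _ _ _ _ _ _ I' m' S hI' h2). }
split; [|split].
- assert (ex : exists I0 : CD d, imag_unit I0 /\
    forall I, imag_unit I -> I <> I0 -> forall m, ~ pole_bound (off_sphere Omt y) f (sl I c) m).
  (* A point of finite order, if there is one, is the exception; otherwise an arbitrary point is
     named. *)
  { destruct (classic (exists (I : CD d) m, imag_unit I /\ pole_bound (off_sphere Omt y) f (sl I c) m))
      as [(I & m & hI & h1)|h1].
    - exists I; split; [easy|]; intros I' hI' hne m' h2; exact (two I' I m' m hI' hI hne h2 h1).
    - destruct (unit_exists d ltac:(lia)) as [J hJ]; exists J; split; [easy|].
      intros I hI _ m hm; apply h1; now exists I, m. }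
  destruct ex as (I0 & hI0 & H0); exists (sl I0 c); split; [apply sp; now exists I0|].
  intros w hw hne; assert (hs := singularity_sphere _ _ _ _ _ _ _ _ S hw).
  apply sp in hw as (I & hI & ->).
  assert (hI0n : I <> I0) by (intros ->; now apply hne).
  split; [split; [exact hs|intros [m hm]; exact (H0 I hI hI0n m hm)]|].
  destruct (ord_cases d (off_sphere Omt y) f (sl I c)) as [[e _]|(m & _ & hm & _)]; [exact e|].
  now apply (H0 I hI hI0n) in hm.
- apply Glb_empty; intros r (k0 & _ & u & v & h1 & h2).
  exact (hn k0 (spherical_grows _ _ _ _ _ _ _ u v k0 S h1 h2)).
- intros U k hU1 hU2; set (E := fun s => _).
  (* A finite supremum is a bound; the value [m_infty] would mean that there are no such points at
     all, and then the bound 0 holds vacuously. *)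
  destruct (Lub_Rbar_correct E) as [hub _]; destruct (Lub_Rbar E) as [M| |]; [exfalso|easy|exfalso].
  + apply (hn k), (bounded_on_neighbourhood_grows _ _ _ _ _ _ _ U k M S hU2).
    intros x h1 h2; apply (hub (norm (cd_pow (Defs.Delta y x) k * f x)%cd)); now exists x.
  + apply (hn k), (bounded_on_neighbourhood_grows _ _ _ _ _ _ _ U k 0 S hU2).
    intros x h1 h2; exfalso; apply (hub (norm (cd_pow (Defs.Delta y x) k * f x)%cd)); now exists x.
Qed.

(** The growth conditions are exhaustive and imply the cases. Conversely the spherical order is 0,
    finite and positive, or infinite in the three cases, so no two of them are compatible and each
    case returns its growth condition. *)
Lemma cases_growth d Omt y f c Dt h : circular Omt -> open Omt -> setting d Omt y f c Dt h ->
  (removable_case Omt y f <-> grows d h c 0) /\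
  (polar_case Omt y f <-> ~ grows d h c 0 /\ exists k, grows d h c k) /\
  (essential_case Omt y f <-> forall k, ~ grows d h c k).
Proof.
intros hcirc hopen S.
assert (c1 := removable_case_of_growth _ _ _ _ _ _ _ hcirc hopen S).
assert (c2 : ~ grows d h c 0 -> (exists k, grows d h c k) -> polar_case Omt y f).
{ intros h0 hk; destruct (least_nat _ hk) as ([|k] & h1 & h2); [easy|].
  apply (polar_case_of_growth _ _ _ _ _ _ _ k S h1); intros h3; apply h2 in h3; lia. }
assert (c3 := essential_case_of_growth _ _ _ _ _ _ _ S).
assert (e1 : removable_case Omt y f -> sph_ord (off_sphere Omt y) f y = Finite 0) by (now intros (_ & _ & e & _)).
assert (e2 : polar_case Omt y f -> exists k, k <> O /\ sph_ord (off_sphere Omt y) f y = Finite (INR (2 * k)))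
  by (intros (_ & k & hk & g & _ & _ & _ & e & _); now exists k).
assert (e3 : essential_case Omt y f -> sph_ord (off_sphere Omt y) f y = p_infty) by (now intros (_ & e & _)).
assert (pos : forall k, k <> O -> INR (2 * k) <> 0) by (intros k hk; apply not_0_INR; lia).
split; [|split]; (split; [intros hcase|tauto]).
- destruct (classic (grows d h c 0)) as [|h0]; [easy|exfalso].
  apply e1 in hcase; destruct (classic (exists k, grows d h c k)) as [hk|hk].
  + destruct (e2 (c2 h0 hk)) as (k & h1 & h2); rewrite h2 in hcase; injection hcase; now apply pos.
  + rewrite e3 in hcase; [easy|]; apply c3; intros k hk'; apply hk; now exists k.
- destruct (e2 hcase) as (k & h1 & h2); split.
  + intros h0; rewrite (e1 (c1 h0)) in h2; injection h2 as h2; apply (pos k h1); now symmetry.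
  + apply NNPP; intros hk; rewrite e3 in h2; [easy|]; apply c3; intros j hj; apply hk; now exists j.
- intros k hk; apply e3 in hcase; destruct (classic (grows d h c 0)) as [h0|h0].
  + rewrite (e1 (c1 h0)) in hcase; easy.
  + destruct (e2 (c2 h0 (ex_intro _ k hk))) as (j & _ & h2); rewrite h2 in hcase; easy.
Qed.

Theorem theorem6p4 (d : nat) (hd : (1 <= d <= 3)%nat)
    (Omt : CD d -> Prop) (hcirc : circular Omt) (hopen : open Omt)
    (y : CD d) (hy : Omt y) (hyR : ~ exists r : R, y = cd_real r)
    (f : CD d -> CD d) (hf : slice_regular (off_sphere Omt y) f) :
  let Om := off_sphere Omt y in
  let yc := cd_conj y in
  (removable_case Omt y f \/ polar_case Omt y f \/ essential_case Omt y f) /\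
  ((removable_case Omt y f <->
      ord Om f y = Finite 0 /\ ord Om f yc = Finite 0) /\
   (polar_case Omt y f <->
      is_finite (ord Om f y) /\ is_finite (ord Om f yc) /\
      ~ (ord Om f y = Finite 0 /\ ord Om f yc = Finite 0)) /\
   (essential_case Omt y f <->
      ~ (is_finite (ord Om f y) /\ is_finite (ord Om f yc)))) /\
  (forall J : CD d, imag_unit J -> slice J y ->
     let bounded := fun k : nat =>
       bounded_near Om J y f k y /\ bounded_near Om J y f k yc in
     (removable_case Omt y f <-> bounded 0%nat) /\
     (polar_case Omt y f <-> ~ bounded 0%nat /\ exists k, bounded k) /\
     (essential_case Omt y f <-> forall k, ~ bounded k)).
Proof.
intros Om yc; assert (hd3 : (d <= 3)%nat) by lia.
destruct (setting_exists d hd Omt hcirc hopen y hy hyR f hf) as (c & Dt & h & S).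
destruct (cases_growth _ _ _ _ _ _ _ hcirc hopen S) as (g1 & g2 & g3).
destruct (st_y S) as (J0 & hJ0 & ey).
assert (hJ0' := imag_unit_opp d J0 hJ0); assert (hne := unit_neq_opp d J0 hd3 hJ0).
(* With the same [c] the point y^c belongs to the unit [-J0], distinct from [J0]; thus y and y^c are
   two points of the sphere that suffice to control the stem function. *)
assert (eyc : yc = sl (opp J0) c) by (unfold yc; rewrite ey, cd_conj_sl, sl_opp by easy; reflexivity).
assert (o1 : forall m m', pole_bound Om f y m -> pole_bound Om f yc m' -> grows d h c (Nat.max m m')).
{ intros m m' h1 h2; rewrite ey in h1; rewrite eyc in h2.
  apply (grows_of_two_slices d h c J0 (opp J0)); auto.
  - exact (pole_bound_grows _ _ _ _ _ _ _ J0 m S hJ0 h1).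
  - exact (pole_bound_grows _ _ _ _ _ _ _ (opp J0) m' S hJ0' h2). }
assert (o2 : forall k, grows d h c k -> pole_bound Om f y k /\ pole_bound Om f yc k).
{ intros k hk; destruct (extension_exists _ _ _ _ _ _ _ _ S hk) as [g E]; rewrite eyc; split.
  - rewrite ey; exact (pole_bound_exists _ _ _ _ _ _ _ _ _ J0 S E hJ0).
  - exact (pole_bound_exists _ _ _ _ _ _ _ _ _ (opp J0) S E hJ0'). }
(* An order is a minimum of pole bounds: two bounds 0 give growth exponent 0 by [o1], and growth
   exponent 0 makes 0 a bound at both points by [o2]. *)
assert (z0 : (ord Om f y = Finite 0 /\ ord Om f yc = Finite 0) <-> grows d h c 0).
{ destruct (ord_cases d Om f y) as [[e1 n1]|(k1 & e1 & p1 & m1)],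
    (ord_cases d Om f yc) as [[e2 n2]|(k2 & e2 & p2 & m2)]; rewrite e1, e2; split; try easy;
    try (intros hg; apply o2 in hg as [h1 h2]; exfalso; (now apply n1 in h1) || now apply n2 in h2).
  - intros [h1 h2]; injection h1 as h1; injection h2 as h2.
    apply (INR_eq k1 0) in h1; apply (INR_eq k2 0) in h2; subst; exact (o1 _ _ p1 p2).
  - intros hg; apply o2 in hg as [h1 h2]; apply m1 in h1; apply m2 in h2.
    replace k1 with O by lia; replace k2 with O by lia; auto. }
assert (zf : (is_finite (ord Om f y) /\ is_finite (ord Om f yc)) <-> exists k, grows d h c k).
{ destruct (ord_cases d Om f y) as [[e1 n1]|(k1 & e1 & p1 & m1)],
    (ord_cases d Om f yc) as [[e2 n2]|(k2 & e2 & p2 & m2)]; rewrite e1, e2; split; try easy;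
    try (intros [k hg]; apply o2 in hg as [h1 h2]; exfalso; (now apply n1 in h1) || now apply n2 in h2).
  intros _; exists (Nat.max k1 k2); exact (o1 _ _ p1 p2). }
split; [|split].
- rewrite g1, g2, g3; destruct (classic (grows d h c 0)) as [|n0]; [tauto|right].
  destruct (classic (exists k, grows d h c k)) as [|nk]; [tauto|right].
  intros k hk; apply nk; now exists k.
- split; [|split].
  + rewrite g1, z0; tauto.
  + rewrite g2, z0, <- zf; tauto.
  + rewrite g3, zf; split; [intros hn [k hk]; exact (hn k hk)|intros hn k hk; apply hn; now exists k].
- intros J hJ hJy bounded.
  assert (hb : forall k, bounded k <-> grows d h c k).
  { intros k; assert (hcs := hJy); rewrite ey in hcs; apply slice_sl in hcs as [c' e].
    (* As y is not real, [J0] and [-J0] are the only units whose slice contains it. *)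
    assert (hJJ : (J0 = J /\ opp J0 = opp J) \/ (J0 = opp J /\ opp J0 = J)).
    { destruct (sl_eq_nonreal d J0 J c c' hd3 hJ0 hJ (st_c S) e) as [[-> _]|[-> _]];
        [left|right]; split; auto; vec. }
    assert (b1 := bounded_near_grows _ _ _ _ _ _ _ J J0 k S hJ hJy ltac:(tauto)).
    assert (b2 := bounded_near_grows _ _ _ _ _ _ _ J (opp J0) k S hJ hJy ltac:(tauto)).
    rewrite <- eyc in b2; rewrite <- ey in b1; unfold bounded, Om; rewrite b1, b2; split.
    - intros [h1 h2]; rewrite <- (Nat.max_id k); now apply (grows_of_two_slices d h c J0 (opp J0)).
    - intros hk; split; now apply grows_slice. }
  rewrite g1, g2, g3, hb; split; [tauto|split; split].
  + intros [h0 [k hk]]; split; [easy|exists k; now apply hb].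
  + intros [h0 [k hk]]; split; [easy|exists k; now apply hb].
  + intros hn k hk; apply (hn k), hb, hk.
  + intros hn k hk; apply (hn k), hb, hk.
Qed.
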